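(* Let $A>0$. If $f\in PW_A^2(\mathbb{H})$, then $$f(\mathbf{q})=\frac{A}{\pi}\int_{-\infty}^{\infty}\operatorname{sinc}\!\left(\frac{A}{\pi}(\mathbf{q}-t)\right)f(t)\,dt,\qquad \mathbf{q}\in\mathbb{H}.$$
   Context: $\mathbb{H}$ denotes the real quaternions with the usual norm, $\mathbb{S}=\{I\in\mathbb{H}: I^2=-1\}$, and $\mathbb{C}_I=\{x+Iy:x,y\in\mathbb{R}\}$ for $I\in\mathbb{S}$. Left slice regular: a real differentiable function $f:\mathbb{H}\to\mathbb{H}$ is left slice regular (written $f\in\mathscr{R}_l(\mathbb{H})$) if for every $I\in\mathbb{S}$ its restriction $f_I$ to $\mathbb{C}_I$ satisfies $\frac12\left(\frac{\partial}{\partial x}+I\frac{\partial}{\partial y}\right)f_I(x+Iy)=0$. Fourier transform: for $I\in\mathbb{S}$ and $F:\mathbb{R}\to\mathbb{H}$ in $L^1(\mathbb{R})$, $\mathscr{F}_I(F)(t)=\frac{1}{\sqrt{2\pi}}\int_{\mathbb{R}}e^{-Ixt}F(x)\,dx$ (exponential on the left), extended to $L^2(\mathbb{R})$ in the usual way; supports are in the almost-everywhere sense. Slice regular Paley-Wiener space: $PW_A^2(\mathbb{H})=\{f\in\mathscr{R}_l(\mathbb{H}): f|_{\mathbb{R}}\in L^2(\mathbb{R}),\ \operatorname{supp}\mathscr{F}_I(f|_{\mathbb{R}})\subset[-A,A]\text{ for every }I\in\mathbb{S}\}$. The quaternionic sinc function is $\operatorname{sinc}(\mathbf{q})=\sum_{k=0}^{\infty}\mathbf{q}^{2k}\frac{(-\pi^2)^k}{(2k+1)!}$,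 $\mathbf{q}\in\mathbb{H}$. *)

(* Defs.v *)
From HB Require Import structures.
From mathcomp Require Import all_boot all_order all_algebra.
From mathcomp Require Import ring lra.
From mathcomp Require Import all_classical all_reals all_analysis.

Set Implicit Arguments.
Unset Strict Implicit.
Unset Printing Implicit Defensive.

Import Order.TTheory GRing.Theory Num.Theory.
Import numFieldNormedType.Exports.

Local Open Scope classical_set_scope.
Local Open Scope ring_scope.

(* [Quat a b c d] is a + b i + c j + d k. *)
Record quat (R : Type) := Quat {qre : R; qi : R; qj : R; qk : R}.

Definition quat_tuple R (q : quat R) : R * R * R * R :=
  (qre q, qi q, qj q, qk q).
Definition tuple_quat R (t : R * R * R * R) : quat R :=
  let: (a, b, c, d) := t in Quat a b c d.

Lemma quat_tupleK R : cancel (@quat_tuple R) (@tuple_quat R).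
Proof. by case. Qed.

HB.instance Definition _ (R : choiceType) :=
  Choice.copy (quat R) (can_type (@quat_tupleK R)).

Section QuatAlgebra.
Variable R : realType.
Implicit Types p q r : quat R.

Definition qadd p q :=
  Quat (qre p + qre q) (qi p + qi q) (qj p + qj q) (qk p + qk q).
Definition qopp q := Quat (- qre q) (- qi q) (- qj q) (- qk q).
Definition qzero : quat R := Quat 0 0 0 0.
Definition qone : quat R := Quat 1 0 0 0.
Definition qscale (a : R) q := Quat (a * qre q) (a * qi q) (a * qj q) (a * qk q).
Definition qmul p q := Quat
  (qre p * qre q - qi p * qi q - qj p * qj q - qk p * qk q)
  (qre p * qi q + qi p * qre q + qj p * qk q - qk p * qj q)
  (qre p * qj q - qi p * qk q + qj p * qre q + qk p * qi q)
  (qre p * qk q + qi p * qj q - qj p * qi q + qk p * qre q).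
Definition qnorm q : R :=
  Num.sqrt (qre q ^+ 2 + qi q ^+ 2 + qj q ^+ 2 + qk q ^+ 2).

Fact qaddA : associative qadd.
Proof. by move=> p q r; congr Quat => /=; ring. Qed.
Fact qaddC : commutative qadd.
Proof. by move=> p q; congr Quat => /=; ring. Qed.
Fact qadd0 : left_id qzero qadd.
Proof. by case=> a b c d; congr Quat => /=; ring. Qed.
Fact qaddN : left_inverse qzero qopp qadd.
Proof. by move=> p; congr Quat => /=; ring. Qed.

HB.instance Definition _ :=
  GRing.isZmodule.Build (quat R) qaddA qaddC qadd0 qaddN.

Fact qmulA : associative qmul.
Proof. by move=> p q r; congr Quat => /=; ring. Qed.
Fact qmul1q : left_id qone qmul.
Proof. by case=> a b c d; congr Quat => /=; ring. Qed.
Fact qmulq1 : right_id qone qmul.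
Proof. by case=> a b c d; congr Quat => /=; ring. Qed.
Fact qmulDl : left_distributive qmul +%R.
Proof. by move=> p q r; congr Quat => /=; ring. Qed.
Fact qmulDr : right_distributive qmul +%R.
Proof. by move=> p q r; congr Quat => /=; ring. Qed.
Fact qone_neq0 : qone != 0.
Proof. by apply/eqP => -[/eqP]; rewrite oner_eq0. Qed.

HB.instance Definition _ := GRing.Zmodule_isNzRing.Build (quat R)
  qmulA qmul1q qmulq1 qmulDl qmulDr qone_neq0.

Fact qscaleA a b q : qscale a (qscale b q) = qscale (a * b) q.
Proof. by congr Quat => /=; ring. Qed.
Fact qscale1 : left_id 1 qscale.
Proof. by case=> a b c d; congr Quat => /=; ring. Qed.
Fact qscaleDr : right_distributive qscale +%R.
Proof. by move=> a p q; congr Quat => /=; ring. Qed.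
Fact qscaleDl q : {morph qscale^~ q : a b / a + b}.
Proof. by move=> a b; congr Quat => /=; ring. Qed.

HB.instance Definition _ := GRing.Zmodule_isLmodule.Build R (quat R)
  qscaleA qscale1 qscaleDr qscaleDl.

Fact qscaleAl (a : R) p q : a *: (p * q) = (a *: p) * q.
Proof. by congr Quat => /=; ring. Qed.
Fact qscaleAr (a : R) p q : a *: (p * q) = p * (a *: q).
Proof. by congr Quat => /=; ring. Qed.

HB.instance Definition _ := GRing.Lmodule_isLalgebra.Build R (quat R) qscaleAl.
HB.instance Definition _ := GRing.Lalgebra_isAlgebra.Build R (quat R) qscaleAr.

Let sq q : R := qre q ^+ 2 + qi q ^+ 2 + qj q ^+ 2 + qk q ^+ 2.

Let sq_ge0 q : 0 <= sq q.
Proof. by rewrite !addr_ge0 ?sqr_ge0. Qed.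

Fact qnormD p q : qnorm (p + q) <= qnorm p + qnorm q.
Proof.
pose dot := qre p * qre q + qi p * qi q + qj p * qj q + qk p * qk q.
have dotE : sq p * sq q = dot ^+ 2
    + (qre p * qi q - qi p * qre q) ^+ 2 + (qre p * qj q - qj p * qre q) ^+ 2
    + (qre p * qk q - qk p * qre q) ^+ 2 + (qi p * qj q - qj p * qi q) ^+ 2
    + (qi p * qk q - qk p * qi q) ^+ 2 + (qj p * qk q - qk p * qj q) ^+ 2.
  by rewrite /sq /dot; ring.
have dot_le : dot <= qnorm p * qnorm q.
  rewrite (le_trans (ler_norm _))// -sqrtr_sqr -sqrtrM ?sq_ge0//.
  by rewrite ler_wsqrtr// -/(sq p) -/(sq q) dotE -!addrA lerDl !addr_ge0 ?sqr_ge0.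
rewrite -(@ler_pXn2r _ 2)// ?nnegrE ?addr_ge0 ?sqrtr_ge0//.
have sqD : sq (p + q) = sq p + dot *+ 2 + sq q by rewrite /sq /dot /=; ring.
rewrite sqrrD !sqr_sqrtr -?/(sq _) ?sq_ge0// sqD.
by rewrite lerD2r lerD2l lerMn2r dot_le orbT.
Qed.

Fact qnormZ (a : R) q : qnorm (a *: q) = `|a| * qnorm q.
Proof.
rewrite -sqrtr_sqr -sqrtrM ?sqr_ge0//; congr Num.sqrt.
by rewrite /=; ring.
Qed.

Fact qnorm0_eq0 q : qnorm q = 0 -> q = 0.
Proof.
move=> /eqP; rewrite sqrtr_eq0 => q0.
have {q0} : sq q == 0 by rewrite eq_le sq_ge0 andbT.
rewrite !paddr_eq0 ?addr_ge0 ?sqr_ge0// !sqrf_eq0.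
by case: q => a b c d /= /andP[/andP[/andP[/eqP-> /eqP->] /eqP->] /eqP->].
Qed.

HB.instance Definition _ :=
  Lmodule_isNormed.Build R (quat R) qnormD qnormZ qnorm0_eq0.

End QuatAlgebra.

Section Analysis.
Variable R : realType.
Local Notation H := (quat R).
Local Notation mu := (@lebesgue_measure R).

(* Real numbers [x] are viewed in [H] as [x%:A]. *)

Definition imag_unit : set H := [set I | I ^+ 2 = -1].

Definition slice_regular (f : H -> H) : Prop :=
  (forall q, differentiable f q) /\
  forall I, imag_unit I -> forall x y : R,
    2^-1 *: (derive1 (fun s : R => f (s%:A + I * y%:A)) x
             + I * derive1 (fun s : R => f (x%:A + I * s%:A)) y) = 0.

Definition qexp (q : H) : H := limn (series (fun k => (k`!%:R : R)^-1 *: q ^+ k)).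

Definition qsinc (q : H) : H := limn (series (fun k =>
  ((- pi ^+ 2) ^+ k / ((2 * k).+1)`!%:R : R) *: q ^+ (2 * k))).

Definition qmeasurable (F : R -> H) : Prop :=
  [/\ measurable_fun setT (fun x => qre (F x)),
      measurable_fun setT (fun x => qi (F x)),
      measurable_fun setT (fun x => qj (F x)) &
      measurable_fun setT (fun x => qk (F x))].

Definition qLnorm (p : \bar R) (F : R -> H) : \bar R :=
  ('N[mu]_p [EFin \o (fun x => `|F x|%R)])%E.

Definition qLp (p : \bar R) (F : R -> H) : Prop :=
  qmeasurable F /\ (qLnorm p F < +oo)%E.

(* Componentwise Lebesgue integral over the real line; meaningful when
   [qLp 1 F]. *)
Definition qintegral (F : R -> H) : H :=
  Quat (\int[mu]_(x in setT) qre (F x)) (\int[mu]_(x in setT) qi (F x))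
       (\int[mu]_(x in setT) qj (F x)) (\int[mu]_(x in setT) qk (F x)).

Definition fourier1 (I : H) (F : R -> H) (t : R) : H :=
  (Num.sqrt (2 * pi))^-1 *:
    qintegral (fun x => qexp (- (I * (x * t)%:A)) * F x).

(* [G] is (a representative of) the image of [F] in L^2 under the extension by
   continuity of [fourier1 I] from the dense subspace of functions that are both
   in L^1 and L^2. *)
Definition is_fourier2 (I : H) (F G : R -> H) : Prop :=
  qLp 2%:E G /\
  forall Fn : nat -> R -> H,
    (forall n, qLp 1%:E (Fn n) /\ qLp 2%:E (Fn n)) ->
    qLnorm 2%:E (fun x => Fn n x - F x) @[n --> \oo] --> 0%E ->
    qLnorm 2%:E (fun t => fourier1 I (Fn n) t - G t) @[n --> \oo] --> 0%E.

(* Complement of the largest open set on which [F] vanishes almost everywhere. *)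
Definition ess_supp (F : R -> H) : set R :=
  ~` \bigcup_(U in [set U : set R |
       open U /\ {ae mu, forall x, U x -> F x = 0}]) U.

Definition paley_wiener (A : R) : set (H -> H) := [set f |
  [/\ slice_regular f,
      qLp 2%:E (fun x => f x%:A) &
      forall I, imag_unit I -> exists G : R -> H,
        is_fourier2 I (fun x => f x%:A) G /\ ess_supp G `<=` `[- A, A] ] ].

End Analysis.

(* Main.v *)
Require Import Defs.
From HB Require Import structures.
From mathcomp Require Import all_boot all_order all_algebra.
From mathcomp Require Import ring lra.
From mathcomp Require Import all_classical all_reals all_analysis.
From mathcomp Require Import measurable_realfun.
Import Order.TTheory GRing.Theory Num.Theory.
Import numFieldNormedType.Exports.
Local Open Scope classical_set_scope.
Local Open Scope ring_scope.

Set Implicit Arguments.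
Unset Strict Implicit.
Unset Printing Implicit Defensive.

(** Let [F] be the restriction of [f] to the real line and [G] its Fourier
    transform with respect to [i].  The sinc integral of [F] turns out to be an
    explicit slice regular extension of [F]; since a slice regular function is
    determined by its values on the real line, it is [f].

    The transform in the mean.  Left multiplication by [exp(- i x t)] acts
    separately on the coordinates along (1, i) and (j, k), so [F] splits into two
    complex functions [a + i b], whose transforms [g1 + i g2] vanish outside
    [[- A, A]] ([fourier_pairs], [ess_supp_ae]).  For truncations of [F] Fubini's
    theorem computes the integral of [exp(y t + i x t)] against the transform over
    a segment; the limit is the multiplication formula
    [fourier_pair_multiplication], in which [F] is integrated against the kernel
    [K(u) = int_al^be exp(y t) exp(- i t u) dt] at [u = s - x].  This kernel decays
    like [1 / (1 + |u|)], so that its products with square integrable functions are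
    integrable.

    Two instances of the multiplication formula are used.  With the damping
    [exp(- e |t|)] the kernel is close to [2 e / (u^2 + e^2)], a multiple of the
    Poisson kernel, and the limit [e -> 0] gives the inversion formula: the integral
    of [exp(i x t) G(t)] over [[- A, A]] is [sqrt(2 pi) F(x)], at every [x] because
    [F] is continuous ([fourier_inversion]).  With the segment [[- A, A]] and a fixed
    [y], comparing power series shows
    [2 A sinc((A / pi) (x + I y - s))
      = int_(- A)^A exp(y t) (cos(t (s - x)) + I sin(t (s - x))) dt]
    for every imaginary unit [I] ([qsinc_kernel]).  Hence the sinc integral at
    [x + I y] is [U(x, y) + I V(x, y)], where [U] and [V] do not depend on [I].
    The parity of the kernels in [y] expresses [U] and [V] by the integrals of
    [exp(+-y t + i x t) G(t)] over [[- A, A]], which can be differentiated under the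
    integral sign; they satisfy the Cauchy-Riemann equations, and [U = F], [V = 0]
    for [y = 0] by inversion ([ext_cauchy_riemann]).

    Uniqueness.  On each slice the difference of [f] and [U + I V] satisfies the
    Cauchy-Riemann equations and vanishes on the real axis.  Slice regularity only
    provides derivatives at each point, so no continuity of the derivatives may be
    assumed.  Goursat's bisection ([circulation0]) yields a primitive [P] of the
    difference, and a Carleman type argument shows [P = 0]: the function
    [|P|^2 exp(2 lam s)] with [s] strictly subharmonic has no positive interior
    maximum ([no_interior_max]), and for a suitable [s] letting [lam] tend to
    infinity forces [P] to vanish ([cauchy_riemann_identity], [slice_identity]). *)

(** * Derivatives of functions of one real variable *)

Section OneVariable.
Variable R : realType.
Implicit Types f g : R -> R.

(** Bisection and Taylor estimates produce and consume explicit bounds on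
    increments; this lemma and the next translate between such bounds and
    derivatives defined as limits. *)
Lemma is_derive_of_bound f (x a : R) :
  (forall e, 0 < e -> exists2 d, 0 < d &
     forall h, `|h| <= d -> `|f (x + h) - f x - a * h| <= e * `|h|) ->
  is_derive x 1 f a.
Proof.
move=> H.
have cv : h^-1 *: (f (h *: (1 : R) + x) - f x) @[h --> 0^'] --> a.
  apply/cvgrPdist_le => /= e e0.
  have [d d0 Hd] := H _ e0.
  near=> h.
  have h0 : h != 0 by near: h; exact: nbhs_dnbhs_neq.
  rewrite distrC (_ : _ - a = h^-1 * (f (x + h) - f x - a * h)); last first.
    by rewrite /GRing.scale /= mulr1 (addrC h); field.
  rewrite normrM normfV mulrC ler_pdivrMr ?normr_gt0//.
  by apply: Hd; near: h; exact: dnbhs0_le.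
split; first by apply/cvg_ex; exists a.
exact: cvg_lim.
Unshelve. all: by end_near. Qed.

Lemma bound_of_is_derive f (x a : R) : is_derive x 1 f a ->
  (forall e, 0 < e -> exists2 d, 0 < d &
     forall h, `|h| <= d -> `|f (x + h) - f x - a * h| <= e * `|h|).
Proof.
move=> [df dfE] e e0.
have /cvgrPdist_le/(_ _ e0) : h^-1 *: (f (h *: (1 : R) + x) - f x) @[h --> 0^'] --> a.
  by move/cvg_ex: df => [l fl]; move: dfE; rewrite /derive (cvg_lim _ fl)// => <-.
move=> [/= d d0 Hd].
exists (d / 2); first by rewrite divr_gt0.
move=> h hd; have [->|h0] := eqVneq h 0.
  by rewrite addr0 mulr0 subr0 subrr normr0 mulr0.
have := Hd h; rewrite /= sub0r normrN => /(_ _ h0).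
rewrite distrC (_ : _ - a = h^-1 * (f (x + h) - f x - a * h)); last first.
  by rewrite /GRing.scale /= mulr1 (addrC h); field.
rewrite normrM normfV mulrC ler_pdivrMr ?normr_gt0//; apply.
by rewrite (le_lt_trans hd)// ltr_pdivrMr// mulr_natr mulr2n ltrDl.
Qed.

Lemma is_derive_continuous f (x a : R) : is_derive x 1 f a -> {for x, continuous f}.
Proof. by case=> df _; apply: differentiable_continuous; apply/derivable1_diffP. Qed.

Lemma mean_value f (df : R -> R) (a b : R) : a <= b ->
  (forall x, a <= x <= b -> is_derive x 1 f (df x)) ->
  exists2 c, a <= c <= b & f b - f a = df c * (b - a).
Proof.
move=> ab H.
have [||c /[!in_itv]/= cab E] := @MVT_segment R f df a b ab.
- by move=> x /[!in_itv]/= /andP[ax xb]; apply: H; rewrite !ltW.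
- by apply: continuous_in_subspaceT => x /[!inE]/= /[!in_itv]/=;
    move=> /H; exact: is_derive_continuous.
- by exists c.
Qed.

(** If the second derivative [l] were positive, [df] would be positive just to
    the right of [x], and [f] would exceed [f x] there by the mean value theorem.
    Differentiability of [df] at the single point [x] is enough for this. *)
Lemma second_derivative_max f (df : R -> R) (x l e : R) : 0 < e ->
  (forall t, `|t - x| <= e -> is_derive t 1 f (df t)) ->
  (forall t, `|t - x| <= e -> f t <= f x) ->
  is_derive x 1 df l -> df x = 0 /\ l <= 0.
Proof.
move=> e0 Hf fmax Hdf.
have dfx : df x = 0.
  have Hx : is_derive x 1 f (df x) by apply: Hf; rewrite subrr normr0 ltW.
  have := @derive1_at_max R f (x - e) (x + e) x.
  case.
  - by rewrite lerD2l; apply: (@le_trans _ _ 0); rewrite ?oppr_le0 ltW.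
  - move=> t /[!in_itv]/= /andP[xt tx]; suff [] : is_derive t 1 f (df t) by [].
    by apply: Hf; rewrite ler_norml; apply/andP; split; lra.
  - by rewrite in_itv/=; apply/andP; split; lra.
  - move=> t /[!in_itv]/= /andP[xt tx].
    by apply: fmax; rewrite ler_norml; apply/andP; split; lra.
  by move=> _ E; case: Hx => _ <-; rewrite E.
split=> //; rewrite leNgt; apply/negP => l0.
have l20 : 0 < l / 2 by rewrite divr_gt0.
have [d d0 Hd] := bound_of_is_derive Hdf l20.
pose m := Num.min d e.
have m0 : 0 < m by rewrite lt_min d0.
have := @MVT R f df x (x + m); rewrite ltrDl => /(_ m0).
have nm t : x <= t <= x + m -> `|t - x| <= m.
  by move=> /andP[? ?]; rewrite ler_norml; apply/andP; split; lra.
have me : m <= e by rewrite ge_min lexx orbT.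
case.
- move=> t /[!in_itv]/= /andP[xt tx].
  by apply: Hf; apply: le_trans me; apply: nm; rewrite !ltW.
- apply: continuous_in_subspaceT => t /[!inE]/= /[!in_itv]/= tx.
  by apply: is_derive_continuous (Hf _ _); apply: le_trans me; apply: nm.
move=> c /[!in_itv]/= /andP[xc cx] E.
have := fmax (x + m); rewrite {1}(addrC x) addrK gtr0_norm// => /(_ me).
rewrite -subr_le0 E (addrC x) addrK pmulr_lle0//; apply/negP; rewrite -ltNge.
have := Hd (c - x); rewrite (addrC x) subrK dfx subr0 (_ : `|c - x| = c - x); last first.
  by rewrite gtr0_norm// subr_gt0.
have cd : c - x <= d.
  by apply: (@le_trans _ _ m); [rewrite lerBlDl ltW|rewrite ge_min lexx].
move=> /(_ cd).
rewrite ler_norml => /andP[+ _].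
have : 0 < l * (c - x) by rewrite mulr_gt0 // subr_gt0.
set k := c - x; lra.
Qed.

End OneVariable.

(** * Goursat's theorem on rectangles *)

Section Goursat.
Variable R : realType.

(** Total differentiability at [(x, y)] with gradient [(a, b)], curried so that
    partial functions and rectangles can be used without product types. *)
Definition frechet2 (u : R -> R -> R) (x y a b : R) := forall e, 0 < e ->
  exists2 d, 0 < d & forall h k, `|h| <= d -> `|k| <= d ->
    `|u (x + h) (y + k) - u x y - (a * h + b * k)| <= e * (`|h| + `|k|).

Lemma frechet2_derive1 u x y a b : frechet2 u x y a b ->
  is_derive x (1 : R) (u^~ y) a.
Proof.
move=> H; apply: is_derive_of_bound => e e0; have [d d0 Hd] := H _ e0.
exists d => // h hd; have := Hd h 0 hd; rewrite normr0 !addr0 mulr0 !addr0.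
by apply; rewrite ltW.
Qed.

Lemma frechet2_derive2 u x y a b : frechet2 u x y a b ->
  is_derive y (1 : R) (u x) b.
Proof.
move=> H; apply: is_derive_of_bound => e e0; have [d d0 Hd] := H _ e0.
exists d => // h hd; have := Hd 0 h; rewrite normr0 !addr0 mulr0 !add0r.
by apply => //; rewrite ltW.
Qed.

Lemma nested_dyadic (a : nat -> R) w : 0 <= w ->
  (forall n, a n <= a n.+1 <= a n + w / 2 ^+ n.+1) ->
  exists x, forall n, a n <= x <= a n + w / 2 ^+ n.
Proof.
move=> w0 H.
have mono n k : a n <= a (n + k)%N.
  elim: k => [|k IH]; rewrite ?addn0// addnS (le_trans IH)//.
  by have /andP[] := H (n + k)%N.
have upper n k : a (n + k)%N + w / 2 ^+ (n + k) <= a n + w / 2 ^+ n.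
  elim: k => [|k IH]; rewrite ?addn0// addnS (le_trans _ IH)//.
  have /andP[_ Hu] := H (n + k)%N.
  rewrite (le_trans (lerD Hu (lexx _)))// -addrA lerD2l.
  by rewrite exprS invfM le_eqVlt; apply/orP; left; apply/eqP; set t := (2 ^+ _)^-1; field.
have bnd m n : a m <= a n + w / 2 ^+ n.
  have [mn|nm] := leqP m n.
    rewrite -(subnKC mn) (le_trans (mono m (n - m)%N))// lerDl.
    by rewrite divr_ge0// exprn_ge0.
  rewrite -(subnKC (ltnW nm)); apply: le_trans (upper n (m - n)%N).
  by rewrite lerDl divr_ge0// exprn_ge0.
have hs : has_sup (range a).
  split; first by exists (a 0%N), 0%N.
  by exists (a 0%N + w / 2 ^+ 0) => _ [m _ <-]; exact: bnd.
exists (sup (range a)) => n; apply/andP; split.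
  by apply: ub_le_sup; [case: hs|exists n].
by apply: ge_sup; [case: hs|move=> _ [m _ <-]; exact: bnd].
Qed.

(* The form [M dx + N dy] is closed: [L] is both the y-derivative of [M] and the
   x-derivative of [N].  [PM] and [PN] are partial primitives, valid to the right of
   [a0] and above [c0], so that [circ] is the circulation around a rectangle
   written without integrals. *)
Variables (M N PM PN : R -> R -> R) (Mx L Ny : R -> R -> R) (a0 c0 : R).
Hypothesis HM : forall x y, frechet2 M x y (Mx x y) (L x y).
Hypothesis HN : forall x y, frechet2 N x y (L x y) (Ny x y).
Hypothesis HPM : forall x y, a0 < x -> is_derive x (1 : R) (PM y) (M x y).
Hypothesis HPN : forall x y, c0 < y -> is_derive y (1 : R) (PN x) (N x y).

Let circ a b c d :=
  PM c b - PM c a + (PN b d - PN b c) - (PM d b - PM d a) - (PN a d - PN a c).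

(* The affine parts of [M] and [N] at [(x0, y0)] have circulation zero because their
   mixed coefficients agree.  The mean value theorem expresses the circulation by
   values of [M] and [N], so only their differentiability remainders are left. *)
Let circ_local x0 y0 e : 0 < e -> exists2 dl, 0 < dl &
  forall a b c d, a0 < a -> c0 < c -> a <= x0 <= b -> c <= y0 <= d ->
    b - a <= dl -> d - c <= dl ->
    `|circ a b c d| <= e * ((b - a) + (d - c)) ^+ 2.
Proof.
move=> e0; have e20 : 0 < e / 2 by rewrite divr_gt0.
have [d1 d10 H1] := HM x0 y0 e20.
have [d2 d20 H2] := HN x0 y0 e20.
exists (Num.min d1 d2); first by rewrite lt_min d10.
move=> a b c d a0a c0c /andP[ax xb] /andP[cy yd].
rewrite !le_min => /andP[ba1 ba2] /andP[dc1 dc2].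
have ab : a <= b by lra.
have cd : c <= d by lra.
have [|x xab Ex] := @mean_value R (fun x => PM c x - PM d x)
    (fun x => M x c - M x d) a b ab.
  by move=> x /andP[ax' xb']; apply: is_deriveB; apply: HPM; lra.
have [|y ycd Ey] := @mean_value R (fun y => PN b y - PN a y)
    (fun y => N b y - N a y) c d cd.
  by move=> y /andP[cy' yd']; apply: is_deriveB; apply: HPN; lra.
have -> : circ a b c d = (M x c - M x d) * (b - a) + (N b y - N a y) * (d - c).
  by rewrite -Ex -Ey /circ; ring.
have nrm (s t p q : R) : p <= s <= q -> p <= t <= q -> `|t - s| <= q - p.
  move=> /andP[? ?] /andP[? ?]; rewrite ler_norml; apply/andP; split; lra.
set w := b - a in ba1 ba2 *; set h := d - c in dc1 dc2 *.
have w0 : 0 <= w by rewrite subr_ge0.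
have h0 : 0 <= h by rewrite subr_ge0.
have PM1 s t : a <= s <= b -> c <= t <= d ->
   `|M s t - M x0 y0 - (Mx x0 y0 * (s - x0) + L x0 y0 * (t - y0))| <= e / 2 * (w + h).
  move=> sab tcd.
  have sx : `|s - x0| <= w by apply: nrm => //; rewrite ax xb.
  have ty : `|t - y0| <= h by apply: nrm => //; rewrite cy yd.
  have := H1 (s - x0) (t - y0) (le_trans sx ba1) (le_trans ty dc1).
  rewrite (addrC x0) (addrC y0) !subrK => /le_trans; apply.
  by rewrite ler_pM2l// lerD.
have PN1 s t : a <= s <= b -> c <= t <= d ->
   `|N s t - N x0 y0 - (L x0 y0 * (s - x0) + Ny x0 y0 * (t - y0))| <= e / 2 * (w + h).
  move=> sab tcd.
  have sx : `|s - x0| <= w by apply: nrm => //; rewrite ax xb.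
  have ty : `|t - y0| <= h by apply: nrm => //; rewrite cy yd.
  have := H2 (s - x0) (t - y0) (le_trans sx ba2) (le_trans ty dc2).
  rewrite (addrC x0) (addrC y0) !subrK => /le_trans; apply.
  by rewrite ler_pM2l// lerD.
have cI : c <= c <= d by rewrite lexx.
have dI : c <= d <= d by rewrite lexx cd.
have aI : a <= a <= b by rewrite lexx.
have bI : a <= b <= b by rewrite lexx ab.
have m1 := PM1 _ _ xab cI; have m2 := PM1 _ _ xab dI.
have n1 := PN1 _ _ bI ycd; have n2 := PN1 _ _ aI ycd.
have -> : (M x c - M x d) * w + (N b y - N a y) * h =
  (M x c - M x d + L x0 y0 * h) * w + (N b y - N a y - L x0 y0 * w) * h by ring.
have e1 : `|M x c - M x d + L x0 y0 * h| <= e * (w + h).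
  rewrite (_ : _ + _ = (M x c - M x0 y0 - (Mx x0 y0 * (x - x0) + L x0 y0 * (c - y0)))
     - (M x d - M x0 y0 - (Mx x0 y0 * (x - x0) + L x0 y0 * (d - y0)))); last first.
    by rewrite /h; ring.
  by rewrite (le_trans (ler_normB _ _))// (le_trans (lerD m1 m2))// -mulrDl -splitr.
have e2 : `|N b y - N a y - L x0 y0 * w| <= e * (w + h).
  rewrite (_ : _ - _ = (N b y - N x0 y0 - (L x0 y0 * (b - x0) + Ny x0 y0 * (y - y0)))
     - (N a y - N x0 y0 - (L x0 y0 * (a - x0) + Ny x0 y0 * (y - y0)))); last first.
    by rewrite /w; ring.
  by rewrite (le_trans (ler_normB _ _))// (le_trans (lerD n1 n2))// -mulrDl -splitr.
rewrite (le_trans (ler_normD _ _))// !normrM (ger0_norm w0) (ger0_norm h0).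
have := ler_wpM2r w0 e1; have := ler_wpM2r h0 e2.
set A := `|_| * h; set B := `|_| * w => HA HB.
rewrite (le_trans (lerD HB HA))// expr2 mulrA -mulrDr//.
Qed.

(** Goursat's argument.  If the circulation had modulus [k > 0], one of the four
    halved rectangles would carry at least [k / 4], and so on; near the common point
    of the nested rectangles this contradicts the local estimate, whose bound is an
    arbitrarily small multiple of [1 / 4 ^ n].  The partial derivatives are nowhere
    assumed continuous. *)
Lemma circulation0 a b c d : a0 < a -> a <= b -> c0 < c -> c <= d ->
  circ a b c d = 0.
Proof.
move=> a0a ab c0c cd.
pose w := b - a; pose h := d - c.
have w0 : 0 <= w by rewrite subr_ge0.
have h0 : 0 <= h by rewrite subr_ge0.
pose cq (p : R * R) n := circ p.1 (p.1 + w / 2 ^+ n) p.2 (p.2 + h / 2 ^+ n).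
apply/eqP; apply: contraT => circ0.
pose k := `|circ a b c d|; have k0 : 0 < k by rewrite normr_gt0.
pose Inv n p := [/\ a0 < p.1, c0 < p.2 & k / 4 ^+ n <= `|cq p n|].
have step (np : nat * (R * R)) : exists p' : R * R, Inv np.1 np.2 -> Inv np.1.+1 p' /\
   (np.2.1 <= p'.1 <= np.2.1 + w / 2 ^+ np.1.+1 /\
    np.2.2 <= p'.2 <= np.2.2 + h / 2 ^+ np.1.+1).
  case: np => n [x y] /=.
  have [Iv|] := pselect (Inv n (x, y)); last by move=> Iv; exists (x, y).
  pose w' := w / 2 ^+ n.+1; pose h' := h / 2 ^+ n.+1.
  have w'0 : 0 <= w' by rewrite divr_ge0// exprn_ge0.
  have h'0 : 0 <= h' by rewrite divr_ge0// exprn_ge0.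
  have ww : w / 2 ^+ n = w' + w' by rewrite /w' exprS invfM; set t := _^-1; field.
  have hh : h / 2 ^+ n = h' + h' by rewrite /h' exprS invfM; set t := _^-1; field.
  have kk : k / 4 ^+ n = 4 * (k / 4 ^+ n.+1).
    by rewrite exprS invfM; set t := _^-1; field.
  have [a0x c0y] : a0 < x /\ c0 < y by case: Iv.
  have four : 4 * (k / 4 ^+ n.+1) <= `|cq (x, y) n.+1| + `|cq (x + w', y) n.+1|
     + `|cq (x, y + h') n.+1| + `|cq (x + w', y + h') n.+1|.
    case: Iv => _ _; rewrite kk => /le_trans; apply.
    have -> : cq (x, y) n = cq (x, y) n.+1 + cq (x + w', y) n.+1
       + cq (x, y + h') n.+1 + cq (x + w', y + h') n.+1.
      by rewrite /cq /= ww hh -/w' -/h' /circ !addrA; ring.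
    do 2 (rewrite (le_trans (ler_normD _ _))// lerD2r).
    exact: ler_normD.
  have [|||] : [\/ k / 4 ^+ n.+1 <= `|cq (x, y) n.+1|,
     k / 4 ^+ n.+1 <= `|cq (x + w', y) n.+1|,
     k / 4 ^+ n.+1 <= `|cq (x, y + h') n.+1| |
     k / 4 ^+ n.+1 <= `|cq (x + w', y + h') n.+1| ].
  - have [q1|q1] := lerP (k / 4 ^+ n.+1) `|cq (x, y) n.+1|; first exact: Or41.
    have [q2|q2] := lerP (k / 4 ^+ n.+1) `|cq (x + w', y) n.+1|; first exact: Or42.
    have [q3|q3] := lerP (k / 4 ^+ n.+1) `|cq (x, y + h') n.+1|; first exact: Or43.
    have [q4|q4] := lerP (k / 4 ^+ n.+1) `|cq (x + w', y + h') n.+1|; first exact: Or44.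
    exfalso; move: four q1 q2 q3 q4.
    set t := k / 4 ^+ n.+1; lra.
  - by move=> q; exists (x, y) => _; rewrite /= !lexx !lerDl w'0 h'0.
  - move=> q; exists (x + w', y) => _ /=; rewrite !lexx !lerDl w'0 h'0; split=> //.
    by split => //=; rewrite ltr_wpDr.
  - move=> q; exists (x, y + h') => _ /=; rewrite !lexx !lerDl w'0 h'0; split=> //.
    by split => //=; rewrite ltr_wpDr.
  - move=> q; exists (x + w', y + h') => _ /=; rewrite !lexx !lerDl w'0 h'0; split=> //.
    by split => //=; rewrite ltr_wpDr.
have /choice[F HF] := step.
pose s := fix s n := if n is m.+1 then F (m, s m) else (a, c).
have Is n : Inv n (s n).
  elim: n => [|n IH] /=; last by case: (HF (n, s n) IH).
  split => //=; rewrite expr0 divr1 /cq /= !expr0 !divr1 /w /h.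
  by rewrite (addrC a) (addrC c) !subrK.
have [x0 Hx] : exists x, forall n, (s n).1 <= x <= (s n).1 + w / 2 ^+ n.
  by apply: nested_dyadic => // n; case: (HF (n, s n) (Is n)) => _ [].
have [y0 Hy] : exists x, forall n, (s n).2 <= x <= (s n).2 + h / 2 ^+ n.
  by apply: nested_dyadic => // n; case: (HF (n, s n) (Is n)) => _ [].
(* With this [e] the local bound [e * (w + h) ^+ 2 / 4 ^+ n] is at most
   [k / 2 / 4 ^+ n]; the summand 1 covers degenerate rectangles. *)
pose e := k / (2 * ((w + h) ^+ 2 + 1)).
have D0 : 0 < (w + h) ^+ 2 + 1 by rewrite ltr_wpDl// sqr_ge0.
have e0 : 0 < e by rewrite divr_gt0// mulr_gt0.
have [dl dl0 Hdl] := circ_local x0 y0 e0.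
have [n [wn hn]] : exists n, w / 2 ^+ n <= dl /\ h / 2 ^+ n <= dl.
  have [n /= Hn] : exists n, (w + h) / dl <= 2 ^+ n.
    have /cvgryPge/(_ ((w + h) / dl))[n _ /(_ n (leqnn n)) /= Hn] := @cvgr_idn R.
    exists n; apply: (le_trans Hn); rewrite -natrX ler_nat.
    by rewrite ltnW// ltn_expl.
  rewrite ler_pdivrMr// in Hn.
  have p2 : 0 < 2 ^+ n :> R by rewrite exprn_gt0.
  by exists n; rewrite !ler_pdivrMr// (mulrC dl); split; lra.
have [q1 q2 q3] := Is n.
have := Hdl (s n).1 ((s n).1 + w / 2 ^+ n) (s n).2 ((s n).2 + h / 2 ^+ n) q1 q2
   (Hx n) (Hy n).
rewrite (addrC (s n).1) (addrC (s n).2) !addrK (addrC _ (s n).1) (addrC _ (s n).2).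
move=> /(_ wn hn) /(le_trans q3).
rewrite -mulrDl exprMn exprVn -exprM mulnC exprM (_ : 2 ^+ 2 = 4); last by ring.
rewrite mulrA ler_pM2r ?invr_gt0 ?exprn_gt0// => kD.
suff : e * (w + h) ^+ 2 <= k / 2 by lra.
rewrite /e mulrAC ler_pdivrMr ?mulr_gt0//.
set D := _ ^+ 2; rewrite (_ : k / 2 * _ = k * (D + 1)); last by field.
by rewrite ler_pM2l// lerDl.
Qed.

End Goursat.

(** Computes a derivative by instance search and leaves the equation between the
    value found and the value claimed. *)
Ltac isderiv := notypeclasses refine (is_derive_eq _ _);
  [typeclasses eauto | rewrite /GRing.scale /=].

(** * A maximum principle with exponential weights *)

Section WeightedMaximum.
Variable R : realType.

(** The first order condition for the weighted function gives [m = - 2 s1 n] at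
    the maximum; substituting it into the second order condition eliminates the
    mixed terms and leaves the square of [s1] with a negative sign. *)
Lemma weighted_max (n m s s1 : R -> R) (x k s2 e : R) : 0 < e ->
  (forall t, `|t - x| <= e -> is_derive t 1 n (m t)) ->
  (forall t : R, is_derive t 1 s (s1 t)) ->
  is_derive x 1 m k -> is_derive x 1 s1 s2 ->
  (forall t, `|t - x| <= e -> n t * expR (2 * s t) <= n x * expR (2 * s x)) ->
  m x = - 2 * s1 x * n x /\ k + 2 * s2 * n x - 4 * s1 x ^+ 2 * n x <= 0.
Proof.
move=> e0 Hn Hs Hm Hs1 Hmax.
pose df t := (m t + 2 * s1 t * n t) * expR (2 * s t).
have Hx : is_derive x 1 n (m x) by apply: Hn; rewrite subrr normr0 ltW.
have := @second_derivative_max R (fun t => n t * expR (2 * s t)) df x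
  ((k + 2 * (s2 * n x + s1 x * m x)) * expR (2 * s x)
    + (m x + 2 * s1 x * n x) * (2 * s1 x * expR (2 * s x))) e e0.
case.
- move=> t /Hn nt; have st := Hs t; isderiv.
  by rewrite /df; ring.
- exact: Hmax.
- have sx := Hs x; rewrite /df; isderiv.
  by ring.
rewrite /df => /eqP; rewrite mulf_eq0 (gt_eqF (expR_gt0 _)) orbF => /eqP m0.
have mE : m x = - 2 * s1 x * n x by apply/eqP; rewrite -subr_eq0 -m0; apply/eqP; ring.
rewrite m0 mul0r addr0 pmulr_lle0 ?expR_gt0// => H; split => //.
by apply: le_trans H; rewrite mE le_eqVlt; apply/orP; left; apply/eqP; ring.
Qed.

Variables (p r u v ux vx : R -> R -> R).

(** Let [P = p + i r] be holomorphic with [P' = u + i v], let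
    [s = y^2 - (x - x0)^2 / 2 - c y], which has Laplacian 1, and let [N = |P|^2].
    Adding the second order conditions in both directions gives
    [4 |P'|^2 + 2 lam N - 4 lam^2 |grad s|^2 N <= 0], while the first order
    conditions and [(pu + rv)^2 + (ru - pv)^2 = N |P'|^2] give
    [lam^2 |grad s|^2 N^2 = N |P'|^2].  Together [2 lam N^2 <= 0]. *)
Lemma no_interior_max (x y x0 c lam e : R) : 0 < e -> 0 < lam ->
  (forall s t, `|s - x| <= e -> `|t - y| <= e ->
     [/\ is_derive s (1 : R) (p^~ t) (u s t), is_derive s (1 : R) (r^~ t) (v s t),
         is_derive t (1 : R) (p s) (- v s t) & is_derive t (1 : R) (r s) (u s t)]) ->
  [/\ is_derive x (1 : R) (u^~ y) (ux x y), is_derive x (1 : R) (v^~ y) (vx x y),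
         is_derive y (1 : R) (u x) (- vx x y) & is_derive y (1 : R) (v x) (ux x y)] ->
  let phi s t := (p s t ^+ 2 + r s t ^+ 2) *
     expR (2 * (lam * (t ^+ 2 - (s - x0) ^+ 2 / 2 - c * t))) in
  (forall s t, `|s - x| <= e -> `|t - y| <= e -> phi s t <= phi x y) ->
  p x y ^+ 2 + r x y ^+ 2 = 0.
Proof.
move=> e0 lam0 H1 [ux1 vx1 uy1 vy1] phi Hmax.
have xx : `|x - x| <= e by rewrite subrr normr0 ltW.
have yy : `|y - y| <= e by rewrite subrr normr0 ltW.
have [px1 rx1 py1 ry1] := H1 _ _ xx yy.
have := @weighted_max (fun s => p s y ^+ 2 + r s y ^+ 2)
  (fun s => 2 * (p s y * u s y + r s y * v s y))
  (fun s => lam * (y ^+ 2 - (s - x0) ^+ 2 / 2 - c * y)) (fun s => - lam * (s - x0))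
  x (2 * (u x y ^+ 2 + v x y ^+ 2 + p x y * ux x y + r x y * vx x y)) (- lam) e e0.
case.
- move=> t tx; have [? ? _ _] := H1 _ _ tx yy; isderiv.
  by ring.
- by move=> t; isderiv; field.
- by isderiv; ring.
- by isderiv; ring.
- by move=> t tx; exact: Hmax.
move=> mx kx.
have := @weighted_max (fun t => p x t ^+ 2 + r x t ^+ 2)
  (fun t => 2 * (r x t * u x t - p x t * v x t))
  (fun t => lam * (t ^+ 2 - (x - x0) ^+ 2 / 2 - c * t)) (fun t => lam * (2 * t - c))
  y (2 * (u x y ^+ 2 + v x y ^+ 2 - p x y * ux x y - r x y * vx x y)) (2 * lam) e e0.
case.
- move=> t ty; have [_ _ ? ?] := H1 _ _ xx ty; isderiv.
  by ring.
- by move=> t; isderiv; field.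
- by isderiv; ring.
- by isderiv; ring.
- by move=> t ty; exact: Hmax.
move=> my ky.
move: mx my kx ky.
set sx := - lam * (x - x0); set sy := lam * (2 * y - c).
set N := _ + r x y ^+ 2.
set P := p x y; set Q := r x y; set U := u x y; set V := v x y.
set ux' := ux x y; set vx' := vx x y.
move=> mx my kx ky.
have N0 : 0 <= N by rewrite addr_ge0 ?sqr_ge0.
have ND : (sx ^+ 2 + sy ^+ 2) * N ^+ 2 = N * (U ^+ 2 + V ^+ 2).
  have E1 : P * U + Q * V = - sx * N by lra.
  have E2 : Q * U - P * V = - sy * N by lra.
  transitivity ((P * U + Q * V) ^+ 2 + (Q * U - P * V) ^+ 2).
    by rewrite E1 E2; ring.
  by rewrite /N -/P -/Q; ring.
have S : (4 * (U ^+ 2 + V ^+ 2) + 2 * lam * N - 4 * (sx ^+ 2 + sy ^+ 2) * N) <= 0.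
  apply: le_trans (_ : _ + _ <= 0); last by rewrite -(addr0 0); exact: lerD kx ky.
  by rewrite le_eqVlt; apply/orP; left; apply/eqP; ring.
have {S} : N * (4 * (U ^+ 2 + V ^+ 2) + 2 * lam * N - 4 * (sx ^+ 2 + sy ^+ 2) * N) <= 0.
  by rewrite mulr_ge0_le0.
have -> : N * (4 * (U ^+ 2 + V ^+ 2) + 2 * lam * N - 4 * (sx ^+ 2 + sy ^+ 2) * N) =
  4 * (N * (U ^+ 2 + V ^+ 2)) + 2 * lam * N ^+ 2 - 4 * ((sx ^+ 2 + sy ^+ 2) * N ^+ 2).
  by ring.
rewrite ND addrAC subrr add0r pmulr_rle0 ?mulr_gt0// => NN.
by apply/eqP; rewrite -sqrf_eq0 eq_le NN sqr_ge0.
Qed.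

End WeightedMaximum.

(** * Primitives of Cauchy-Riemann pairs *)

Section Primitive.
Variable R : realType.
Local Notation mu := (@lebesgue_measure R).

Lemma primitive_is_derive (g : R -> R) (a x : R) : continuous g -> a < x ->
  is_derive x 1 (fun x => \int[mu]_(t in `[a, x]) g t) (g x).
Proof.
move=> cg ax.
have ig : mu.-integrable `[a, x + 1] (EFin \o g).
  apply: continuous_compact_integrable; first exact: segment_compact.
  exact: continuous_subspaceT.
have xx1 : x < x + 1 by rewrite ltrDl.
have [d1 d2] := continuous_FTC1_closed xx1 ig ax (cg x).
by apply: DeriveDef; [exact: d1|rewrite -derive1E; exact: d2].
Qed.

Lemma frechet2_continuous (u : R -> R -> R) x y a b : frechet2 u x y a b ->
  {for (x, y), continuous (fun z => u z.1 z.2)}.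
Proof.
move=> H; apply/cvgrPdist_le => /= e e0.
have [d d0 Hd] := H _ ltr01.
pose K := 2 + `|a| + `|b|.
have K0 : 0 < K by rewrite /K -addrA ltr_pwDl.
pose m := Num.min d (e / K).
have m0 : 0 < m by rewrite lt_min d0 divr_gt0.
exists (ball x m, ball y m) => /=.
  by split; apply: nbhsx_ballx.
move=> [s t] [/= sx ty].
rewrite /ball/= in sx ty.
have sxm : `|s - x| <= m by rewrite distrC ltW.
have tym : `|t - y| <= m by rewrite distrC ltW.
have md : m <= d by rewrite ge_min lexx.
have me : m * K <= e by rewrite -ler_pdivlMr// ge_min lexx orbT.
have := Hd _ _ (le_trans sxm md) (le_trans tym md).
rewrite (addrC x) (addrC y) !subrK mul1r => HH.
rewrite distrC (_ : _ - _ = (u s t - u x y - (a * (s - x) + b * (t - y)))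
  + (a * (s - x) + b * (t - y))); last by ring.
rewrite (le_trans (ler_normD _ _))// (le_trans _ me)//.
rewrite (le_trans (lerD HH (ler_normD _ _)))// !normrM.
apply: (@le_trans _ _ (m + m + (`|a| * m + `|b| * m))).
  by rewrite !lerD// ler_wpM2l.
by rewrite /K le_eqVlt; apply/orP; left; apply/eqP; ring.
Qed.

(** The primitive is the integral of [N dy] along vertical segments from the real
    axis, so its y-derivative is immediate.  For the x-derivative the circulation
    around a rectangle standing on the axis is zero: moving the vertical segment
    changes the value by a horizontal integral of [M] at height [y], the one on the
    axis being zero since [M] vanishes there. *)
Lemma potential (M N Mx L Ny : R -> R -> R) :
  (forall x y, frechet2 M x y (Mx x y) (L x y)) ->
  (forall x y, frechet2 N x y (L x y) (Ny x y)) ->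
  (forall x, M x 0 = 0) ->
  exists p : R -> R -> R, (forall x, p x 0 = 0) /\
    forall x y, 0 <= y -> is_derive x (1 : R) (p^~ y) (M x y) /\
                          is_derive y (1 : R) (p x) (N x y).
Proof.
move=> HM HN M0.
(* Starting below the axis makes [y = 0] an interior point. *)
pose PN x y := \int[mu]_(t in `[(-1), y]) N x t.
have cM y : continuous (M^~ y).
  by move=> x; apply: is_derive_continuous (frechet2_derive1 (HM x y)).
have cN x : continuous (N x).
  by move=> y; apply: is_derive_continuous (frechet2_derive2 (HN x y)).
exists (fun x y => PN x y - PN x 0); split=> [x|x y y0]; first by rewrite subrr.
have m1y : -1 < y by apply: lt_le_trans y0; rewrite oppr_lt0.
split; last first.
  have d1 : is_derive y 1 (PN x) (N x y) by apply: primitive_is_derive.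
  by isderiv; rewrite subr0.
pose PM y x' := \int[mu]_(t in `[x - 2, x']) M t y.
have dPM s t : x - 2 < s -> is_derive s (1 : R) (PM t) (M s t).
  by move=> xs; apply: primitive_is_derive.
have x2x : x - 2 < x by rewrite ltrBlDr ltrDl.
apply: (@near_eq_is_derive _ _ _
  (fun s => PM y s - PM y (x - 1) + (PN (x - 1) y - PN (x - 1) 0))); last first.
  have := dPM x y x2x => d1; isderiv.
  by rewrite subr0 addr0.
have a0a : x - 2 < x - 1 by rewrite ltrD2l ltrN2 ltr1n.
near=> s.
have xs : x - 1 <= s.
  by near: s; exists 1 => //= s; rewrite /ball/= ltr_norml => /andP[_]; lra.
have := @circulation0 R M N PM PN Mx L Ny (x - 2) (-1) HM HN dPM.
move=> /(_ (fun s' t ht => primitive_is_derive (cN s') ht) (x - 1) s 0 y a0a xs).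
move=> /(_ _ y0)/wrap[]; first by rewrite oppr_lt0.
have [c _ Ec] := @mean_value R (PM 0) (M^~ 0) (x - 1) s xs
  (fun t ht => dPM t 0 (lt_le_trans a0a (proj1 (andP ht)))).
rewrite M0 mul0r in Ec; rewrite Ec add0r => E.
by apply/eqP; rewrite -subr_eq0 -oppr_eq0; apply/eqP; rewrite -[RHS]E; ring.
Unshelve. all: by end_near. Qed.

Lemma compact_rect (a b c d : R) : compact (`[a, b]%classic `*` `[c, d]%classic).
Proof. by apply: compact_setX; exact: segment_compact. Qed.

Lemma bounded_rect (u : R -> R -> R) (a b c d : R) :
  (forall x y, {for (x, y), continuous (fun z => u z.1 z.2)}) ->
  exists2 K, 0 <= K & forall x y, a <= x <= b -> c <= y <= d -> `|u x y| <= K.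
Proof.
move=> cu.
have : bounded_set ((fun z : R * R => u z.1 z.2) @` (`[a, b]%classic `*` `[c, d]%classic)).
  apply: compact_bounded; apply: continuous_compact; last exact: compact_rect.
  by apply: continuous_subspaceT => -[x y]; exact: cu.
move=> /ex_strict_bound_gt0[K K0 HK].
exists K; first exact: ltW.
by move=> x y xab ycd; apply/ltW/HK; exists (x, y).
Qed.

(** The primitive is controlled only in the closed upper half plane; on rectangles
    standing on the axis its continuity up to the boundary comes from bounds on the
    two partial derivatives. *)
Lemma potential_lipschitz (p M N : R -> R -> R) (a b d K : R) :
  (forall x y, 0 <= y -> is_derive x (1 : R) (p^~ y) (M x y) /\
                          is_derive y (1 : R) (p x) (N x y)) ->
  (forall x y, a <= x <= b -> 0 <= y <= d -> `|M x y| <= K /\ `|N x y| <= K) ->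
  forall x y x' y', a <= x <= b -> 0 <= y <= d -> a <= x' <= b -> 0 <= y' <= d ->
  `|p x' y' - p x y| <= K * (`|x' - x| + `|y' - y|).
Proof.
move=> Hp HK.
have H1 y x x' : 0 <= y <= d -> a <= x <= b -> a <= x' <= b -> x <= x' ->
    `|p x' y - p x y| <= K * `|x' - x|.
  move=> /andP[y0 yd] /andP[ax xb] /andP[ax' xb'] xx'.
  have [t _|c /andP[xc cx'] ->] := @mean_value R (p^~ y) (M^~ y) x x' xx'.
    by have [] := Hp t y y0.
  rewrite normrM ler_wpM2r//.
  have [||//] := HK c y; apply/andP; split => //.
  - exact: le_trans xc.
  - exact: le_trans cx' _.
have H2 x y y' : a <= x <= b -> 0 <= y <= d -> 0 <= y' <= d -> y <= y' ->
    `|p x y' - p x y| <= K * `|y' - y|.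
  move=> /andP[ax xb] /andP[y0 yd] /andP[y0' yd'] yy'.
  have [t /andP[yt _]|c /andP[yc cy'] ->] := @mean_value R (p x) (N x) y y' yy'.
    by have [] := Hp x t (le_trans y0 yt).
  rewrite normrM ler_wpM2r//.
  have [||//] := HK x c; apply/andP; split => //.
  - exact: le_trans yc.
  - exact: le_trans cy' _.
move=> x y x' y' hx hy hx' hy'.
rewrite (_ : _ - _ = (p x' y' - p x y') + (p x y' - p x y)); last by ring.
rewrite (le_trans (ler_normD _ _))// mulrDr lerD//.
  case/orP: (le_total x x') => xx'; first exact: H1.
  by rewrite distrC (distrC x'); exact: H1.
case/orP: (le_total y y') => yy'; first exact: H2.
by rewrite distrC (distrC y'); exact: H2.
Qed.

Lemma lipschitz_within (p : R -> R -> R) (A : set (R * R)) (K : R) : 0 <= K ->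
  (forall z z', A z -> A z' ->
     `|p z'.1 z'.2 - p z.1 z.2| <= K * (`|z'.1 - z.1| + `|z'.2 - z.2|)) ->
  forall z, A z -> (fun z => p z.1 z.2) @ within A (nbhs z) --> p z.1 z.2.
Proof.
move=> K0 H [x y] Az; apply/cvgrPdist_le => /= e e0.
pose m := e / (2 * (K + 1)).
have K10 : 0 < 2 * (K + 1) by rewrite mulr_gt0// ltr_wpDl.
have m0 : 0 < m by rewrite divr_gt0.
exists (ball x m, ball y m) => /=.
  by split; apply: nbhsx_ballx.
move=> [s t] [/= sx ty] As; rewrite distrC.
rewrite /ball/= in sx ty.
have := H _ _ Az As => /= /le_trans; apply.
have : `|s - x| + `|t - y| <= m + m by rewrite lerD// distrC ltW.
move=> /(ler_wpM2l K0) /le_trans; apply.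
have : 2 * (K + 1) * m = e by rewrite /m mulrC divfK// gt_eqF.
nra.
Qed.

End Primitive.

(** * The identity theorem for Cauchy-Riemann pairs *)

Section IdentityTheorem.
Variable R : realType.

Lemma dist_itv (x y lo hi e : R) :
  `|x - y| <= e -> e <= y - lo -> e <= hi - y -> lo <= x <= hi.
Proof. by rewrite ler_norml => /andP[? ?] ? ?; apply/andP; split; lra. Qed.

(** Let [P] be the primitive of [u + i v] vanishing on the axis.  On the rectangle
    [[x1 - rho, x1 + rho] x [0, d]] the function [|P|^2 exp(2 lam s)], with
    [s = y^2 - (x - x1)^2 / 2 - c y], is either zero at its maximum or attains it on
    the boundary.  It vanishes on the bottom side, and on the three other sides [s]
    is at least 1 below its value at [(x1, y0)]; hence
    [|P(x1, y0)|^2 <= C exp(- 2 lam)] for all [lam > 0].  So [P] vanishes on the whole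
    line [y = y0], and with it its x-derivative [u]. *)
Lemma cauchy_riemann_identity (u v ux vx : R -> R -> R) :
  (forall x y, frechet2 u x y (ux x y) (- vx x y)) ->
  (forall x y, frechet2 v x y (vx x y) (ux x y)) ->
  (forall x, u x 0 = 0) -> (forall x, v x 0 = 0) ->
  forall x y, 0 < y -> u x y = 0.
Proof.
move=> Hu Hv u0 v0 x0 y0 y00.
have HNv x y : frechet2 (fun x y => - v x y) x y (- vx x y) (- ux x y).
  move=> e e0; have [d d0 Hd] := Hv x y _ e0; exists d => // h k hd kd.
  rewrite (_ : _ - _ = - (v (x + h) (y + k) - v x y - (vx x y * h + ux x y * k))); last by ring.
  by rewrite normrN; exact: Hd.
have [p [p0 Hp]] := potential Hu HNv u0.
have [r [r0 Hr]] := potential Hv Hu v0.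
(* [c] lets the weight drop by 2 between heights [y0] and [d]; then [rho] is large
   enough for it to drop by 1 on the vertical sides. *)
pose d := y0 + 1; pose c := 2 * y0 + 3; pose rho := c * y0 + 2.
have c0 : 0 < c by rewrite /c; lra.
have cy0 : 0 < c * y0 by rewrite mulr_gt0.
have rho0 : 0 < rho by rewrite /rho; lra.
suff PR x1 : p x1 y0 ^+ 2 + r x1 y0 ^+ 2 = 0.
  have pE : (p^~ y0) = cst 0.
    apply/funext => x1; have /eqP := PR x1.
    by rewrite paddr_eq0 ?sqr_ge0// => /andP[]; rewrite sqrf_eq0 => /eqP.
  have [[_ <-] _] := Hp x0 y0 (ltW y00).
  by rewrite pE derive_cst.
pose a := x1 - rho; pose b := x1 + rho.
have cu x y : {for (x, y), continuous (fun z => u z.1 z.2)}.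
  exact: frechet2_continuous (Hu x y).
have cv x y : {for (x, y), continuous (fun z => v z.1 z.2)}.
  exact: frechet2_continuous (Hv x y).
have [K1 K10 HK1] := @bounded_rect R u a b 0 d cu.
have [K2 K20 HK2] := @bounded_rect R v a b 0 d cv.
pose K := K1 + K2.
have K0 : 0 <= K by rewrite addr_ge0.
pose A : set (R * R) := (`[a, b]%classic `*` `[0, d]%classic).
have inA x y : A (x, y) = ((a <= x <= b) /\ (0 <= y <= d)).
  by rewrite /A /= !in_itv.
have d0 : 0 < d by rewrite /d; lra.
have ax1 : a <= x1 <= b by rewrite /a /b; apply/andP; split; lra.
have y0d : 0 <= y0 <= d by rewrite /d; apply/andP; split; lra.
have A0 : A !=set0 by exists (x1, y0); rewrite inA.
have cA : compact A by exact: compact_rect.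
have HKu x y : a <= x <= b -> 0 <= y <= d -> `|u x y| <= K.
  by move=> xab ycd; rewrite (le_trans (HK1 _ _ xab ycd))// lerDl.
have HKv x y : a <= x <= b -> 0 <= y <= d -> `|v x y| <= K.
  by move=> xab ycd; rewrite (le_trans (HK2 _ _ xab ycd))// lerDr.
have cp z : A z -> (fun z => p z.1 z.2) @ within A (nbhs z) --> p z.1 z.2.
  apply: (lipschitz_within K0) => -[x y] [x' y']; rewrite !inA => -[xab yd] [xab' yd'] /=.
  by apply: (potential_lipschitz Hp) xab yd xab' yd' => s t hs ht; rewrite normrN; auto.
have cr z : A z -> (fun z => r z.1 z.2) @ within A (nbhs z) --> r z.1 z.2.
  apply: (lipschitz_within K0) => -[x y] [x' y']; rewrite !inA => -[xab yd] [xab' yd'] /=.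
  by apply: (potential_lipschitz Hr) xab yd xab' yd' => s t hs ht; auto.
pose Nz (z : R * R) := p z.1 z.2 ^+ 2 + r z.1 z.2 ^+ 2.
have cN : {within A, continuous Nz}.
  apply/subspace_continuousP => z Az.
  by apply: cvgD; rewrite !expr2; apply: cvgM; (exact: cp || exact: cr).
have [zN _ HN] := compact_EVT_max A0 cA cN.
pose C := Nz zN.
have HC z : A z -> Nz z <= C by move=> Az; apply: HN; rewrite inE.
have N0 z : 0 <= Nz z by rewrite addr_ge0 ?sqr_ge0.
have C0 : 0 <= C by exact: N0.
pose sg (lam x y : R) := lam * (y ^+ 2 - (x - x1) ^+ 2 / 2 - c * y).
pose s1 := y0 ^+ 2 - c * y0.
have key lam : 0 < lam -> Nz (x1, y0) <= C * expR (- (2 * lam)).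
  move=> lam0.
  pose phi z := Nz z * expR (2 * sg lam z.1 z.2).
  have cphi : {within A, continuous phi}.
    apply/subspace_continuousP => z Az.
    apply: cvgM; first exact: (subspace_continuousP _ _).1 cN z Az.
    apply: cvg_within_filter.
    apply: (@continuous_comp _ _ _ (fun z : R * R => 2 * sg lam z.1 z.2) expR);
      last exact: continuous_expR.
    have c1 : (fun z : R * R => z.1) @ z --> z.1 by exact: cvg_fst.
    have c2 : (fun z : R * R => z.2) @ z --> z.2 by exact: cvg_snd.
    apply: cvgM; first exact: cvg_cst.
    apply: cvgM; first exact: cvg_cst.
    apply: cvgB; last by apply: cvgM => //; exact: cvg_cst.
    apply: cvgB; first by rewrite !expr2; exact: cvgM.
    apply: cvgM; last exact: cvg_cst.
    by rewrite !expr2; apply: cvgM; apply: cvgB => //; exact: cvg_cst.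
  have [[xm ym]] := compact_EVT_max A0 cA cphi.
  rewrite inE inA => -[/andP[axm xmb] /andP[ym0 ymd]] Hmax.
  have : phi (x1, y0) <= phi (xm, ym) by apply: Hmax; rewrite inE inA.
  rewrite {1}/phi /= {1}/sg subrr expr0n /= mul0r subr0 -/s1 => Hle.
  suff : phi (xm, ym) <= C * expR (2 * (lam * (s1 - 1))).
    move=> /(le_trans Hle).
    rewrite -ler_pdivlMr ?expR_gt0// -mulrA -expRN -expRD => /le_trans; apply.
    by rewrite le_eqVlt; apply/orP; left; apply/eqP; congr (_ * expR _); ring.
  have bdry : xm = a \/ xm = b \/ ym = d -> phi (xm, ym) <= C * expR (2 * (lam * (s1 - 1))).
    move=> Hb; apply: ler_pM => //.
      by apply: HC; rewrite inA axm xmb ym0 ymd.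
    rewrite ler_expR ler_pM2l// /sg ler_pM2l// /s1 /=.
    have rr : rho ^+ 2 >= 2 * (c * y0) + 2.
      by rewrite /rho; move: (c * y0) cy0 => t t0; nra.
    have yy : ym * (ym - c) <= 0.
      by apply: mulr_ge0_le0 => //; rewrite /c; move: ymd; rewrite /d; lra.
    case: Hb => [->|[->|->]].
    - have -> : a - x1 = - rho by rewrite /a; ring.
      by rewrite sqrrN; move: yy rr (sqr_ge0 y0); set t := rho ^+ 2; set t' := y0 ^+ 2; lra.
    - have -> : b - x1 = rho by rewrite /b; ring.
      by move: yy rr (sqr_ge0 y0); set t := rho ^+ 2; set t' := y0 ^+ 2; lra.
    - by move: (sqr_ge0 (xm - x1)); set t := (xm - x1) ^+ 2; rewrite /d /c; lra.
  have [ym0'|ymn0] := eqVneq ym 0.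
    by rewrite /phi /Nz /= ym0' p0 r0 expr0n /= addr0 mul0r mulr_ge0// expR_ge0.
  have {}ym0 : 0 < ym by rewrite lt_def ymn0.
  have [/eqP|xma] := boolP (xm == a); first by move=> H; apply: bdry; left.
  have [/eqP|xmb'] := boolP (xm == b); first by move=> H; apply: bdry; right; left.
  have [/eqP|ymd'] := boolP (ym == d); first by move=> H; apply: bdry; right; right.
  have {xma}axm' : a < xm by rewrite lt_neqAle eq_sym xma.
  have {xmb'}xmb' : xm < b by rewrite lt_neqAle xmb'.
  have {ymd'}ymd' : ym < d by rewrite lt_neqAle ymd'.
  pose e := Num.min (Num.min (xm - a) (b - xm)) (Num.min (ym / 2) (d - ym)).
  have e0 : 0 < e by rewrite !lt_min !subr_gt0 axm' xmb' ymd' divr_gt0.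
  have ine s t : `|s - xm| <= e -> `|t - ym| <= e -> A (s, t) /\ 0 < t.
    move=> q1 q3.
    move: (lexx e); rewrite {2}/e !le_min => /andP[/andP[q2 q2'] /andP[q5' q4]].
    have q5 : e <= ym - ym / 2 by rewrite [X in X - _](splitr ym) addrK.
    have /andP[yt td] := dist_itv q3 q5 q4.
    have t0 : 0 < t by apply: lt_le_trans yt; rewrite divr_gt0.
    by rewrite inA (dist_itv q1 q2 q2') td ltW.
  have : Nz (xm, ym) = 0.
    apply: (@no_interior_max R p r u v ux vx xm ym x1 c lam e e0 lam0).
    - move=> s t sxm tym; have [_ /ltW t0] := ine _ _ sxm tym.
      by have [? ?] := Hp s t t0; have [? ?] := Hr s t t0.
    - by split; [exact: frechet2_derive1 (Hu _ _)|exact: frechet2_derive1 (Hv _ _)|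
               exact: frechet2_derive2 (Hu _ _)|exact: frechet2_derive2 (Hv _ _)].
    - move=> s t sxm tym; have [Ast _] := ine _ _ sxm tym.
      by have := Hmax (s, t); rewrite inE => /(_ Ast).
  by rewrite /phi => ->; rewrite mul0r mulr_ge0// expR_ge0.
change (Nz (x1, y0) = 0).
apply/eqP; rewrite eq_le N0 andbT; apply/ler_addgt0Pr => e e0; rewrite add0r.
pose lam := C / e + 1.
have lam0 : 0 < lam by rewrite /lam ltr_wpDl// divr_ge0// ltW.
apply: le_trans (key _ lam0) _.
rewrite expRN ler_pdivrMr ?expR_gt0//.
have := expR_ge1Dx (2 * lam) => H.
have : C <= e * lam by rewrite /lam mulrDr mulrCA divff ?gt_eqF// !mulr1 lerDl ltW.
move=> /le_trans; apply; rewrite ler_pM2l//; lra.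
Qed.

End IdentityTheorem.

(** * Lebesgue integrals of real functions *)

Section RealIntegrals.
Variable R : realType.
Local Notation mu := (@lebesgue_measure R).
Implicit Types (D : set R) (f g : R -> R).

Definition rintegrable D f := mu.-integrable D (EFin \o f).

Lemma rintegrable_measurable D f : rintegrable D f -> measurable_fun D f.
Proof. by move=> /measurable_int /measurable_EFinP. Qed.

Lemma rintegrable_dominated D f g : measurable D -> measurable_fun D f ->
  (forall x, D x -> `|f x| <= g x) -> rintegrable D g -> rintegrable D f.
Proof.
move=> mD mf fg ig; apply: (le_integrable (mu:=mu) mD _ _ ig); first exact/measurable_EFinP.
by move=> x Dx /=; rewrite lee_fin (le_trans (fg _ Dx))// ler_norm.
Qed.

Lemma rintegrableD D f g : measurable D -> rintegrable D f -> rintegrable D g ->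
  rintegrable D (fun x => f x + g x).
Proof.
move=> mD jf jg.
by have := integrableD (mu:=mu) mD jf jg; apply: eq_integrable.
Qed.

Lemma rintegrableZ D k f : measurable D -> rintegrable D f -> rintegrable D (fun x => k * f x).
Proof.
move=> mD jf.
by have := integrableZl (mu:=mu) mD k jf; apply: eq_integrable.
Qed.

Lemma rintegrableN D f : measurable D -> rintegrable D f -> rintegrable D (fun x => - f x).
Proof.
move=> mD /(rintegrableZ (-1) mD); congr rintegrable; apply/funext => x; exact: mulN1r.
Qed.

Lemma rintegrableB D f g : measurable D -> rintegrable D f -> rintegrable D g ->
  rintegrable D (fun x => f x - g x).
Proof. by move=> mD jf jg; apply: rintegrableD => //; exact: rintegrableN. Qed.

Lemma rintegrable_norm D f : measurable D -> rintegrable D f -> rintegrable D (fun x => `|f x|).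
Proof.
by move=> mD jf; have := integrable_abse (mu:=mu) jf; apply: eq_integrable.
Qed.

Lemma rintegrableS D E f : measurable E -> measurable D -> D `<=` E -> rintegrable E f -> rintegrable D f.
Proof. by move=> mE mD DE; exact: (integrableS (mu:=mu)). Qed.

Lemma continuous_rintegrable_segment (a b : R) f : continuous f -> rintegrable `[a, b] f.
Proof.
move=> cf; apply: continuous_compact_integrable; first exact: segment_compact.
exact: continuous_subspaceT.
Qed.

Lemma cst_rintegrable_segment (a b k : R) : rintegrable `[a, b] (fun => k).
Proof. by apply: continuous_rintegrable_segment => x; exact: cvg_cst. Qed.

Lemma le_norm_rintegral D f g : measurable D -> measurable_fun D f ->
  (forall x, D x -> `|f x| <= g x) -> rintegrable D g ->
  `|\int[mu]_(x in D) f x| <= \int[mu]_(x in D) g x.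
Proof.
move=> mD mf fg ig; have jf := rintegrable_dominated mD mf fg ig.
rewrite (le_trans (le_normr_Rintegral (mu:=mu) mD jf))//.
by apply: (le_Rintegral (mu:=mu) mD) => //; exact: rintegrable_norm.
Qed.

Lemma rintegral_segment_cst (a b k : R) : a <= b ->
  \int[mu]_(x in `[a, b]) k = k * (b - a).
Proof.
move=> ab; rewrite Rintegral_cst//= lebesgue_measure_itv/= lte_fin.
by case: ltgtP ab => // [->] _; rewrite subrr.
Qed.

Lemma rintegral_is_derive f (F : R -> R) (a b : R) : a <= b ->
  (forall x, is_derive x (1 : R) F (f x)) -> continuous f ->
  \int[mu]_(x in `[a, b]) f x = F b - F a.
Proof.
rewrite le_eqVlt => /predU1P[->|ab] dF cf.
  by rewrite set_itv1 Rintegral_set1 subrr.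
have cF : continuous F by move=> x; exact: is_derive_continuous (dF x).
rewrite /Rintegral (@continuous_FTC2 R f F a b ab)//.
- exact: continuous_subspaceT.
- split.
  + by move=> x _; case: (dF x).
  + by apply: cvg_at_right_filter; exact: cF.
  + by apply: cvg_at_left_filter; exact: cF.
- by move=> x _; rewrite derive1E; case: (dF x).
Qed.

Lemma eq_rintegral D f g : (forall x, D x -> f x = g x) ->
  \int[mu]_(x in D) f x = \int[mu]_(x in D) g x.
Proof. by move=> fg; apply: eq_Rintegral => x; rewrite inE; exact: fg. Qed.

Lemma rintegral_eq0 D f : measurable D -> (forall x, D x -> f x = 0) ->
  \int[mu]_(x in D) f x = 0.
Proof.
move=> mD f0; rewrite (@eq_rintegral D f (cst 0))// (Rintegral_cst mu mD) mul0r//.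
Qed.

Lemma continuous_parameter_integral D (k : R -> R -> R) (w : R -> R) : measurable D -> rintegrable D w ->
  (forall u, measurable_fun D (k u)) -> (forall u s, D s -> `|k u s| <= w s) ->
  (forall s, continuous (k^~ s)) -> continuous (fun u => \int[mu]_(s in D) k u s).
Proof.
move=> mD iw mk kw ck u.
pose B : set R := `](u - 1), (u + 1)[%classic.
have H1 : {ae mu, forall y, D y -> {in B, continuous (k^~ y)}}.
  by apply: aeW => y _ x _; exact: ck.
have H2 x : B x -> {ae mu, forall y, D y -> `|k x y| <= w y}.
  by move=> _; apply: aeW => y; exact: kw.
apply: (continuity_under_integral (mu:=mu) mD
  (fun x _ => rintegrable_dominated mD (mk x) (kw x) iw) H1 iw H2).
by rewrite inE/= in_itv/= ltrBlDr !ltrDl ltr01.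
Qed.

(** Domination by a product of integrable functions makes the kernel integrable on
    the product, so Fubini's theorem applies. *)
Lemma rintegral_swap (D1 D2 : set R) (k : R -> R -> R) (w1 w2 : R -> R) :
  measurable D1 -> measurable D2 ->
  measurable_fun setT (fun z : R * R => k z.1 z.2) ->
  rintegrable D1 w1 -> rintegrable D2 w2 -> (forall t, 0 <= w1 t) -> (forall s, 0 <= w2 s) ->
  (forall t s, `|k t s| <= w1 t * w2 s) ->
  \int[mu]_(t in D1) \int[mu]_(s in D2) k t s =
  \int[mu]_(s in D2) \int[mu]_(t in D1) k t s.
Proof.
move=> mD1 mD2 mk i1 i2 w10 w20 kw.
have mk1 t : measurable_fun setT (k t).
  exact: (measurableT_comp mk (pair1_measurable t)).
have mk2 s : measurable_fun setT (k^~ s).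
  exact: (measurableT_comp mk (pair2_measurable s)).
pose f (z : R * R) := (k z.1 z.2 * (\1_D1 z.1 * \1_D2 z.2))%:E.
have mf : measurable_fun setT f.
  apply/measurable_EFinP; apply: measurable_funM => //.
  by apply: measurable_funM; apply: measurableT_comp => //; exact: measurable_indic.
have inner t : (\int[mu]_(s in setT) f (t, s) =
   (\1_D1 t * \int[mu]_(s in D2) k t s)%:E)%E.
  have jt : rintegrable D2 (k t).
    apply: (rintegrable_dominated mD2 (measurable_funTS (mk1 t)) (fun s _ => kw t s)).
    exact: rintegrableZ.
  rewrite EFinM /Rintegral fineK; last exact: (integrable_fin_num (mu:=mu)).
  rewrite -(integralZl (mu:=mu) mD2 jt).
  rewrite [RHS]integral_mkcond; apply: eq_integral => s _.
  rewrite /f /= patchE indicE; case: ifPn => sD.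
    by rewrite indicE sD mulr1 mulrC -EFinM.
  by rewrite indicE (negbTE sD) !mulr0.
have inner2 s : (\int[mu]_(t in setT) f (t, s) =
   (\1_D2 s * \int[mu]_(t in D1) k t s)%:E)%E.
  have jt : rintegrable D1 (k^~ s).
    apply: (rintegrable_dominated mD1 (measurable_funTS (mk2 s)) (fun t _ => kw t s)).
    by have := rintegrableZ (w2 s) mD1 i1; congr rintegrable; apply/funext => t; rewrite mulrC.
  rewrite EFinM /Rintegral fineK; last exact: (integrable_fin_num (mu:=mu)).
  rewrite -(integralZl (mu:=mu) mD1 jt).
  rewrite [RHS]integral_mkcond; apply: eq_integral => t _.
  rewrite /f /= patchE !indicE; case: ifPn => tD.
    by rewrite mul1r mulrC -EFinM.
  by rewrite mul0r mulr0.
have maf : measurable_fun setT (abse \o f) by exact: measurableT_comp.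
have jf : (mu \x mu)%E.-integrable setT f.
  apply/integrable12ltyP => //.
  apply: (@le_lt_trans _ _ (\int[mu]_x ((w1 \_ D1) x * \int[mu]_(s in D2) w2 s)%:E)%E).
    apply: ge0_le_integral => //.
    - by move=> t _; exact: integral_ge0.
    - exact: (measurable_fun_fubini_tonelli_F (m2:=mu) (abse \o f) maf (fun=> abse_ge0 _)).
    - apply/measurable_EFinP; apply: measurable_funM => //.
      by apply/(measurable_restrictT _ _).1 => //; exact: rintegrable_measurable.
    move=> t _.
    rewrite EFinM /Rintegral fineK; last exact: (integrable_fin_num (mu:=mu)).
    rewrite -(integralZl (mu:=mu) mD2 i2).
    rewrite [leRHS]integral_mkcond; apply: ge0_le_integral => //.
    - exact: (measurableT_comp maf (pair1_measurable t)).
    - apply/(measurable_restrictT _ _).1 => //; apply/measurable_EFinP.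
      by apply: measurable_funM => //; exact: rintegrable_measurable.
    - move=> s _; rewrite /f /= !patchE !indicE.
      case: ifPn => sD; [case: ifPn => tD|].
      + by rewrite !mulr1; exact: (kw t s).
      + rewrite mul0r mulr0 normr0; change (0%:E <= 0%:E * (w2 s)%:E)%E; by rewrite mul0e.
      + by rewrite !mulr0 normr0.
  under eq_integral do rewrite EFinM muleC.
  have i1' : mu.-integrable setT (EFin \o (w1 \_ D1)).
    by rewrite -restrict_EFin; exact: (proj1 (integrable_mkcond (mu:=mu) _ mD1) i1).
  rewrite integralZl//.
  by rewrite lte_mul_pinfty// ?lee_fin ?Rintegral_ge0//; case/integrableP: i1' => ? ?;
    rewrite ltey_eq integrable_fin_num//; apply/integrableP.
have := Fubini jf.
under eq_integral do rewrite inner.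
under [in RHS]eq_integral do rewrite inner2.
move=> H.
rewrite [LHS]Rintegral_mkcond [RHS]Rintegral_mkcond.
rewrite (@eq_rintegral setT _ (fun t => \1_D1 t * \int[mu]_(s in D2) k t s)); last first.
  by move=> t _; rewrite patchE indicE; case: ifPn; rewrite ?mul1r ?mul0r.
rewrite [in RHS](@eq_rintegral setT _ (fun s => \1_D2 s * \int[mu]_(t in D1) k t s)); last first.
  by move=> t _; rewrite patchE indicE; case: ifPn; rewrite ?mul1r ?mul0r.
by rewrite /Rintegral H.
Qed.

End RealIntegrals.

(** * Square integrable functions *)

Section SquareIntegrable.
Variable R : realType.
Local Notation mu := (@lebesgue_measure R).
Implicit Types (D : set R) (f g a b : R -> R).

Lemma rintegralD D f g : measurable D -> rintegrable D f -> rintegrable D g ->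
  \int[mu]_(x in D) (f x + g x) = \int[mu]_(x in D) f x + \int[mu]_(x in D) g x.
Proof. by move=> mD jf jg; exact: (RintegralD (mu:=mu)). Qed.

Lemma rintegralB D f g : measurable D -> rintegrable D f -> rintegrable D g ->
  \int[mu]_(x in D) (f x - g x) = \int[mu]_(x in D) f x - \int[mu]_(x in D) g x.
Proof. by move=> mD jf jg; exact: (RintegralB (mu:=mu)). Qed.

Lemma rintegralZ D f k : measurable D -> rintegrable D f ->
  \int[mu]_(x in D) (k * f x) = k * \int[mu]_(x in D) f x.
Proof. by move=> mD jf; exact: (RintegralZl (mu:=mu)). Qed.

Lemma le_rintegral D f g : measurable D -> rintegrable D f -> rintegrable D g ->
  (forall x, D x -> f x <= g x) ->
  \int[mu]_(x in D) f x <= \int[mu]_(x in D) g x.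
Proof. by move=> mD jf jg; exact: (le_Rintegral (mu:=mu)). Qed.

Definition sqr_integrable a := measurable_fun setT a /\ rintegrable setT (fun x => a x ^+ 2).

Lemma norm_mul_le_sqrD (x y : R) : `|x * y| <= x ^+ 2 + y ^+ 2.
Proof.
rewrite ler_norml; apply/andP; split.
  by have := sqr_ge0 (x + y); have := sqr_ge0 x; have := sqr_ge0 y; nra.
by have := sqr_ge0 (x - y); have := sqr_ge0 x; have := sqr_ge0 y; nra.
Qed.

Lemma sqr_integrableM a b : sqr_integrable a -> sqr_integrable b -> rintegrable setT (fun x => a x * b x).
Proof.
move=> [ma ia] [mb ib].
apply: (@rintegrable_dominated R setT _ (fun x => a x ^+ 2 + b x ^+ 2)) => //.
- exact: measurable_funM.
- by move=> x _; exact: norm_mul_le_sqrD.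
- exact: rintegrableD.
Qed.

Lemma sqr_integrable_segment a (u v : R) : sqr_integrable a -> rintegrable `[u, v] a.
Proof.
move=> [ma ia].
apply: (@rintegrable_dominated R _ _ (fun x => a x ^+ 2 + 1)) => //.
- exact: measurable_funTS.
- move=> x _; have := norm_mul_le_sqrD (a x) 1; rewrite mulr1 expr1n //.
- apply: rintegrableD => //; last exact: cst_rintegrable_segment.
  by apply: rintegrableS ia.
Qed.

Lemma rintegrable_invDsqr : rintegrable setT (fun x : R => (1 + x ^+ 2)^-1).
Proof.
have c1 : continuous (fun x : R => (1 + x ^+ 2)^-1) := @continuous_oneDsqrV R.
apply/integrableP; split.
  by apply/measurable_EFinP; exact: continuous_measurable_fun.
under eq_integral do rewrite /= ger0_norm ?invr_ge0 ?addr_ge0 ?sqr_ge0//.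
rewrite (@ge0_symfun_integralT R)//.
- rewrite -set_itvcy.
  have := @integral0y_oneDsqr R; rewrite /oneDsqr => ->.
  by rewrite -EFinM ltry.
- by move=> x; rewrite invr_ge0 addr_ge0 ?sqr_ge0.
- by move=> x /=; rewrite sqrrN.
Qed.

Lemma sqr_integrable_decay f (K : R) : measurable_fun setT f ->
  (forall x, f x ^+ 2 <= K * (1 + x ^+ 2)^-1) -> sqr_integrable f.
Proof.
move=> mf Hf; split => //.
apply: (@rintegrable_dominated R _ _ (fun x => K * (1 + x ^+ 2)^-1)) => //.
- exact: measurable_funX.
- by move=> x _; rewrite ger0_norm ?sqr_ge0.
- by apply: rintegrableZ => //; exact: rintegrable_invDsqr.
Qed.

Lemma translate_decay (x s : R) :
  (1 + (s - x) ^+ 2)^-1 <= 2 * (1 + x ^+ 2) * (1 + s ^+ 2)^-1.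
Proof.
have p (t : R) : 0 < 1 + t ^+ 2 by rewrite ltr_pwDl// sqr_ge0.
rewrite -[leLHS]mul1r ler_pdivrMr// mulrAC ler_pdivlMr// mul1r.
have := sqr_ge0 (x * (s - x)); have := sqr_ge0 (s - 2 * x); have := sqr_ge0 x.
nra.
Qed.

Lemma sqr_integrable_translate_decay f (K x : R) : 0 <= K -> measurable_fun setT f ->
  (forall u, f u ^+ 2 <= K * (1 + u ^+ 2)^-1) -> sqr_integrable (fun s => f (s - x)).
Proof.
move=> K0 mf Hf; apply: (@sqr_integrable_decay _ (K * (2 * (1 + x ^+ 2)))).
  apply: measurableT_comp => //; exact: measurable_funB.
move=> s; rewrite (le_trans (Hf _))// -mulrA ler_wpM2l//.
exact: translate_decay.
Qed.

Lemma cvg_integral_segments f : rintegrable setT f ->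
  (fun n : nat => \int[mu]_(x in `[- n%:R, n%:R]) f x) @ \oo --> \int[mu]_x f x.
Proof.
move=> jf; have mf := rintegrable_measurable jf.
pose fn (n : nat) x := (f \_ `[- n%:R, n%:R]%classic) x.
have mfn n : measurable_fun setT (fn n).
  by apply/(measurable_restrictT _ _).1 => //; exact: measurable_funTS.
have := @dominated_cvg _ _ R mu setT measurableT (fun n x => (fn n x)%:E)
  (EFin \o f) (EFin \o (fun x => `|f x|)).
have H1 : forall n, measurable_fun setT (fun x => (fn n x)%:E).
  by move=> n; exact/measurable_EFinP.
have H2 x : (fn n x)%:E @[n --> \oo] --> (f x)%:E.
  apply: cvg_EFin; first exact: nearW.
  apply: cvg_near_cst.
  have [n _ Hn] : \forall n \near \oo, `|x| <= n%:R.
    by have /cvgryPge := @cvgr_idn R; exact.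
  exists n => // m /Hn /=; rewrite ler_norml => xm.
  by rewrite /fn patchE mem_set//= in_itv.
have H3 : mu.-integrable setT (EFin \o (fun x => `|f x|)) by exact: rintegrable_norm.
have H4 n x : (`|(fn n x)%:E| <= (`|f x|)%:E)%E.
  by rewrite lee_fin /fn patchE; case: ifPn => //= _; rewrite normr0.
move=> /(_ H1 (fun x _ => H2 x) (fun x _ => isT) H3 (fun n x _ => H4 n x)).
have -> : (\int[mu]_(x in setT) (EFin \o f) x = (\int[mu]_x f x)%:E)%E.
  by rewrite /Rintegral fineK//; exact: (integrable_fin_num (mu:=mu)).
move=> /fine_cvg H.
rewrite (_ : (fun n => _) = (fun n => \int[mu]_x fn n x)) //.
by apply/funext => n; rewrite Rintegral_mkcond.
Qed.

End SquareIntegrable.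

(** * Exponential kernels *)

Section Kernels.
Variable R : realType.
Local Notation mu := (@lebesgue_measure R).

(** [cos_kernel - i sin_kernel] is the integral of [exp(y t) exp(- i t u)] over
    [[al, be]]. *)
Definition cos_kernel (y al be u : R) := \int[mu]_(t in `[al, be]) (expR (y * t) * cos (t * u)).
Definition sin_kernel (y al be u : R) := \int[mu]_(t in `[al, be]) (expR (y * t) * sin (t * u)).

Lemma continuous_exp_lin (y : R) : continuous (fun t : R => expR (y * t)).
Proof.
move=> t; apply: (@continuous_comp _ _ _ (fun t : R => y * t) expR); last exact: continuous_expR.
by apply: cvgM; [exact: cvg_cst|exact: cvg_id].
Qed.

Lemma continuous_cos_lin (u : R) : continuous (fun t : R => cos (t * u)).
Proof.
move=> t; apply: (@continuous_comp _ _ _ (fun t : R => t * u) (@cos R)); last exact: continuous_cos.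
by apply: cvgM; [exact: cvg_id|exact: cvg_cst].
Qed.

Lemma continuous_sin_lin (u : R) : continuous (fun t : R => sin (t * u)).
Proof.
move=> t; apply: (@continuous_comp _ _ _ (fun t : R => t * u) (@sin R)); last exact: continuous_sin.
by apply: cvgM; [exact: cvg_id|exact: cvg_cst].
Qed.

Lemma continuous_expcos (y u : R) : continuous (fun t : R => expR (y * t) * cos (t * u)).
Proof. by move=> t; apply: cvgM; [exact: continuous_exp_lin|exact: continuous_cos_lin]. Qed.

Lemma continuous_expsin (y u : R) : continuous (fun t : R => expR (y * t) * sin (t * u)).
Proof. by move=> t; apply: cvgM; [exact: continuous_exp_lin|exact: continuous_sin_lin]. Qed.

Lemma norm_cos (x : R) : `|cos x| <= 1.
Proof. by rewrite ler_norml cos_geN1 cos_le1. Qed.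

Lemma norm_sin (x : R) : `|sin x| <= 1.
Proof. by rewrite ler_norml sin_geN1 sin_le1. Qed.

Lemma norm_expM (y t w : R) : `|w| <= 1 -> `|expR (y * t) * w| <= expR (y * t).
Proof. by move=> w1; rewrite normrM ger0_norm ?expR_ge0// ler_piMr ?expR_ge0. Qed.

Variables (y al be : R).
Hypothesis ab : al <= be.

Lemma continuous_cos_kernel : continuous (cos_kernel y al be).
Proof.
apply: (@continuous_parameter_integral R `[al, be] (fun u t => expR (y * t) * cos (t * u))
  (fun t : R => expR (y * t))) => //.
- by apply: continuous_rintegrable_segment; exact: continuous_exp_lin.
- by move=> u; apply: measurable_funTS; apply: continuous_measurable_fun; exact: continuous_expcos.
- by move=> u s _; apply: norm_expM; exact: norm_cos.
- move=> s u; apply: cvgM; first exact: cvg_cst.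
  by apply: (continuous_comp _ (@continuous_cos R _)); apply: cvgM; [exact: cvg_cst|exact: cvg_id].
Qed.

Lemma continuous_sin_kernel : continuous (sin_kernel y al be).
Proof.
apply: (@continuous_parameter_integral R `[al, be] (fun u t => expR (y * t) * sin (t * u))
  (fun t : R => expR (y * t))) => //.
- by apply: continuous_rintegrable_segment; exact: continuous_exp_lin.
- by move=> u; apply: measurable_funTS; apply: continuous_measurable_fun; exact: continuous_expsin.
- by move=> u s _; apply: norm_expM; exact: norm_sin.
- move=> s u; apply: cvgM; first exact: cvg_cst.
  by apply: (continuous_comp _ (@continuous_sin R _)); apply: cvgM; [exact: cvg_cst|exact: cvg_id].
Qed.

(** Integrating the derivatives of [exp(y t) sin(t u)] and [exp(y t) cos(t u)] gives
    two linear relations between the kernels.  They yield both the decay of the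
    kernels in [u] and, solved for the kernels, closed forms. *)
Lemma kernel_parts_sin (u : R) : u * cos_kernel y al be u + y * sin_kernel y al be u =
  expR (y * be) * sin (be * u) - expR (y * al) * sin (al * u).
Proof.
have m : measurable `[al, be]%classic by exact: measurable_itv.
have ic : rintegrable `[al, be] (fun t : R => expR (y * t) * cos (t * u)).
  by apply: continuous_rintegrable_segment; exact: continuous_expcos.
have js : rintegrable `[al, be] (fun t : R => expR (y * t) * sin (t * u)).
  by apply: continuous_rintegrable_segment; exact: continuous_expsin.
rewrite /cos_kernel /sin_kernel -(rintegralZ _ m ic) -(rintegralZ _ m js) -rintegralD//;
  try exact: rintegrableZ.
notypeclasses refine (@rintegral_is_derive R _ (fun t : R => expR (y * t) * sin (t * u)) al be ab _ _).
- by move=> t; isderiv; ring.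
- by move=> t; apply: cvgD; apply: cvgM; (exact: cvg_cst ||
    exact: continuous_expcos || exact: continuous_expsin).
Qed.

Lemma kernel_parts_cos (u : R) : y * cos_kernel y al be u - u * sin_kernel y al be u =
  expR (y * be) * cos (be * u) - expR (y * al) * cos (al * u).
Proof.
have m : measurable `[al, be]%classic by exact: measurable_itv.
have ic : rintegrable `[al, be] (fun t : R => expR (y * t) * cos (t * u)).
  by apply: continuous_rintegrable_segment; exact: continuous_expcos.
have js : rintegrable `[al, be] (fun t : R => expR (y * t) * sin (t * u)).
  by apply: continuous_rintegrable_segment; exact: continuous_expsin.
rewrite /cos_kernel /sin_kernel -(rintegralZ _ m ic) -(rintegralZ _ m js) -rintegralB//;
  try exact: rintegrableZ.
notypeclasses refine (@rintegral_is_derive R _ (fun t : R => expR (y * t) * cos (t * u)) al be ab _ _).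
- by move=> t; isderiv; ring.
- by move=> t; apply: cvgB; apply: cvgM; (exact: cvg_cst ||
    exact: continuous_expcos || exact: continuous_expsin).
Qed.

Let E := \int[mu]_(t in `[al, be]) expR (y * t).

Let cos_kernel_le u : `|cos_kernel y al be u| <= E.
Proof.
apply: le_norm_rintegral => //.
- by apply: measurable_funTS; apply: continuous_measurable_fun; exact: continuous_expcos.
- by move=> x _; apply: norm_expM; exact: norm_cos.
- by apply: continuous_rintegrable_segment; exact: continuous_exp_lin.
Qed.

Let sin_kernel_le u : `|sin_kernel y al be u| <= E.
Proof.
apply: le_norm_rintegral => //.
- by apply: measurable_funTS; apply: continuous_measurable_fun; exact: continuous_expsin.
- by move=> x _; apply: norm_expM; exact: norm_sin.
- by apply: continuous_rintegrable_segment; exact: continuous_exp_lin.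
Qed.

Let decay_aux (v u K : R) : `|v| <= E -> `|u * v| <= K ->
  v ^+ 2 <= (E ^+ 2 + K ^+ 2) * (1 + u ^+ 2)^-1.
Proof.
move=> v1 v2; rewrite ler_pdivlMr ?ltr_pwDl ?sqr_ge0// mulrDr mulr1 -exprMn (mulrC v).
have E0 : 0 <= E := le_trans (normr_ge0 _) v1.
have K0 : 0 <= K := le_trans (normr_ge0 _) v2.
apply: lerD.
  by rewrite -[v ^+ 2]real_normK ?num_real// ler_pXn2r// ?nnegrE.
by rewrite -[(u * v) ^+ 2]real_normK ?num_real// ler_pXn2r// ?nnegrE.
Qed.

(** By the relations above [u] times either kernel is bounded, and so are the
    kernels themselves. *)
Lemma kernel_decay : exists2 K, 0 <= K & forall u,
  cos_kernel y al be u ^+ 2 <= K * (1 + u ^+ 2)^-1 /\ sin_kernel y al be u ^+ 2 <= K * (1 + u ^+ 2)^-1.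
Proof.
pose B := expR (y * be) + expR (y * al).
pose K := B + `|y| * E.
exists (E ^+ 2 + K ^+ 2); first by rewrite addr_ge0 ?sqr_ge0.
move=> u; split; apply: decay_aux => //.
- rewrite (_ : u * _ = (expR (y * be) * sin (be * u) - expR (y * al) * sin (al * u)) -
    y * sin_kernel y al be u); last by rewrite -kernel_parts_sin; ring.
  rewrite (le_trans (ler_normB _ _))// lerD// ?normrM ?ler_wpM2l//.
  by rewrite (le_trans (ler_normB _ _))// lerD// norm_expM// norm_sin.
- rewrite (_ : u * _ = y * cos_kernel y al be u - (expR (y * be) * cos (be * u) -
    expR (y * al) * cos (al * u))); last by rewrite -kernel_parts_cos; ring.
  rewrite (le_trans (ler_normB _ _))// addrC lerD// ?normrM ?ler_wpM2l//.
  by rewrite (le_trans (ler_normB _ _))// lerD// norm_expM// norm_cos.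
Qed.

Lemma sqr_integrable_cos_kernel (x : R) : sqr_integrable (fun s => cos_kernel y al be (s - x)).
Proof.
have [K K0 HK] := kernel_decay.
apply: (@sqr_integrable_translate_decay R (cos_kernel y al be) K) => //.
  by apply: continuous_measurable_fun; exact: continuous_cos_kernel.
by move=> u; case: (HK u).
Qed.

Lemma sqr_integrable_sin_kernel (x : R) : sqr_integrable (fun s => sin_kernel y al be (s - x)).
Proof.
have [K K0 HK] := kernel_decay.
apply: (@sqr_integrable_translate_decay R (sin_kernel y al be) K) => //.
  by apply: continuous_measurable_fun; exact: continuous_sin_kernel.
by move=> u; case: (HK u).
Qed.

Lemma rintegrable_kernels (a b : R -> R) (x : R) :
  sqr_integrable a -> sqr_integrable b -> rintegrable setT
    (fun s => a s * cos_kernel y al be (s - x) + b s * sin_kernel y al be (s - x)).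
Proof.
move=> sa sb; apply: rintegrableD => //.
  exact: (sqr_integrableM sa (sqr_integrable_cos_kernel x)).
exact: (sqr_integrableM sb (sqr_integrable_sin_kernel x)).
Qed.

End Kernels.

(** * Mean square convergence on segments *)

Section L2toL1.
Variable R : realType.
Local Notation mu := (@lebesgue_measure R).

(** [|d| <= eta + d^2 / eta] bounds the integral of [|d|] over the segment by [eta]
    times its length, plus [eta] once the integral of [d^2] is below [eta^2]. *)
Lemma L2_cvg_L1_segment (d : nat -> R -> R) (al be : R) : al <= be ->
  (forall n, measurable_fun setT (d n)) -> (forall n, rintegrable `[al, be] (d n)) ->
  ((\int[mu]_(t in setT) ((d n t) ^+ 2)%:E)%E @[n --> \oo] --> 0%E) ->
  \int[mu]_(t in `[al, be]) `|d n t| @[n --> \oo] --> 0.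
Proof.
move=> ab md id Hd; apply/cvgrPdist_le => /= e e0.
pose eta := e / (be - al + 1).
have w0 : 0 < be - al + 1 by rewrite ltr_wpDl// subr_ge0.
have eta0 : 0 < eta by rewrite divr_gt0.
move/fine_cvgP : Hd => [[N1 _ HN1]] /cvgrPdist_le /= /(_ (eta ^+ 2)).
rewrite exprn_gt0// => /(_ isT)[N2 _ HN2].
exists (maxn N1 N2) => // n /=; rewrite geq_max => /andP[n1 n2].
have m2 : measurable_fun setT (fun t : R => d n t ^+ 2) by exact: measurable_funX.
have d2 : rintegrable setT (fun t : R => d n t ^+ 2).
  apply/integrableP; split.
    exact/measurable_EFinP.
  under eq_integral do rewrite /= ger0_norm ?sqr_ge0//.
  by rewrite ltey_eq HN1.
have d2s : rintegrable `[al, be] (fun t : R => d n t ^+ 2) by apply: rintegrableS d2.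
have i2 : \int[mu]_(t in `[al, be]) (d n t ^+ 2) <= eta ^+ 2.
  have := HN2 _ n2; rewrite /= sub0r normrN => /(le_trans (ler_norm _)).
  apply: le_trans.
  rewrite Rintegral_mkcond; apply: le_rintegral => //.
    rewrite /rintegrable -restrict_EFin.
    exact: (proj1 (integrable_mkcond (mu:=mu) _ (measurable_itv _)) d2s).
  by move=> t _; rewrite patchE; case: ifPn => // _; rewrite sqr_ge0.
rewrite sub0r normrN ger0_norm; last by apply: Rintegral_ge0.
apply: (@le_trans _ _ (\int[mu]_(t in `[al, be]) (eta + eta^-1 * d n t ^+ 2))).
  apply: le_rintegral => //.
  - exact: rintegrable_norm.
  - by apply: rintegrableD => //; [exact: cst_rintegrable_segment|exact: rintegrableZ].
  - move=> t _; have [h|h] := lerP `|d n t| eta.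
      by rewrite (le_trans h)// lerDl mulr_ge0 ?invr_ge0 ?sqr_ge0// ltW.
    apply: ler_wpDl; first exact: ltW.
    rewrite ler_pdivlMl// -real_normK ?num_real// expr2.
    by rewrite ler_wpM2r// ltW.
rewrite rintegralD//; last 2 first.
- exact: cst_rintegrable_segment.
- exact: rintegrableZ.
have -> : \int[mu]_(t in `[al, be]) (eta^-1 * d n t ^+ 2) =
    eta^-1 * \int[mu]_(t in `[al, be]) (d n t ^+ 2) by exact: rintegralZ.
have -> : \int[mu]_(t in `[al, be]) eta = eta * (be - al) by exact: rintegral_segment_cst.
apply: (@le_trans _ _ (eta * (be - al) + eta)).
  rewrite lerD2l (le_trans (ler_wpM2l _ i2)) ?invr_ge0 ?(ltW eta0)//.
  by rewrite expr2 mulKf// gt_eqF.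
by rewrite -[X in _ + X]mulr1 -mulrDr /eta divfK// gt_eqF.
Qed.

End L2toL1.

(** * Fourier transforms in the mean and the multiplication formula *)

Section FourierPair.
Variable R : realType.
Local Notation mu := (@lebesgue_measure R).

(** Real part of [c] times the integral of [exp(- i s t) (a + i b)(s)] over
    [[- n, n]]; replacing [(a, b)] by [(b, - a)] gives the imaginary part. *)
Definition truncated_transform (c : R) (a b : R -> R) (n : nat) (t : R) : R :=
  c * \int[mu]_(s in `[- n%:R, n%:R]) (cos (s * t) * a s + sin (s * t) * b s).

Definition L2_limit (h : nat -> R -> R) (g : R -> R) : Prop :=
  (\int[mu]_(t in setT) ((h n t - g t) ^+ 2)%:E)%E @[n --> \oo] --> 0%E.

(** For [c = 1 / sqrt(2 pi)], [g1 + i g2] is the Fourier transform of [a + i b]. *)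
Definition fourier_pair (c : R) (a b g1 g2 : R -> R) : Prop :=
  [/\ sqr_integrable a /\ sqr_integrable b, sqr_integrable g1 /\ sqr_integrable g2,
      L2_limit (truncated_transform c a b) g1 &
      L2_limit (truncated_transform c b (fun s => - a s)) g2].

Lemma sqr_integrableN (a : R -> R) : sqr_integrable a -> sqr_integrable (fun s => - a s).
Proof.
move=> [ma ia]; split; first exact: measurableT_comp.
by under eq_fun do rewrite sqrrN.
Qed.

Lemma truncated_transformN c (a b : R -> R) n t : sqr_integrable a -> sqr_integrable b ->
  truncated_transform c (fun s => - a s) (fun s => - b s) n t = - truncated_transform c a b n t.
Proof.
move=> sa sb; rewrite /truncated_transform -mulrN; congr (_ * _).
rewrite -[RHS]mulN1r -rintegralZ//; last first.
  have [ma _] := sa; have [mb _] := sb.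
  apply: (@rintegrable_dominated R _ _ (fun s => `|a s| + `|b s|)) => //.
  - apply: measurable_funTS; apply: measurable_funD; apply: measurable_funM => //;
      apply: continuous_measurable_fun; [exact: continuous_cos_lin|exact: continuous_sin_lin].
  - move=> s _; rewrite (le_trans (ler_normD _ _))// !normrM lerD//.
      by rewrite ler_piMl// norm_cos.
    by rewrite ler_piMl// norm_sin.
  - by apply: rintegrableD => //; apply: rintegrable_norm => //; exact: sqr_integrable_segment.
by apply: eq_rintegral => s _; ring.
Qed.

(** Multiplication of both functions by [- i]: a statement about real parts applied
    to the rotated pair is the one about imaginary parts. *)
Lemma fourier_pair_rot c a b g1 g2 : fourier_pair c a b g1 g2 ->
  fourier_pair c b (fun s => - a s) g2 (fun t : R => - g1 t).
Proof.
move=> [[sa sb] [sg1 sg2] L1 L2]; split => //.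
- by split => //; exact: sqr_integrableN.
- by split => //; exact: sqr_integrableN.
rewrite /L2_limit (_ : (fun n => _) = (fun n => (\int[mu]_(t in setT)
  ((truncated_transform c a b n t - g1 t) ^+ 2)%:E)%E))//.
apply/funext => n; apply: eq_integral => t _.
by rewrite truncated_transformN// -opprD sqrrN.
Qed.

Variables (c : R) (a b g1 g2 : R -> R).
Hypothesis F : fourier_pair c a b g1 g2.

Let sa : sqr_integrable a. Proof. by case: F => -[]. Qed.
Let sb : sqr_integrable b. Proof. by case: F => -[]. Qed.
Let sg1 : sqr_integrable g1. Proof. by case: F => _ []. Qed.
Let sg2 : sqr_integrable g2. Proof. by case: F => _ []. Qed.
Let ma : measurable_fun setT a. Proof. by case: sa. Qed.
Let mb : measurable_fun setT b. Proof. by case: sb. Qed.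

Let mcos (t : R) : measurable_fun setT (fun s : R => cos (s * t)).
Proof. by apply: continuous_measurable_fun; exact: continuous_cos_lin. Qed.
Let msin (t : R) : measurable_fun setT (fun s : R => sin (s * t)).
Proof. by apply: continuous_measurable_fun; exact: continuous_sin_lin. Qed.

Let bound (w1 w2 z1 z2 : R) : `|w1| <= 1 -> `|w2| <= 1 ->
  `|w1 * z1 + w2 * z2| <= `|z1| + `|z2|.
Proof.
move=> h1 h2; rewrite (le_trans (ler_normD _ _))// !normrM.
by rewrite lerD// ler_piMl.
Qed.

Let rintegrable_trunc (t : R) n (p q : R -> R) : sqr_integrable p -> sqr_integrable q ->
  rintegrable `[- n%:R, n%:R] (fun s => cos (s * t) * p s + sin (s * t) * q s).
Proof.
move=> sp sq; apply: (@rintegrable_dominated R _ _ (fun s => `|p s| + `|q s|)) => //.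
- apply: measurable_funTS; apply: measurable_funD; apply: measurable_funM => //.
    by case: sp.
  by case: sq.
- by move=> s _; apply: bound; [exact: norm_cos|exact: norm_sin].
- by apply: rintegrableD => //; apply: rintegrable_norm => //; exact: sqr_integrable_segment.
Qed.

Lemma continuous_truncated_transform (p q : R -> R) n : sqr_integrable p -> sqr_integrable q ->
  continuous (truncated_transform c p q n).
Proof.
move=> sp sq t; apply: cvgM; first exact: cvg_cst.
apply: (@continuous_parameter_integral R `[- n%:R, n%:R] (fun t s => cos (s * t)
  * p s + sin (s * t) * q s)
   (fun s => `|p s| + `|q s|)) => //.
- by apply: rintegrableD => //; apply: rintegrable_norm => //; exact: sqr_integrable_segment.
- move=> u; apply: measurable_funTS; apply: measurable_funD; apply: measurable_funM => //.
    by case: sp.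
  by case: sq.
- by move=> u s _; apply: bound; [exact: norm_cos|exact: norm_sin].
- move=> s u; apply: cvgD; apply: cvgM; try exact: cvg_cst.
    apply: (continuous_comp _ (@continuous_cos R _)).
    by apply: cvgM; [exact: cvg_cst|exact: cvg_id].
  apply: (continuous_comp _ (@continuous_sin R _)).
  by apply: cvgM; [exact: cvg_cst|exact: cvg_id].
Qed.

Variables (x y al be : R).
Hypothesis ab : al <= be.

Let T n t := cos (t * x) * truncated_transform c a b n t
  - sin (t * x) * truncated_transform c b (fun s => - a s) n t.

Let TE n t : T n t = c * \int[mu]_(s in `[- n%:R, n%:R])
  (cos (t * (s - x)) * a s + sin (t * (s - x)) * b s).
Proof.
rewrite /T /truncated_transform mulrCA [X in _ - X]mulrCA -mulrBr; congr (_ * _).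
have m : measurable `[- n%:R : R, n%:R]%classic by exact: measurable_itv.
have i1 := rintegrable_trunc t n sa sb.
have i2 := rintegrable_trunc t n sb (sqr_integrableN sa).
rewrite -(rintegralZ _ m i1) -(rintegralZ _ m i2) -rintegralB//; try exact: rintegrableZ.
apply: eq_rintegral => s _.
by rewrite mulrBr cosB sinB (mulrC s t); ring.
Qed.

Let inner_swap n : \int[mu]_(t in `[al, be]) (expR (y * t) * T n t) =
  c * \int[mu]_(s in `[- n%:R, n%:R])
    (a s * cos_kernel y al be (s - x) + b s * sin_kernel y al be (s - x)).
Proof.
have m : measurable `[- n%:R : R, n%:R]%classic by exact: measurable_itv.
have m' : measurable `[al, be]%classic by exact: measurable_itv.
pose k t s := expR (y * t) * (cos (t * (s - x)) * a s + sin (t * (s - x)) * b s).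
have mk : measurable_fun setT (fun z : R * R => k z.1 z.2).
  have m1 : measurable_fun setT (fun z : R * R => z.1 * (z.2 - x)).
    by apply: measurable_funM => //; apply: measurable_funB.
  apply: measurable_funM.
    apply: (measurableT_comp (f := expR)); first exact: measurable_expR.
    by apply: measurable_funM.
  apply: measurable_funD; apply: measurable_funM.
  - apply: (measurableT_comp (f := @cos R)) => //.
    by apply: continuous_measurable_fun; exact: continuous_cos.
  - exact: (measurableT_comp ma).
  - apply: (measurableT_comp (f := @sin R)) => //.
    by apply: continuous_measurable_fun; exact: continuous_sin.
  - exact: (measurableT_comp mb).
have iE : rintegrable `[al, be] (fun t : R => expR (y * t)).
  by apply: continuous_rintegrable_segment; exact: continuous_exp_lin.
have iab : rintegrable `[- n%:R, n%:R] (fun s => `|a s| + `|b s|).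
  by apply: rintegrableD => //; apply: rintegrable_norm => //; exact: sqr_integrable_segment.
have kb t s : `|k t s| <= expR (y * t) * (`|a s| + `|b s|).
  rewrite /k normrM ger0_norm ?expR_ge0// ler_wpM2l ?expR_ge0//.
  by apply: bound; [exact: norm_cos|exact: norm_sin].
have mk1 t : measurable_fun setT (k t) := measurableT_comp mk (pair1_measurable t).
have mk2 s : measurable_fun setT (k^~ s) := measurableT_comp mk (pair2_measurable s).
have ks t : rintegrable `[- n%:R, n%:R] (fun s => cos (t * (s - x)) * a s + sin (t * (s - x)) * b s).
  apply: (@rintegrable_dominated R _ _ (fun s => `|a s| + `|b s|)) => //.
    have ms (f : R -> R) : continuous f -> measurable_fun setT (fun s : R => f (t * (s - x))).
      move=> cf; apply: (measurableT_comp (continuous_measurable_fun cf)).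
      by apply: measurable_funM => //; exact: measurable_funB.
    apply: measurable_funTS; apply: measurable_funD; apply: measurable_funM => //; apply: ms;
      [exact: continuous_cos|exact: continuous_sin].
  by move=> s _; apply: bound; [exact: norm_cos|exact: norm_sin].
transitivity (c * \int[mu]_(t in `[al, be]) \int[mu]_(s in `[- n%:R, n%:R]) k t s).
  rewrite -rintegralZ//; last first.
    apply: (@rintegrable_dominated R _ _ (fun t : R => expR (y * t) * \int[mu]_(s in `[- n%:R,
      n%:R]) (`|a s| + `|b s|))) => //.
    - have -> : (fun t : R => \int[mu]_(s in `[- n%:R, n%:R]) k t s) = (fun t : R => expR (y * t) *
          \int[mu]_(s in `[- n%:R, n%:R]) (cos (t * (s - x)) * a s + sin (t * (s - x)) * b s)).
        by apply/funext => t; rewrite -rintegralZ.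
      apply: measurable_funTS; apply: continuous_measurable_fun => t.
      apply: cvgM; first exact: continuous_exp_lin.
      apply: (@continuous_parameter_integral R `[- n%:R, n%:R]
        (fun t s => cos (t * (s - x)) * a s + sin (t * (s - x)) * b s)
        (fun s => `|a s| + `|b s|)) => //.
      + by move=> u; exact: rintegrable_measurable.
      + by move=> u s _; apply: bound; [exact: norm_cos|exact: norm_sin].
      + move=> s u; apply: cvgD; apply: cvgM; try exact: cvg_cst.
          exact: continuous_cos_lin.
        exact: continuous_sin_lin.
    - move=> t _; rewrite -rintegralZ//; apply: le_norm_rintegral => //.
        by apply: measurable_funTS.
      exact: rintegrableZ.
    - by have := rintegrableZ (\int[mu]_(s in `[- n%:R, n%:R]) (`|a s| + `|b s|)) m' iE;
        congr rintegrable; apply/funext => t; rewrite mulrC.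
  apply: eq_rintegral => t _; rewrite TE mulrCA; congr (_ * _).
  by rewrite -rintegralZ.
congr (_ * _).
rewrite (rintegral_swap m' m mk iE iab _ _ kb); last 2 first.
- by move=> t; exact: expR_ge0.
- by move=> s; exact: addr_ge0.
- apply: eq_rintegral => s _.
  have i1 : rintegrable `[al, be] (fun t : R => expR (y * t) * cos (t * (s - x))).
    by apply: continuous_rintegrable_segment; exact: continuous_expcos.
  have i2 : rintegrable `[al, be] (fun t : R => expR (y * t) * sin (t * (s - x))).
    by apply: continuous_rintegrable_segment; exact: continuous_expsin.
  rewrite /cos_kernel /sin_kernel -(rintegralZ _ m' i1) -(rintegralZ _ m' i2) -rintegralD//;
    try exact: rintegrableZ.
  by apply: eq_rintegral => t _; rewrite /k; ring.
Qed.

(** Real part of the multiplication formula, tested against [exp(y t + i x t)] on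
    [[al, be]].  For truncated transforms it is Fubini's theorem.  In the limit the
    left sides converge because mean square convergence implies convergence in mean
    on a segment, the right sides because the kernels are square integrable. *)
Lemma fourier_pair_multiplication :
  \int[mu]_(t in `[al, be]) (expR (y * t) * (cos (t * x) * g1 t - sin (t * x) * g2 t)) =
  c * \int[mu]_s (a s * cos_kernel y al be (s - x) + b s * sin_kernel y al be (s - x)).
Proof.
have m' : measurable `[al, be]%classic by exact: measurable_itv.
have jR := rintegrable_kernels y ab x sa sb.
have lim1 : \int[mu]_(t in `[al, be]) (expR (y * t) * T n t) @[n --> \oo] -->
    c * \int[mu]_s (a s * cos_kernel y al be (s - x) + b s * sin_kernel y al be (s - x)).
  under eq_fun do rewrite inner_swap.
  by apply: cvgM; [exact: cvg_cst|exact: cvg_integral_segments].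
suff lim2 : \int[mu]_(t in `[al, be]) (expR (y * t) * T n t) @[n --> \oo] -->
    \int[mu]_(t in `[al, be]) (expR (y * t) * (cos (t * x) * g1 t - sin (t * x) * g2 t)).
  exact: (cvg_unique _ lim2 lim1).
pose h1 := truncated_transform c a b.
pose h2 := truncated_transform c b (fun s => - a s).
have ch1 n : continuous (h1 n) by exact: continuous_truncated_transform.
have ch2 n : continuous (h2 n) by apply: continuous_truncated_transform => //; exact: sqr_integrableN.
pose d1 n t := h1 n t - g1 t.
pose d2 n t := h2 n t - g2 t.
have md1 n : measurable_fun setT (d1 n).
  by apply: measurable_funB; [exact: continuous_measurable_fun|case: sg1].
have md2 n : measurable_fun setT (d2 n).
  by apply: measurable_funB; [exact: continuous_measurable_fun|case: sg2].
have jd1 n : rintegrable `[al, be] (d1 n).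
  by apply: rintegrableB => //; [exact: continuous_rintegrable_segment|exact: sqr_integrable_segment].
have jd2 n : rintegrable `[al, be] (d2 n).
  by apply: rintegrableB => //; [exact: continuous_rintegrable_segment|exact: sqr_integrable_segment].
have [_ _ L1 L2] := F.
have c1 := L2_cvg_L1_segment ab md1 jd1 L1.
have c2 := L2_cvg_L1_segment ab md2 jd2 L2.
pose M := expR (`|y| * (`|al| + `|be|)).
have HM t : al <= t <= be -> expR (y * t) <= M.
  move=> /andP[h h']; rewrite ler_expR (le_trans (ler_norm _))// normrM ler_wpM2l//.
  rewrite ler_norml; apply/andP; split.
    have := ler_normB al 0; have := normr_ge0 be; have := ler_norm (- al); rewrite normrN; lra.
  have := normr_ge0 al; have := ler_norm be; lra.
have lim0 : M * (\int[mu]_(t in `[al, be]) `|d1 n t| + \int[mu]_(t in `[al, be]) `|d2 n t|)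
   @[n --> \oo] --> 0.
  by rewrite -(mulr0 M) -[X in M * X](addr0 0); apply: cvgM; [exact: cvg_cst|exact: cvgD].
apply/subr_cvg0; apply/cvgr0Pnorm_le => /= e e0.
move/cvgr0Pnorm_le : lim0 => /(_ e e0); apply: filterS => n.
rewrite ger0_norm; last first.
  by rewrite mulr_ge0 ?expR_ge0 ?addr_ge0 ?Rintegral_ge0.
apply: le_trans.
have cE : continuous (fun t : R => expR (y * t)) by exact: continuous_exp_lin.
have jT : rintegrable `[al, be] (fun t : R => expR (y * t) * T n t).
  apply: continuous_rintegrable_segment => t; apply: cvgM; first exact: cE.
  apply: cvgB; apply: cvgM; [exact: continuous_cos_lin|exact: ch1|
    exact: continuous_sin_lin|exact: ch2].
have jG : rintegrable `[al, be] (fun t : R => expR (y * t) * (cos (t * x) * g1 t - sin (t * x) * g2 t)).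
  apply: (@rintegrable_dominated R _ _ (fun t : R => M * (`|g1 t| + `|g2 t|))) => //.
  - apply: measurable_funTS; apply: measurable_funM; first exact: continuous_measurable_fun.
    apply: measurable_funB; apply: measurable_funM => //; [by case: sg1|by case: sg2].
  - move=> t /=; rewrite in_itv/= => /HM ht.
    rewrite normrM ger0_norm ?expR_ge0// ler_pM ?expR_ge0//.
    by rewrite -mulrN -(normrN (g2 t)); apply: bound; [exact: norm_cos|exact: norm_sin].
  - apply: rintegrableZ => //; apply: rintegrableD => //; apply: rintegrable_norm => //;
      exact: sqr_integrable_segment.
rewrite -rintegralB// -rintegralD//; try exact: rintegrable_norm.
have jn : rintegrable `[al, be] (fun t : R => `|d1 n t| + `|d2 n t|).
  by apply: rintegrableD => //; exact: rintegrable_norm.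
rewrite -rintegralZ//; apply: le_norm_rintegral => //; last exact: rintegrableZ.
  exact: (rintegrable_measurable (rintegrableB m' jT jG)).
move=> t; rewrite /= in_itv/= => /HM ht.
rewrite -mulrBr normrM ger0_norm ?expR_ge0// ler_pM ?expR_ge0//.
rewrite (_ : _ - _ = cos (t * x) * d1 n t + sin (t * x) * (- d2 n t)).
  by rewrite -(normrN (d2 n t)); apply: bound; [exact: norm_cos|exact: norm_sin].
by rewrite /T /d1 /d2 /h1 /h2; ring.
Qed.

End FourierPair.

(** * The Poisson kernel *)

Section Poisson.
Variable R : realType.
Local Notation mu := (@lebesgue_measure R).

Lemma rintegral_restrict_ae (D1 D2 : set R) (f : R -> R) :
  measurable D1 -> measurable D2 -> D2 `<=` D1 -> measurable_fun D1 f ->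
  {ae mu, forall t, D1 t -> ~ D2 t -> f t = 0} ->
  \int[mu]_(t in D1) f t = \int[mu]_(t in D2) f t.
Proof.
move=> mD1 mD2 D21 mf Hae.
rewrite [LHS]Rintegral_mkcond [RHS]Rintegral_mkcond /Rintegral; congr fine.
have m1 : measurable_fun setT (f \_ D1) by apply/(measurable_restrictT _ _).1.
have m2 : measurable_fun setT (f \_ D2).
  by apply/(measurable_restrictT _ _).1 => //; apply: measurable_funS mf.
apply: (@ae_eq_integral _ _ R mu setT) => //; try exact/measurable_EFinP.
move: Hae; apply: filterS; first exact: (ae_filter_ringOfSetsType mu).
move=> t Ht _ /=; rewrite !patchE.
case: ifPn; case: ifPn => //; rewrite ?inE ?notin_setE => h2 h1.
  by rewrite Ht.
by have := D21 _ h2.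
Qed.

(** [pi] times the Poisson kernel of the upper half plane at height [e]. *)
Definition poisson (e u : R) := e / (u ^+ 2 + e ^+ 2).

Lemma sqrD_gt0 (e u : R) : 0 < e -> 0 < u ^+ 2 + e ^+ 2.
Proof. by move=> e0; rewrite ltr_wpDl ?sqr_ge0 ?exprn_gt0. Qed.

Lemma invDsqr_scale (e u : R) : 0 < e ->
  (u ^+ 2 + e ^+ 2)^-1 <= (1 + e ^- 2) * (1 + u ^+ 2)^-1.
Proof.
move=> e0; have p : 0 < 1 + u ^+ 2 by rewrite ltr_pwDl// sqr_ge0.
rewrite -[leLHS]mul1r ler_pdivrMr ?sqrD_gt0// mulrAC ler_pdivlMr// mul1r.
rewrite mulrDl mul1r mulrDr mulVf ?expf_neq0 ?gt_eqF//.
rewrite (addrC 1) -addrA lerD2l; apply: ler_wpDl; first exact: sqr_ge0.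
by apply: ler_wpDl => //; rewrite mulr_ge0 ?invr_ge0 ?sqr_ge0.
Qed.

Lemma continuous_invDsqr (e : R) : 0 < e -> continuous (fun u : R => (u ^+ 2 + e ^+ 2)^-1).
Proof.
move=> e0 u; apply: cvgV; first by rewrite gt_eqF// sqrD_gt0.
by apply: cvgD; [exact: exprn_continuous|exact: cvg_cst].
Qed.

Lemma continuous_poisson (e : R) : 0 < e -> continuous (poisson e).
Proof. by move=> e0 u; apply: cvgM; [exact: cvg_cst|exact: continuous_invDsqr]. Qed.

Lemma poisson_ge0 (e u : R) : 0 < e -> 0 <= poisson e u.
Proof. by move=> e0; rewrite divr_ge0 ?(ltW e0)// ltW// sqrD_gt0. Qed.

Lemma sqr_integrable_poisson (e x : R) : 0 < e -> sqr_integrable (fun s => poisson e (s - x)).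
Proof.
move=> e0; apply: (@sqr_integrable_translate_decay R (poisson e) (1 + e ^- 2)).
- by rewrite addr_ge0// invr_ge0 sqr_ge0.
- by apply: continuous_measurable_fun; exact: continuous_poisson.
move=> u; apply: le_trans (invDsqr_scale u e0).
rewrite /poisson expr_div_n ler_pdivrMr ?exprn_gt0 ?sqrD_gt0//.
by rewrite [X in _ <= _ * X]expr2 mulKf ?gt_eqF ?sqrD_gt0// lerDr sqr_ge0.
Qed.

Lemma integral_poisson (e x dl : R) : 0 < e -> 0 <= dl ->
  \int[mu]_(s in `[x - dl, x + dl]) poisson e (s - x) = 2 * atan (dl / e).
Proof.
move=> e0 dl0.
have xx : x - dl <= x + dl by lra.
transitivity (atan ((x + dl - x) / e) - atan ((x - dl - x) / e)).
  notypeclasses refine (@rintegral_is_derive R _ (fun s => atan ((s - x) / e)) _ _ xx _ _).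
    move=> s; isderiv.
    by rewrite /poisson; field; rewrite !gt_eqF ?sqrD_gt0// addrC sqrD_gt0.
  move=> s; apply: (@continuous_comp _ _ _ (fun s => s - x) (poisson e)).
    by apply: cvgB; [exact: cvg_id|exact: cvg_cst].
  exact: continuous_poisson.
rewrite (_ : x + dl - x = dl); last by ring.
rewrite (_ : x - dl - x = - dl); last by ring.
by rewrite mulNr atanN; ring.
Qed.

Variables (a : R -> R) (x : R).
Hypothesis (sa : sqr_integrable a) (ca : {for x, continuous a}).

Let w (s : R) := (1 + (s - x) ^+ 2)^-1.

Let sqr_integrable_w : sqr_integrable w.
Proof.
have := @sqr_integrable_poisson 1 x ltr01; congr sqr_integrable; apply/funext => s.
by rewrite /poisson /w mul1r expr1n addrC.
Qed.

Let w0 s : 0 <= w s.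
Proof. by rewrite invr_ge0 addr_ge0// sqr_ge0. Qed.

(** The kernel has total mass [pi].  On [[x - dl, x + dl]] the continuity of [a] at
    [x] makes the error small; outside, the kernel is at most [e K w] with a
    square integrable [w] independent of [e], and the integral of [|a| w] is finite. *)
Lemma poisson_approximation :
  \int[mu]_s (a s * poisson k.+1%:R^-1 (s - x)) @[k --> \oo] --> pi * a x.
Proof.
have [ma ia] := sa.
apply/cvgrPdist_le => /= eta eta0.
(* The near part then contributes at most [e1 * pi = eta / 2]. *)
pose e1 := eta / (2 * pi).
have pi0 := @pi_gt0 R.
have e10 : 0 < e1 by rewrite divr_gt0// mulr_gt0.
have [dl dl0 Hdl] : exists2 dl, 0 < dl & forall s, `|s - x| <= dl -> `|a s - a x| <= e1.
  move/cvgrPdist_le : ca => /(_ _ e10)[d /= d0 Hd].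
  exists (d / 2); first by rewrite divr_gt0.
  move=> s sx; rewrite distrC; apply: Hd; rewrite /= distrC (le_lt_trans sx)//.
  by rewrite ltr_pdivrMr// ltr_pMr// ltr1n.
pose B := \int[mu]_s (`|a s| * w s).
have B0 : 0 <= B by apply: Rintegral_ge0 => s _; rewrite mulr_ge0.
pose K := 1 + dl ^- 2.
have K0 : 0 <= K by rewrite addr_ge0// invr_ge0 sqr_ge0.
have jaw : rintegrable setT (fun s => `|a s| * w s).
  have := rintegrable_norm measurableT (sqr_integrableM sa sqr_integrable_w); congr rintegrable.
  by apply/funext => s; rewrite normrM (ger0_norm (w0 s)).
pose D : set R := `[x - dl, x + dl]%classic.
have mD : measurable D by exact: measurable_itv.
have xDl : x - dl <= x + dl by lra.
have main e : 0 < e ->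
  `|\int[mu]_s (a s * poisson e (s - x)) - a x * (2 * atan (dl / e))|
    <= e1 * pi + e * (K * B).
  move=> e0.
  pose P s := poisson e (s - x).
  have P0 s : 0 <= P s by exact: poisson_ge0.
  have jaP : rintegrable setT (fun s => a s * P s).
    by apply: sqr_integrableM => //; exact: sqr_integrable_poisson.
  have jPD : rintegrable D P by apply: sqr_integrable_segment; exact: sqr_integrable_poisson.
  have jPD' : rintegrable setT (P \_ D).
    rewrite /rintegrable -restrict_EFin.
    exact: (proj1 (integrable_mkcond (mu:=mu) _ mD) jPD).
  have IP : \int[mu]_s (P \_ D) s = 2 * atan (dl / e).
    by rewrite -Rintegral_mkcond; apply: integral_poisson => //; exact: ltW.
  rewrite -IP -(rintegralZ _ measurableT jPD') -rintegralB//; last exact: rintegrableZ.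
  apply: (@le_trans _ _ (\int[mu]_s (e1 * (P \_ D) s + (e * K) * (`|a s| * w s)))).
    apply: le_norm_rintegral => //.
    - by apply: rintegrable_measurable; apply: rintegrableB => //; exact: rintegrableZ.
    - move=> s _; rewrite patchE; case: ifPn => sD.
        rewrite -mulrBl normrM (ger0_norm (P0 s)) ler_wpDr//.
          by rewrite mulr_ge0 ?mulr_ge0 ?(ltW e0).
        rewrite ler_wpM2r//; apply: Hdl.
        by move: sD; rewrite inE /D /= in_itv/= ler_distl.
      rewrite (_ : point = 0 :> R)// !mulr0 subr0 add0r normrM (ger0_norm (P0 s)).
      rewrite [leRHS]mulrCA ler_wpM2l// /P /poisson -[leRHS]mulrA ler_wpM2l ?(ltW e0)//.
      have dls : dl <= `|s - x|.
        rewrite leNgt; apply: contra sD => /ltW; rewrite ler_distl => h.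
        by rewrite inE /D /= in_itv.
      apply: le_trans (_ : ((s - x) ^+ 2)^-1 <= _).
        have s0 : 0 < (s - x) ^+ 2.
          by rewrite -real_normK ?num_real// exprn_gt0// (lt_le_trans dl0).
        by rewrite lef_pV2 ?posrE ?sqrD_gt0// lerDl sqr_ge0.
      have s0 : 0 < (s - x) ^+ 2.
        by rewrite -real_normK ?num_real// exprn_gt0// (lt_le_trans dl0).
      have ds : dl ^+ 2 <= (s - x) ^+ 2.
        by rewrite -[leRHS]real_normK ?num_real// ler_pXn2r// nnegrE// ltW.
      have p : 0 < 1 + (s - x) ^+ 2 by rewrite ltr_pwDl// sqr_ge0.
      rewrite -[leLHS]mul1r ler_pdivrMr// /w mulrAC ler_pdivlMr// mul1r.
      rewrite /K mulrDl mul1r addrC lerD2l mulrC ler_pdivlMr ?exprn_gt0// mul1r//.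
    - by apply: rintegrableD => //; exact: rintegrableZ.
  rewrite rintegralD//; last 2 first.
  - exact: rintegrableZ.
  - exact: rintegrableZ.
  rewrite (rintegralZ _ measurableT jPD') (rintegralZ _ measurableT jaw) IP -/B -(mulrA e K) lerD2r.
  rewrite ler_wpM2l ?(ltW e10)//.
  have := @atan_ltpi2 R (dl / e); lra.
have ek : (k.+1%:R^-1 : R) @[k --> \oo] --> 0 by exact: cvg_harmonic.
have L1 : \forall k \near \oo, k.+1%:R^-1 * (K * B) <= eta / 4.
  have : (k.+1%:R^-1 * (K * B) : R) @[k --> \oo] --> 0 * (K * B).
    by apply: cvgM => //; exact: cvg_cst.
  rewrite mul0r => /cvgrPdist_le /(_ (eta / 4)).
  rewrite divr_gt0// => /(_ isT); apply: filterS => k /=.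
  by rewrite sub0r normrN => /(le_trans (ler_norm _)).
have L2 : \forall k \near \oo, `|pi * a x - a x * (2 * atan (dl / k.+1%:R^-1))| <= eta / 4.
  have : (a x * (2 * atan (dl / k.+1%:R^-1)) : R) @[k --> \oo] --> a x * (2 * (pi / 2)).
    apply: cvgM; first exact: cvg_cst.
    apply: cvgM; first exact: cvg_cst.
    apply: (cvg_comp _ _ _ (@cvgy_atan R)).
    under eq_fun do rewrite invrK.
    change (dl * x0.+1%:R @[x0 --> \oo] --> +oo).
    apply/cvgryPge => M.
    have /cvgryPge/(_ (M / dl)) := @cvgr_idn R.
    apply: filterS => k; rewrite ler_pdivrMr// => /le_trans; apply.
    by rewrite mulrC ler_pM2l// ler_nat.
  rewrite (_ : a x * (2 * (pi / 2)) = pi * a x); last by field.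
  by move=> /cvgrPdist_le /(_ (eta / 4)); rewrite divr_gt0// => /(_ isT).
near=> k.
have ek0 : 0 < k.+1%:R^-1 :> R by rewrite invr_gt0.
have M := main _ ek0.
have H1 : k.+1%:R^-1 * (K * B) <= eta / 4 by near: k.
have H2 : `|pi * a x - a x * (2 * atan (dl / k.+1%:R^-1))| <= eta / 4 by near: k.
have e1pi : e1 * pi = eta / 2 by rewrite /e1 invfM mulrA divfK ?gt_eqF.
rewrite e1pi in M.
rewrite (_ : pi * a x - _ = (pi * a x - a x * (2 * atan (dl / k.+1%:R^-1))) -
  (\int[mu]_s (a s * poisson k.+1%:R^-1 (s - x)) - a x * (2 * atan (dl / k.+1%:R^-1))));
  last by ring.
rewrite (le_trans (ler_normB _ _))// (le_trans (lerD H2 M))//.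
have : eta = eta / 4 + (eta / 2 + eta / 4) by field.
set q := _ * (K * B) in H1 *; lra.
Unshelve. all: by end_near. Qed.

End Poisson.

(** * Fourier inversion for band-limited functions *)

Section Inversion.
Variable R : realType.
Local Notation mu := (@lebesgue_measure R).

Opaque cos_kernel sin_kernel.

Lemma cos_kernelE (y al be u : R) : al <= be -> u ^+ 2 + y ^+ 2 != 0 ->
  cos_kernel y al be u = (u * (expR (y * be) * sin (be * u) - expR (y * al) * sin (al * u))
    + y * (expR (y * be) * cos (be * u) - expR (y * al) * cos (al * u))) / (u ^+ 2 + y ^+ 2).
Proof.
by move=> ab D; apply: (mulIf D); rewrite divfK// -kernel_parts_sin// -kernel_parts_cos//; ring.
Qed.

Lemma sin_kernelE (y al be u : R) : al <= be -> u ^+ 2 + y ^+ 2 != 0 ->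
  sin_kernel y al be u = (y * (expR (y * be) * sin (be * u) - expR (y * al) * sin (al * u))
    - u * (expR (y * be) * cos (be * u) - expR (y * al) * cos (al * u))) / (u ^+ 2 + y ^+ 2).
Proof.
by move=> ab D; apply: (mulIf D); rewrite divfK// -kernel_parts_sin// -kernel_parts_cos//; ring.
Qed.

Lemma eq0_of_exp_decay (z Q e A : R) : 0 < e ->
  (forall n : nat, A <= n%:R -> `|z| <= Q * expR (- (e * n%:R))) -> z = 0.
Proof.
move=> e0 H; apply/eqP; apply: contraT => z0.
have zp : 0 < `|z| by rewrite normr_gt0.
have [n [An Qn]] : exists n : nat, A <= n%:R /\ Q / (`|z| * e) <= n%:R.
  have /cvgryPge cn := @cvgr_idn R.
  have [N1 _ H1] := cn A; have [N2 _ H2] := cn (Q / (`|z| * e)).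
  exists (maxn N1 N2); split; [apply: H1|apply: H2]; rewrite /= ?leq_maxl ?leq_maxr//.
have := H n An; rewrite expRN ler_pdivlMr ?expR_gt0// leNgt => /negP[].
rewrite ler_pdivrMr ?mulr_gt0// in Qn.
apply: (le_lt_trans Qn); rewrite mulrCA ltr_pM2l// mulrC.
by apply: lt_le_trans (expR_ge1Dx _); rewrite ltrDr.
Qed.

Variables (c : R) (a b g1 g2 : R -> R) (A x : R).
Hypothesis F : fourier_pair c a b g1 g2.
Hypothesis ca : {for x, continuous a}.
Hypothesis A0 : 0 < A.
Hypothesis Hae : {ae mu, forall t, ~ `[- A, A]%classic t -> g1 t = 0 /\ g2 t = 0}.

Let sa : sqr_integrable a. Proof. by case: F => -[]. Qed.
Let sb : sqr_integrable b. Proof. by case: F => -[]. Qed.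
Let sg1 : sqr_integrable g1. Proof. by case: F => _ []. Qed.
Let sg2 : sqr_integrable g2. Proof. by case: F => _ []. Qed.

Let T t := cos (t * x) * g1 t - sin (t * x) * g2 t.

Let mT : measurable_fun setT T.
Proof.
apply: measurable_funB; apply: measurable_funM.
- by apply: continuous_measurable_fun; exact: continuous_cos_lin.
- by case: sg1.
- by apply: continuous_measurable_fun; exact: continuous_sin_lin.
- by case: sg2.
Qed.

Let rintegrableT u v : rintegrable `[u, v] T.
Proof.
apply: (@rintegrable_dominated R _ _ (fun t => `|g1 t| + `|g2 t|)) => //.
- exact: measurable_funTS.
- move=> t _; rewrite (le_trans (ler_normB _ _))// !normrM lerD//.
    by rewrite ler_piMl// norm_cos.
  by rewrite ler_piMl// norm_sin.
- by apply: rintegrableD => //; apply: rintegrable_norm => //; exact: sqr_integrable_segment.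
Qed.

Let mET y : measurable_fun setT (fun t : R => expR (y * t) * T t).
Proof.
apply: measurable_funM => //; apply: continuous_measurable_fun; exact: continuous_exp_lin.
Qed.

Let aeT y (D : set R) : {ae mu, forall t, D t -> ~ `[- A, A]%classic t -> expR (y * t) * T t = 0}.
Proof.
move: Hae; apply: filterS; first exact: (ae_filter_ringOfSetsType mu).
by move=> t Ht _ /Ht[t1 t2]; rewrite /T t1 t2 !mulr0 subrr mulr0.
Qed.

(* Abel means of the inversion integral: [T] is damped by [exp(- e |t|)]. *)
Let I e := \int[mu]_(t in `[0, A]) (expR (- e * t) * T t) +
           \int[mu]_(t in `[- A, 0]) (expR (e * t) * T t).

Let q (e n u : R) := (u * sin (n * u) - e * cos (n * u)) / (u ^+ 2 + e ^+ 2).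

(* The kernels of [exp(- e |t|)] on [[- n, n]] add up to [2 * poisson e], up
   to boundary terms of size [exp(- e n)]; the sine parts cancel. *)
Let kerE e n u : 0 < e -> 0 <= n ->
  cos_kernel (- e) 0 n u + cos_kernel e (- n) 0 u = 2 * poisson e u + 2 * expR (- (e * n)) * q e n u /\
  sin_kernel (- e) 0 n u + sin_kernel e (- n) 0 u = 0.
Proof.
move=> e0 n0.
have D0 : u ^+ 2 + e ^+ 2 != 0 by rewrite gt_eqF// sqrD_gt0.
have n0' : - n <= 0 by rewrite oppr_le0.
rewrite !cos_kernelE ?sqrrN// !sin_kernelE ?sqrrN// !(mulr0, mul0r) !mulNr !mulrN.
rewrite sinN cosN sin0 cos0 expR0 /poisson /q.
by split; field.
Qed.

Let we (e u : R) := (`|u| + e) / (u ^+ 2 + e ^+ 2).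

Let we_ge0 e u : 0 < e -> 0 <= we e u.
Proof.
move=> e0; apply: divr_ge0; last by rewrite ltW// sqrD_gt0.
by rewrite addr_ge0// ltW.
Qed.

Let qwe e n u : 0 < e -> `|q e n u| <= we e u.
Proof.
move=> e0; rewrite /q /we normrM normfV (gtr0_norm (sqrD_gt0 u e0)).
rewrite ler_pM2r ?invr_gt0 ?sqrD_gt0// (le_trans (ler_normB _ _))// !normrM.
rewrite (gtr0_norm e0) lerD//.
  by rewrite ler_piMr// norm_sin.
by rewrite ler_piMr ?(ltW e0)// norm_cos.
Qed.

Let sqr_integrable_we e : 0 < e -> sqr_integrable (fun s => we e (s - x)).
Proof.
move=> e0; apply: (@sqr_integrable_translate_decay R (we e) (2 * (1 + e ^- 2))).
- by rewrite mulr_ge0// addr_ge0// invr_ge0 sqr_ge0.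
- apply: continuous_measurable_fun => u; apply: cvgM; last exact: continuous_invDsqr.
  by apply: cvgD; [exact: norm_continuous|exact: cvg_cst].
move=> u; rewrite -mulrA; apply: le_trans (ler_wpM2l _ (invDsqr_scale u e0)) => //.
rewrite /we expr_div_n ler_pdivrMr ?exprn_gt0 ?sqrD_gt0//.
rewrite [X in _ <= _ * X]expr2 mulrA divfK ?gt_eqF ?sqrD_gt0//.
by rewrite -(real_normK (num_real u)); have := sqr_ge0 (`|u| - e); nra.
Qed.

(* The transform vanishes outside [[- A, A]], so the Abel mean can be computed on
   [[- n, n]] for every [n >= A].  The multiplication formula evaluates it up to
   [exp(- e n)], and the difference does not depend on [n]. *)
Let I_poisson e : 0 < e -> I e = 2 * c * \int[mu]_s (a s * poisson e (s - x)).
Proof.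
move=> e0; apply/eqP; rewrite -subr_eq0; apply/eqP.
pose W := \int[mu]_s (`|a s| * we e (s - x)).
apply: (@eq0_of_exp_decay _ (2 * `|c| * W) e A e0) => n An.
have n0 : 0 <= n%:R :> R by [].
have nn0 : - n%:R <= 0 :> R by rewrite oppr_le0.
have E1 := fourier_pair_multiplication F x (- e) n0.
have E2 := fourier_pair_multiplication F x e nn0.
have sub1 : `[0, A]%classic `<=` `[0, n%:R]%classic.
  by move=> t /=; rewrite !in_itv/= => /andP[-> /le_trans]; apply.
have sub2 : `[- A, 0]%classic `<=` `[- n%:R, 0]%classic.
  by move=> t /=; rewrite !in_itv/= => /andP[h ->]; rewrite (le_trans _ h)// lerN2.
have V1 : \int[mu]_(t in `[0, n%:R]) (expR (- e * t) * T t) =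
          \int[mu]_(t in `[0, A]) (expR (- e * t) * T t).
  apply: rintegral_restrict_ae => //; first exact: measurable_funTS.
  move: (aeT (- e) setT); apply: filterS; first exact: (ae_filter_ringOfSetsType mu).
  move=> t Ht /=; rewrite !in_itv/= => /andP[t0 _] h; apply: Ht => //=; rewrite in_itv/=.
  by move=> /andP[_ tA]; apply: h; rewrite t0.
have V2 : \int[mu]_(t in `[- n%:R, 0]) (expR (e * t) * T t) =
          \int[mu]_(t in `[- A, 0]) (expR (e * t) * T t).
  apply: rintegral_restrict_ae => //; first exact: measurable_funTS.
  move: (aeT e setT); apply: filterS; first exact: (ae_filter_ringOfSetsType mu).
  move=> t Ht /=; rewrite !in_itv/= => /andP[_ t0] h; apply: Ht => //=; rewrite in_itv/=.
  by move=> /andP[tA _]; apply: h; rewrite t0 tA.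
have j1 := rintegrable_kernels (- e) n0 x sa sb.
have j2 := rintegrable_kernels e nn0 x sa sb.
have jP : rintegrable setT (fun s => a s * poisson e (s - x)).
  by apply: sqr_integrableM => //; exact: sqr_integrable_poisson.
rewrite /I -V1 -V2 E1 E2.
rewrite (_ : forall X Y Z, c * X + c * Y - 2 * c * Z = c * (X + Y - 2 * Z)); last by move=> *; ring.
rewrite -(rintegralD measurableT j1 j2) -(rintegralZ _ measurableT jP).
have j12 := rintegrableD measurableT j1 j2.
have j2P := rintegrableZ 2 measurableT jP.
rewrite -(rintegralB measurableT j12 j2P).
rewrite normrM -!mulrA mulrCA ler_wpM2l//.
have -> : 2 * (W * expR (- (e * n%:R))) =
    \int[mu]_s ((2 * expR (- (e * n%:R))) * (`|a s| * we e (s - x))).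
  rewrite rintegralZ//; first by rewrite -/W; ring.
  have := rintegrable_norm measurableT (sqr_integrableM sa (sqr_integrable_we e0)); congr rintegrable.
  by apply/funext => s; rewrite normrM (ger0_norm (we_ge0 _ e0)).
apply: le_norm_rintegral => //.
- exact: (rintegrable_measurable (rintegrableB measurableT j12 j2P)).
- move=> s _; have [k1 k2] := @kerE e n%:R (s - x) e0 n0.
  rewrite (_ : _ - _ = a s * (cos_kernel (- e) 0 n%:R (s - x) + cos_kernel e (- n%:R) 0 (s - x)) +
    b s * (sin_kernel (- e) 0 n%:R (s - x) + sin_kernel e (- n%:R) 0 (s - x)) -
    2 * (a s * poisson e (s - x))); last by ring.
  rewrite k1 k2 (_ : _ - _ = (2 * expR (- (e * n%:R))) * (a s * q e n%:R (s - x))); last by ring.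
  rewrite normrM ger0_norm ?mulr_ge0 ?expR_ge0// ler_wpM2l ?mulr_ge0 ?expR_ge0//.
  by rewrite normrM ler_wpM2l// qwe.
- apply: rintegrableZ => //.
  have := rintegrable_norm measurableT (sqr_integrableM sa (sqr_integrable_we e0)); congr rintegrable.
  by apply/funext => s; rewrite normrM (ger0_norm (we_ge0 _ e0)).
Qed.

Let I_limit : I k.+1%:R^-1 @[k --> \oo] -->
  \int[mu]_(t in `[0, A]) T t + \int[mu]_(t in `[- A, 0]) T t.
Proof.
have gen (D : set R) (sg : R) : measurable D -> rintegrable D T ->
    (forall t, D t -> 0 <= sg * t <= A) ->
    \int[mu]_(t in D) (expR (- (k.+1%:R^-1 * (sg * t))) * T t) @[k --> \oo] -->
      \int[mu]_(t in D) T t.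
  move=> mD jT HD; have jTn := rintegrable_norm mD jT.
  have lim0 : (k.+1%:R^-1 * (A * \int[mu]_(t in D) `|T t|) : R) @[k --> \oo] --> 0.
    rewrite -(mul0r (A * \int[mu]_(t in D) `|T t|)).
    by apply: cvgM; [exact: cvg_harmonic|exact: cvg_cst].
  apply/subr_cvg0; apply/cvgr0Pnorm_le => /= e e0.
  move/cvgr0Pnorm_le : lim0 => /(_ e e0); apply: filterS => k.
  rewrite ger0_norm; last by rewrite !mulr_ge0 ?Rintegral_ge0 ?(ltW A0).
  apply: le_trans.
  have ek0 : 0 <= k.+1%:R^-1 :> R by rewrite invr_ge0.
  have mE : measurable_fun D (fun t => expR (- (k.+1%:R^-1 * (sg * t))) * T t).
    apply: measurable_funTS; have := mET (- (k.+1%:R^-1 * sg)).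
    by congr measurable_fun; apply/funext => t; rewrite mulNr mulrA.
  have jE : rintegrable D (fun t => expR (- (k.+1%:R^-1 * (sg * t))) * T t).
    apply: (rintegrable_dominated mD mE _ jTn) => t Dt; rewrite normrM ger0_norm ?expR_ge0//.
    rewrite ler_piMl// expR_le1 oppr_le0 mulr_ge0//.
    by have /andP[] := HD _ Dt.
  rewrite -rintegralB// mulrA -rintegralZ//; apply: le_norm_rintegral => //.
  - by apply: rintegrable_measurable; exact: rintegrableB.
  - move=> t Dt; have /andP[st sA] := HD _ Dt.
    rewrite -[X in _ - X]mul1r -mulrBl normrM ler_wpM2r//.
    have p0 : 0 <= k.+1%:R^-1 * (sg * t) by rewrite mulr_ge0.
    rewrite ler0_norm ?subr_le0; last by rewrite expR_le1 oppr_le0.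
    rewrite opprB lerBlDl -lerBlDr; apply: le_trans (expR_ge1Dx _).
    by rewrite lerD2l lerN2 ler_wpM2l.
  - exact: rintegrableZ.
apply: cvgD.
  have := @gen `[0, A]%classic 1 (measurable_itv _) (@rintegrableT 0 A).
  move=> /(_ _)/wrap[]; first by move=> t /=; rewrite in_itv/= mul1r.
  apply: cvg_trans; apply: near_eq_cvg; apply: nearW => k /=.
  by apply: eq_rintegral => t _; rewrite mul1r mulNr.
have := @gen `[- A, 0]%classic (-1) (measurable_itv _) (@rintegrableT (- A) 0).
move=> /(_ _)/wrap[].
  by move=> t /=; rewrite in_itv/= mulN1r oppr_ge0 lerNl andbC.
apply: cvg_trans; apply: near_eq_cvg; apply: nearW => k /=.
by apply: eq_rintegral => t _; rewrite mulN1r mulrN opprK.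
Qed.

(** Abel summation.  As [e] tends to 0 the Abel means converge to the undamped
    integral, since [0 <= 1 - exp(- e |t|) <= e A] on [[- A, A]], and the Poisson
    integrals converge to [pi * a x] by continuity of [a] at [x]. *)
Lemma fourier_inversion :
  \int[mu]_(t in `[- A, A]) (cos (t * x) * g1 t - sin (t * x) * g2 t) = 2 * c * (pi * a x).
Proof.
transitivity (\int[mu]_(t in `[0, A]) T t + \int[mu]_(t in `[- A, 0]) T t).
  have := @Rintegral_itvB R T (BLeft (- A)) (BRight A) 0 (@rintegrableT (- A) A).
  rewrite !bnd_simp oppr_le0 (ltW A0) => /(_ isT isT) E.
  rewrite -/T -[LHS](subrK (\int[mu]_(t in `[- A, 0]) T t)); congr (_ + _).
  rewrite E Rintegral_itv_obnd_cbnd//.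
  apply: rintegrableS (@rintegrableT 0 A) => // t /=.
  by rewrite !in_itv/= => /andP[/ltW -> ->].
apply: (cvg_unique _ I_limit) => //.
have -> : (fun k : nat => I k.+1%:R^-1) =
    (fun k => 2 * c * \int[mu]_s (a s * poisson k.+1%:R^-1 (s - x))).
  by apply/funext => k; rewrite I_poisson// invr_gt0.
by apply: cvgM; [exact: cvg_cst|exact: poisson_approximation].
Qed.

End Inversion.

(** * Operations on total differentials *)

Section Frechet2Algebra.
Variable R : realType.
Implicit Types u v : R -> R -> R.

Lemma frechet2_quadratic u x y a b (K d0 : R) : 0 <= K -> 0 < d0 ->
  (forall h k, `|h| <= d0 -> `|k| <= d0 ->
    `|u (x + h) (y + k) - u x y - (a * h + b * k)| <= K * (h ^+ 2 + k ^+ 2)) ->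
  frechet2 u x y a b.
Proof.
move=> K0 d00 H e e0.
have K10 : 0 < K + 1 by rewrite ltr_wpDl.
exists (Num.min d0 (e / (K + 1))); first by rewrite lt_min d00 divr_gt0.
move=> h k; rewrite !le_min => /andP[h1 h2] /andP[k1 k2].
rewrite (le_trans (H h k h1 k1))//.
have sq (z : R) : `|z| <= e / (K + 1) -> (K + 1) * z ^+ 2 <= e * `|z|.
  move=> h3; rewrite -real_normK ?num_real// expr2 mulrA ler_wpM2r//.
  by rewrite mulrC -ler_pdivlMr.
have := sq _ h2; have := sq _ k2; have := sqr_ge0 h; have := sqr_ge0 k.
rewrite mulrDr !mulrDl !mul1r mulrDr; lra.
Qed.

Lemma frechet2D u v x y a b a' b' : frechet2 u x y a b -> frechet2 v x y a' b' ->
  frechet2 (fun x y => u x y + v x y) x y (a + a') (b + b').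
Proof.
move=> Hu Hv e e0; have e20 : 0 < e / 2 by rewrite divr_gt0.
have [d1 d10 H1] := Hu _ e20; have [d2 d20 H2] := Hv _ e20.
exists (Num.min d1 d2); first by rewrite lt_min d10.
move=> h k; rewrite !le_min => /andP[h1 h2] /andP[k1 k2].
rewrite (_ : _ - _ = (u (x + h) (y + k) - u x y - (a * h + b * k)) +
  (v (x + h) (y + k) - v x y - (a' * h + b' * k))); last by ring.
rewrite (le_trans (ler_normD _ _))// (le_trans (lerD (H1 _ _ h1 k1) (H2 _ _ h2 k2)))//.
by rewrite -mulrDl -splitr.
Qed.

Lemma frechet2Z u x y a b (c : R) : frechet2 u x y a b ->
  frechet2 (fun x y => c * u x y) x y (c * a) (c * b).
Proof.
move=> Hu e e0.
have c0 : 0 < `|c| + 1 by rewrite ltr_wpDl.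
have [d d0 Hd] := Hu _ (divr_gt0 e0 c0).
exists d => // h k h1 k1.
rewrite (_ : _ - _ = c * (u (x + h) (y + k) - u x y - (a * h + b * k))); last by ring.
rewrite normrM.
apply: (@le_trans _ _ ((`|c| + 1) * `|u (x + h) (y + k) - u x y - (a * h + b * k)|)).
  by rewrite ler_wpM2r// lerDl.
by rewrite mulrC -ler_pdivlMr// mulrAC Hd.
Qed.

Lemma frechet2_flip u x y a b : frechet2 u x (- y) a b ->
  frechet2 (fun x y => u x (- y)) x y a (- b).
Proof.
move=> Hu e e0; have [d d0 Hd] := Hu _ e0; exists d => // h k h1 k1.
by rewrite opprD mulNr -mulrN; have := Hd h (- k); rewrite normrN; apply.
Qed.

Lemma frechet2_eq u x y a b a' b' : frechet2 u x y a b -> a = a' -> b = b' ->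
  frechet2 u x y a' b'.
Proof. by move=> ? <- <-. Qed.

End Frechet2Algebra.

(** * Second order remainders of the exponential *)

Section Remainders.
Variable R : realType.

Lemma mvt_bound (f df : R -> R) (r K : R) : (forall t, is_derive t (1 : R) f (df t)) ->
  (forall t, `|t| <= `|r| -> `|df t| <= K) -> `|f r - f 0| <= K * `|r|.
Proof.
move=> Hf HK; case/orP: (le_total 0 r) => r0.
  have [c /andP[c0 cr] ->] := @mean_value R f df 0 r r0 (fun t _ => Hf t).
  by rewrite subr0 normrM ler_wpM2r// HK// !ger0_norm.
have [c /andP[rc c0] E] := @mean_value R f df r 0 r0 (fun t _ => Hf t).
by rewrite distrC E sub0r normrM normrN ler_wpM2r// HK// !ler0_norm// lerN2.
Qed.

Lemma norm_sin_le (r : R) : `|sin r| <= `|r|.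
Proof.
have := @mvt_bound (@sin R) (@cos R) r 1; rewrite sin0 subr0 mul1r; apply.
by move=> t _; exact: norm_cos.
Qed.

Lemma norm_cosB1_le (r : R) : `|cos r - 1| <= `|r|.
Proof.
have := @mvt_bound (@cos R) (fun t => - sin t) r 1; rewrite cos0 mul1r; apply.
by move=> t _; rewrite normrN; exact: norm_sin.
Qed.

Lemma norm_cosB1_sqr (r : R) : `|cos r - 1| <= r ^+ 2.
Proof.
have := @mvt_bound (@cos R) (fun t => - sin t) r `|r|; rewrite cos0.
rewrite -expr2 real_normK ?num_real//; apply.
by move=> t tr; rewrite normrN (le_trans (norm_sin_le _)).
Qed.

Lemma norm_sinB_sqr (r : R) : `|sin r - r| <= r ^+ 2.
Proof.
have := @mvt_bound (fun t => sin t - t) (fun t => cos t - 1) r `|r|.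
rewrite sin0 !subr0 -expr2 real_normK ?num_real//; apply.
by move=> t tr; rewrite (le_trans (norm_cosB1_le _)).
Qed.

Lemma norm_expB1_le (s : R) : `|s| <= 1 -> `|expR s - 1| <= expR 1 * `|s|.
Proof.
move=> s1; have := @mvt_bound (@expR R) (@expR R) s (expR 1); rewrite expR0; apply.
by move=> t ts; rewrite ger0_norm ?expR_ge0// ler_expR (le_trans (ler_norm _))// (le_trans ts).
Qed.

Lemma norm_expB1B_le (s : R) : `|s| <= 1 -> `|expR s - 1 - s| <= expR 1 * s ^+ 2.
Proof.
move=> s1; have := @mvt_bound (fun t => expR t - 1 - t) (fun t => expR t - 1) s (expR 1 * `|s|).
rewrite expR0 subrr !subr0 -mulrA -expr2 real_normK ?num_real//; apply.
  by move=> t; isderiv; rewrite subr0.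
by move=> t ts; rewrite (le_trans (norm_expB1_le _)) ?ler_wpM2l ?expR_ge0// (le_trans ts).
Qed.

Lemma expcos_remainder (s r : R) : `|s| <= 1 ->
  `|expR s * cos r - 1 - s| <= 2 * expR 1 * (s ^+ 2 + r ^+ 2).
Proof.
move=> s1.
rewrite (_ : _ - _ - _ = (expR s - 1 - s) + expR s * (cos r - 1)); last by ring.
rewrite (le_trans (ler_normD _ _))//.
have H1 := norm_expB1B_le s1.
have H2 : `|expR s * (cos r - 1)| <= expR 1 * r ^+ 2.
  rewrite normrM ler_pM ?norm_cosB1_sqr// ger0_norm ?expR_ge0// ler_expR.
  exact: le_trans (ler_norm _) _.
rewrite (le_trans (lerD H1 H2))// -mulrDr -mulrA ler_peMl ?ler1n//.
by rewrite mulr_ge0 ?expR_ge0 ?addr_ge0 ?sqr_ge0.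
Qed.

Lemma expsin_remainder (s r : R) : `|s| <= 1 ->
  `|expR s * sin r - r| <= 2 * expR 1 * (s ^+ 2 + r ^+ 2).
Proof.
move=> s1.
rewrite (_ : _ - _ = (expR s - 1) * sin r + (sin r - r)); last by ring.
rewrite (le_trans (ler_normD _ _))//.
have H1 : `|(expR s - 1) * sin r| <= expR 1 * (s ^+ 2 + r ^+ 2).
  rewrite normrM (le_trans (ler_pM _ _ (norm_expB1_le s1) (norm_sin_le r)))//.
  rewrite -mulrA ler_wpM2l ?expR_ge0//.
  by have := norm_mul_le_sqrD s r; rewrite normrM.
have H2 : `|sin r - r| <= expR 1 * (s ^+ 2 + r ^+ 2).
  rewrite (le_trans (norm_sinB_sqr r))//.
  have e1 : 1 <= expR 1 :> R by rewrite -expR0 ler_expR.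
  have := sqr_ge0 s; have := sqr_ge0 r; nra.
by rewrite (le_trans (lerD H1 H2))// -mulrA mulr_natl mulr2n.
Qed.

End Remainders.

(** * Fourier-Laplace integrals *)

Section FourierLaplace.
Variable R : realType.
Local Notation mu := (@lebesgue_measure R).
Variable A : R.
Hypothesis A0 : 0 < A.

(** Real part of the integral of [exp(t (y + i x)) (g1 + i g2)(t)] over [[- A, A]],
    and its y-derivative. *)
Definition laplace (g1 g2 : R -> R) (x y : R) : R :=
  \int[mu]_(t in `[- A, A]) (expR (y * t) * (cos (t * x) * g1 t - sin (t * x) * g2 t)).

Definition laplace1 (g1 g2 : R -> R) (x y : R) : R :=
  \int[mu]_(t in `[- A, A]) (t * (expR (y * t) * (cos (t * x) * g1 t - sin (t * x) * g2 t))).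

Section Pair.
Variables (g1 g2 : R -> R).
Hypotheses (sg1 : sqr_integrable g1) (sg2 : sqr_integrable g2).

Let mI : measurable `[- A, A]%classic. Proof. exact: measurable_itv. Qed.

Let mk x y : measurable_fun setT
  (fun t : R => expR (y * t) * (cos (t * x) * g1 t - sin (t * x) * g2 t)).
Proof.
apply: measurable_funM; first by apply: continuous_measurable_fun; exact: continuous_exp_lin.
apply: measurable_funB; apply: measurable_funM.
- by apply: continuous_measurable_fun; exact: continuous_cos_lin.
- by case: sg1.
- by apply: continuous_measurable_fun; exact: continuous_sin_lin.
- by case: sg2.
Qed.

Let expA y t : `[- A, A]%classic t -> expR (y * t) <= expR (`|y| * A).
Proof.
rewrite /= in_itv/= => tA; rewrite ler_expR (le_trans (ler_norm _))// normrM ler_wpM2l//.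
by rewrite ler_norml.
Qed.

Let pair_le x t : `|cos (t * x) * g1 t - sin (t * x) * g2 t| <= `|g1 t| + `|g2 t|.
Proof.
rewrite (le_trans (ler_normB _ _))// !normrM lerD//.
  by rewrite ler_piMl// norm_cos.
by rewrite ler_piMl// norm_sin.
Qed.

Let jg : rintegrable `[- A, A] (fun t => `|g1 t| + `|g2 t|).
Proof. by apply: rintegrableD => //; apply: rintegrable_norm => //; exact: sqr_integrable_segment. Qed.

Lemma rintegrable_laplace x y : rintegrable `[- A, A]
  (fun t => expR (y * t) * (cos (t * x) * g1 t - sin (t * x) * g2 t)).
Proof.
apply: (@rintegrable_dominated R _ _ (fun t => expR (`|y| * A) * (`|g1 t| + `|g2 t|))) => //.
- exact: measurable_funTS.
- move=> t tA; rewrite normrM ger0_norm ?expR_ge0// ler_pM ?expR_ge0//; exact: expA.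
- exact: rintegrableZ.
Qed.

Lemma rintegrable_laplace1 x y : rintegrable `[- A, A]
  (fun t => t * (expR (y * t) * (cos (t * x) * g1 t - sin (t * x) * g2 t))).
Proof.
apply: (@rintegrable_dominated R _ _ (fun t => A * (expR (`|y| * A) * (`|g1 t| + `|g2 t|)))) => //.
- by apply: measurable_funTS; exact: measurable_funM.
- move=> t tA; rewrite normrM ler_pM//; first by move: tA; rewrite /= in_itv/= ler_norml.
  by rewrite normrM ger0_norm ?expR_ge0// ler_pM ?expR_ge0//; exact: expA.
- by do 2 apply: rintegrableZ => //.
Qed.

Lemma laplaceE x y : laplace g1 g2 x y = \int[mu]_(t in `[- A, A])
  (expR (y * t) * (cos (t * x) * g1 t - sin (t * x) * g2 t)).
Proof. by []. Qed.

Lemma laplace_real x : laplace g1 g2 x 0 =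
  \int[mu]_(t in `[- A, A]) (cos (t * x) * g1 t - sin (t * x) * g2 t).
Proof. by apply: eq_rintegral => t _; rewrite mul0r expR0 mul1r. Qed.

Lemma laplace1N x y :
  laplace1 (fun t => - g1 t) (fun t => - g2 t) x y = - laplace1 g1 g2 x y.
Proof.
rewrite /laplace1 -[RHS]mulN1r -rintegralZ//; last exact: rintegrable_laplace1.
by apply: eq_rintegral => t _; ring.
Qed.

End Pair.

(** Differentiation under the integral sign.  The quadratic remainder of
    [exp(t (k + i h))] is uniform for [|t| <= A] and [|h|, |k| <= 1 / A], and the
    x-derivative is the y-derivative for the pair multiplied by [i]. *)
Lemma laplace_frechet2 (g1 g2 : R -> R) x y : sqr_integrable g1 -> sqr_integrable g2 ->
  frechet2 (laplace g1 g2) x y (- laplace1 g2 (fun t => - g1 t) x y) (laplace1 g1 g2 x y).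
Proof.
move=> sg1 sg2.
have sg1' : sqr_integrable (fun t => - g1 t) := sqr_integrableN sg1.
pose G := \int[mu]_(t in `[- A, A]) (`|g1 t| + `|g2 t|).
pose C := expR (`|y| * A) * (4 * expR 1 * A ^+ 2).
have mI : measurable `[- A, A]%classic by exact: measurable_itv.
have jg : rintegrable `[- A, A] (fun t => `|g1 t| + `|g2 t|).
  by apply: rintegrableD => //; apply: rintegrable_norm => //; exact: sqr_integrable_segment.
have C0 : 0 <= C by rewrite !mulr_ge0 ?expR_ge0// ltW.
apply: (@frechet2_quadratic R _ x y _ _ (C * G) A^-1).
- by rewrite mulr_ge0// Rintegral_ge0.
- by rewrite invr_gt0.
move=> h k hA kA.
have j0 := rintegrable_laplace sg1 sg2 x y.
have j1 := rintegrable_laplace sg1 sg2 (x + h) (y + k).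
have j2 := rintegrable_laplace1 sg1 sg2 x y.
have j3 := rintegrable_laplace1 sg2 sg1' x y.
rewrite mulNr -mulNr (mulrC _ h) (mulrC _ k) mulrN -mulNr.
rewrite /laplace /laplace1.
rewrite -(rintegralZ (- h) mI j3) -(rintegralZ k mI j2) -rintegralB// -rintegralD;
  [|by []|exact: rintegrableZ|exact: rintegrableZ].
rewrite -rintegralB//; [|exact: rintegrableB|by apply: rintegrableD => //; exact: rintegrableZ].
rewrite mulrAC /G -rintegralZ//; apply: le_norm_rintegral => //; last exact: rintegrableZ.
  by apply: rintegrable_measurable; apply: rintegrableB => //;
    [exact: rintegrableB|apply: rintegrableD => //; exact: rintegrableZ].
move=> t tA.
have tA' : `|t| <= A by move: tA; rewrite /= in_itv/= ler_norml.
pose p := cos (t * x) * g1 t - sin (t * x) * g2 t.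
pose q := sin (t * x) * g1 t + cos (t * x) * g2 t.
have pb : `|p| <= `|g1 t| + `|g2 t|.
  rewrite (le_trans (ler_normB _ _))// !normrM lerD//.
    by rewrite ler_piMl// norm_cos.
  by rewrite ler_piMl// norm_sin.
have qb : `|q| <= `|g1 t| + `|g2 t|.
  rewrite (le_trans (ler_normD _ _))// !normrM lerD//.
    by rewrite ler_piMl// norm_sin.
  by rewrite ler_piMl// norm_cos.
rewrite (_ : _ - _ - _ = expR (y * t) * ((expR (k * t) * cos (h * t) - 1 - k * t) * p -
  (expR (k * t) * sin (h * t) - h * t) * q)); last first.
  have -> : (y + k) * t = y * t + k * t by ring.
  have -> : t * (x + h) = t * x + h * t by ring.
  by rewrite expRD cosD sinD /p /q; ring.
have kt : `|k * t| <= 1.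
  rewrite normrM -(mulVf (lt0r_neq0 A0)) ler_pM//.
have H1 := expcos_remainder (h * t) kt.
have H2 := expsin_remainder (h * t) kt.
have HK : 2 * expR 1 * ((k * t) ^+ 2 + (h * t) ^+ 2) <= 2 * expR 1 * A ^+ 2 * (h ^+ 2 + k ^+ 2).
  rewrite -!mulrA; do 2 (rewrite ler_pM2l ?expR_gt0//).
  rewrite (_ : (k * t) ^+ 2 + (h * t) ^+ 2 = t ^+ 2 * (h ^+ 2 + k ^+ 2)); last by ring.
  rewrite mulrA -expr2 ler_wpM2r ?addr_ge0 ?sqr_ge0//.
  by rewrite -(real_normK (num_real t)) ler_pXn2r// nnegrE ltW.
rewrite normrM ger0_norm ?expR_ge0// /C.
rewrite (_ : _ * _ * _ * _ = expR (`|y| * A) * (2 * (2 * expR 1 * A ^+ 2 * (h ^+ 2 + k ^+ 2)) *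
   (`|g1 t| + `|g2 t|))); last by ring.
rewrite ler_pM ?expR_ge0//.
  rewrite ler_expR (le_trans (ler_norm _))// normrM ler_wpM2l//.
rewrite (le_trans (ler_normB _ _))// !normrM mulr_natl mulr2n mulrDl.
by rewrite lerD// ler_pM// (le_trans _ HK).
Qed.

End FourierLaplace.

(** * The extension of a band-limited function to the plane *)

Section HolomorphicExtension.
Variable R : realType.
Local Notation mu := (@lebesgue_measure R).

Lemma cos_kernelN (y A u : R) : 0 <= A -> cos_kernel (- y) (- A) A u = cos_kernel y (- A) A u.
Proof.
move=> A0; have AA : - A <= A by lra.
have [D|D] := eqVneq (u ^+ 2 + y ^+ 2) 0.
  have y0 : y = 0.
    by move/eqP: D; rewrite paddr_eq0 ?sqr_ge0// => /andP[_]; rewrite sqrf_eq0 => /eqP.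
  by rewrite y0 oppr0.
rewrite !cos_kernelE ?sqrrN//; congr (_ / _).
by rewrite !(mulNr, mulrN, opprK) sinN cosN; ring.
Qed.

Lemma sin_kernelN (y A u : R) : 0 <= A -> sin_kernel (- y) (- A) A u = - sin_kernel y (- A) A u.
Proof.
move=> A0; have AA : - A <= A by lra.
have [D|D] := eqVneq (u ^+ 2 + y ^+ 2) 0.
  have /eqP := D; rewrite paddr_eq0 ?sqr_ge0// => /andP[].
  rewrite !sqrf_eq0 => /eqP -> /eqP ->.
  have z : sin_kernel 0 (- A) A 0 = 0.
    by apply: rintegral_eq0 => // t _; rewrite mulr0 sin0 mulr0.
  by rewrite oppr0 z oppr0.
rewrite !sin_kernelE ?sqrrN// -[RHS]mulNr; congr (_ / _).
by rewrite !(mulNr, mulrN, opprK) sinN cosN; ring.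
Qed.

Opaque cos_kernel sin_kernel laplace laplace1.

(** For [c = 1 / sqrt(2 pi)] the sinc integral of [a] at [x + I y] is
    [ext_re c A a x y + I * ext_im c A a x y]; see [qsinc_kernel]. *)
Definition ext_re (c A : R) (a : R -> R) (x y : R) : R :=
  c ^+ 2 * \int[mu]_s (a s * cos_kernel y (- A) A (s - x)).
Definition ext_im (c A : R) (a : R -> R) (x y : R) : R :=
  c ^+ 2 * \int[mu]_s (a s * sin_kernel y (- A) A (s - x)).

Variables (c A : R).
Hypothesis A0 : 0 < A.

Let AA : - A <= A. Proof. by have := A0; lra. Qed.

Let jC y x (p : R -> R) (sp : sqr_integrable p) :=
  sqr_integrableM sp (sqr_integrable_cos_kernel y AA x).
Let jS y x (p : R -> R) (sp : sqr_integrable p) :=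
  sqr_integrableM sp (sqr_integrable_sin_kernel y AA x).

Let ext_reN a x y : ext_re c A a x (- y) = ext_re c A a x y.
Proof.
rewrite /ext_re; apply: (congr1 ( *%R (c ^+ 2))); apply: eq_rintegral => s _.
by rewrite cos_kernelN// ltW.
Qed.

Let ext_imN a x y : sqr_integrable a -> ext_im c A a x (- y) = - ext_im c A a x y.
Proof.
move=> sa; rewrite /ext_im -mulrN; apply: (congr1 ( *%R (c ^+ 2))).
rewrite -[RHS]mulN1r -(rintegralZ _ measurableT (jS y x sa)).
by apply: eq_rintegral => s _; rewrite sin_kernelN ?ltW// mulrN mulN1r.
Qed.

Let ext_im_opp a x y : sqr_integrable a ->
  ext_im c A (fun s => - a s) x y = - ext_im c A a x y.
Proof.
move=> sa; rewrite /ext_im -mulrN; apply: (congr1 ( *%R (c ^+ 2))).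
rewrite -[RHS]mulN1r -(rintegralZ _ measurableT (jS y x sa)).
by apply: eq_rintegral => s _; rewrite mulNr mulN1r.
Qed.

Let laplace_ext a b g1 g2 x y : fourier_pair c a b g1 g2 ->
  c * laplace A g1 g2 x y = ext_re c A a x y + ext_im c A b x y.
Proof.
move=> F; have [[sa sb] _ _ _] := F.
rewrite laplaceE (fourier_pair_multiplication F x y AA).
by rewrite (rintegralD measurableT (jC y x sa) (jS y x sb)) mulrA -expr2 mulrDr.
Qed.

(** The cosine kernel is even in [y] and the sine kernel odd, so the half sum of the
    Fourier-Laplace integrals at [y] and [- y] isolates the first, and, for the
    rotated pair, their half difference isolates the second. *)
Lemma ext_reE a b g1 g2 x y : fourier_pair c a b g1 g2 ->
  ext_re c A a x y = c / 2 * (laplace A g1 g2 x y + laplace A g1 g2 x (- y)).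
Proof.
move=> F; have [[_ sb] _ _ _] := F.
rewrite mulrAC mulrDr !(laplace_ext _ _ F) ext_reN ext_imN//.
by move: (ext_re _ _ _ _ _) (ext_im _ _ _ _ _) => z w; field.
Qed.

Lemma ext_imE a b g1 g2 x y : fourier_pair c a b g1 g2 ->
  ext_im c A a x y = - (c / 2) *
    (laplace A g2 (fun t => - g1 t) x y - laplace A g2 (fun t => - g1 t) x (- y)).
Proof.
move=> F; have [[sa _] _ _ _] := F.
rewrite mulNr mulrAC mulrBr !(laplace_ext _ _ (fourier_pair_rot F)).
rewrite ext_reN !(ext_im_opp _ _ sa) (ext_imN _ _ sa).
by move: (ext_re _ _ _ _ _) (ext_im _ _ _ _ _) => z w; field.
Qed.

(** Both parts are combinations of Fourier-Laplace integrals, whose differentials are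
    known.  On the real axis the half difference is zero and the half sum is the
    inversion integral. *)
Lemma ext_cauchy_riemann a b g1 g2 : fourier_pair c a b g1 g2 -> continuous a ->
  {ae mu, forall t, ~ `[- A, A]%classic t -> g1 t = 0 /\ g2 t = 0} ->
  2 * c ^+ 2 * pi = 1 ->
  exists Ux Vx : R -> R -> R,
  [/\ forall x y, frechet2 (ext_re c A a) x y (Ux x y) (- Vx x y),
      forall x y, frechet2 (ext_im c A a) x y (Vx x y) (Ux x y) &
      forall x, ext_re c A a x 0 = a x /\ ext_im c A a x 0 = 0].
Proof.
move=> F ca Hae hc; have [_ [sg1 sg2] _ _] := F.
pose n1 := fun t => - g1 t.
have sn1 : sqr_integrable n1 := sqr_integrableN sg1.
have UE : ext_re c A a = fun x y => c / 2 * (laplace A g1 g2 x y + laplace A g1 g2 x (- y)).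
  by apply/funext => x; apply/funext => y; exact: ext_reE F.
have VE : ext_im c A a = fun x y =>
    - (c / 2) * (laplace A g2 n1 x y + (-1) * laplace A g2 n1 x (- y)).
  by apply/funext => x; apply/funext => y; rewrite (ext_imE _ _ F) mulN1r.
pose D1 := laplace1 A g1 g2. pose D2 := laplace1 A g2 n1.
exists (fun x y => - (c / 2) * (D2 x y + D2 x (- y))),
       (fun x y => - (c / 2) * (D1 x y - D1 x (- y))).
have nn : laplace1 A n1 (fun t => - g2 t) = fun x y => - D1 x y.
  by apply/funext => x; apply/funext => y; exact: laplace1N.
split.
- move=> x y; rewrite UE.
  have H1 := laplace_frechet2 A0 x y sg1 sg2.
  have H2 := laplace_frechet2 A0 x (- y) sg1 sg2.
  have H3 := frechet2Z (c / 2) (frechet2D H1 (frechet2_flip H2)).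
  apply: (frechet2_eq H3); rewrite -/D1 -/D2.
    by move: (D2 x y) (D2 x (- y)) => z w; ring.
  by move: (D1 x y) (D1 x (- y)) => z w; ring.
- move=> x y; rewrite VE.
  have H1 := laplace_frechet2 A0 x y sg2 sn1.
  have H2 := laplace_frechet2 A0 x (- y) sg2 sn1.
  rewrite nn in H1 H2.
  have H3 := frechet2Z (- (c / 2)) (frechet2D H1 (frechet2Z (-1) (frechet2_flip H2))).
  apply: (frechet2_eq H3); rewrite -/D2.
    by move: (D1 x y) (D1 x (- y)) => z w; ring.
  by move: (D2 x y) (D2 x (- y)) => z w; ring.
- move=> x; rewrite UE VE oppr0; split; last by ring.
  have := fourier_inversion F (@ca x) A0 Hae => E.
  have -> : laplace A g1 g2 x 0 = 2 * c * (pi * a x).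
    by rewrite laplace_real.
  transitivity (2 * c ^+ 2 * pi * a x); first by field.
  by rewrite hc mul1r.
Qed.

End HolomorphicExtension.

(** * Power series of the kernels *)

Section ComplexExponentialTaylor.
Variable R : realType.
Local Notation mu := (@lebesgue_measure R).

Local Instance is_derive_exprn n (t : R) :
  is_derive t (1 : R) (fun t : R => t ^+ n) (n%:R * t ^+ n.-1).
Proof.
have -> : (fun t : R => t ^+ n) = (@id R) ^+ n.
  by apply/funext => s; elim: n => [|n IH]; rewrite ?expr0// !exprS IH.
have := @is_deriveX R R id n t 1 1 (is_derive_id _ _).
by move=> H; apply: is_derive_eq H _; rewrite /GRing.scale /= mulr1.
Qed.

(** Taylor polynomials written by the derivatives [a k] at 0, and their primitives
    vanishing at 0. *)
Definition taylor_sum (a : nat -> R) n (t : R) := \sum_(k < n) a k * (t ^+ k / k`!%:R).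
Definition taylor_sum_primitive (a : nat -> R) n (t : R) := \sum_(k < n) a k * (t ^+ k.+1 / k.+1`!%:R).

Lemma taylor_sum_primitive_derive a n (t : R) : is_derive t 1 (taylor_sum_primitive a n)
  (taylor_sum a n t).
Proof.
elim: n => [|n IH].
  have -> : taylor_sum_primitive a 0 = cst 0 by apply/funext => s; rewrite /taylor_sum_primitive big_ord0.
  by rewrite /taylor_sum big_ord0; exact: is_derive_cst.
have -> : taylor_sum_primitive a n.+1 = fun t => taylor_sum_primitive a n t + a n * (t ^+ n.+1 /
  n.+1`!%:R).
  by apply/funext => s; rewrite /taylor_sum_primitive big_ord_recr.
isderiv; rewrite /taylor_sum big_ord_recr /=; congr (_ + _).
rewrite factS natrM; field.
by rewrite pnatr_eq0 -lt0n fact_gt0 nat1r pnatr_eq0.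
Qed.

Lemma taylor_sumS a n t : taylor_sum a n.+1 t = a 0%N + taylor_sum_primitive (fun k => a k.+1) n t.
Proof. by rewrite /taylor_sum big_ord_recl /= expr0 fact0 divr1 mulr1. Qed.

(** Compares [f] and [- f] with [K * t ^+ n.+1 / n.+1`!], whose derivative dominates
    theirs; negative [t] are treated by reflection. *)
Lemma taylor_step (f df : R -> R) (K B : R) n : f 0 = 0 ->
  (forall t : R, is_derive t (1 : R) f (df t)) ->
  (forall t, `|t| <= B -> `|df t| <= K * (`|t| ^+ n / n`!%:R)) ->
  forall t, `|t| <= B -> `|f t| <= K * (`|t| ^+ n.+1 / n.+1`!%:R).
Proof.
have pos (h dh : R -> R) : h 0 = 0 -> (forall t : R, is_derive t (1 : R) h (dh t)) ->
    (forall t, 0 <= t <= B -> `|dh t| <= K * (t ^+ n / n`!%:R)) ->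
    forall t, 0 <= t <= B -> h t <= K * (t ^+ n.+1 / n.+1`!%:R).
  move=> h0 Hh Hb t /andP[t0 tB].
  pose g s := K * (s ^+ n.+1 / n.+1`!%:R).
  have dg s : is_derive s (1 : R) (fun s => g s - h s) (K * (s ^+ n / n`!%:R) - dh s).
    rewrite /g; isderiv; congr (_ - _); rewrite factS natrM; field.
    by rewrite pnatr_eq0 -lt0n fact_gt0 nat1r pnatr_eq0.
  have [c /andP[c0 ct] E] := @mean_value R _ _ 0 t t0 (fun s _ => dg s).
  have g0 : g 0 = 0 by rewrite /g expr0n /= mul0r mulr0.
  rewrite h0 g0 !subr0 in E.
  rewrite -subr_ge0 -/(g t) E mulr_ge0// subr_ge0 (le_trans (ler_norm _))// Hb//.
  by rewrite c0 (le_trans ct).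
move=> f0 Hf Hb t tB.
case/orP: (le_total 0 t) => t0.
  have tt : 0 <= t <= B by rewrite t0 -(ger0_norm t0).
  have Hb' s : 0 <= s <= B -> `|df s| <= K * (s ^+ n / n`!%:R).
    by move=> /andP[s0 sB]; rewrite -{2}(ger0_norm s0) Hb// ger0_norm.
  rewrite (ger0_norm t0) ler_norml; apply/andP; split; last exact: (pos f df).
  rewrite lerNl; apply: (pos (fun s => - f s) (fun s => - df s)) => //.
    by rewrite f0 oppr0.
  by move=> s hs; rewrite normrN Hb'.
have tt : 0 <= - t <= B by rewrite oppr_ge0 t0 -(ler0_norm t0).
have Hb' s : 0 <= s <= B -> `|df (- s)| <= K * (s ^+ n / n`!%:R).
  by move=> /andP[s0 sB]; rewrite -{2}(ger0_norm s0) -(normrN s) Hb// normrN ger0_norm.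
have dN (s : R) : is_derive s (1 : R) (fun s => f (- s)) (- df (- s)).
  have := Hf (- s) => H; have : is_derive s (1 : R) (fun s : R => - s) (- 1) by isderiv.
  by move=> H'; have := is_derive1_comp H H'; rewrite /GRing.scale /= ?mulN1r ?mulrN1.
rewrite (ler0_norm t0) ler_norml; apply/andP; split; last first.
  have := pos (fun s => f (- s)) (fun s => - df (- s)); rewrite oppr0 => /(_ f0 dN).
  move=> /(_ _)/wrap[]; first by move=> s hs; rewrite normrN Hb'.
  by move=> /(_ _ tt); rewrite opprK.
rewrite lerNl.
have := pos (fun s => - f (- s)) (fun s => df (- s)); rewrite oppr0 f0 oppr0 => /(_ erefl).
move=> /(_ _)/wrap[].
  by move=> s; have := dN s => H; isderiv; rewrite opprK.
by move=> /(_ Hb') /(_ _ tt); rewrite opprK.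
Qed.

(** Real and imaginary parts of [(y + i u) ^ k], the derivatives at 0 of
    [exp(y t) cos(t u)] and [exp(y t) sin(t u)]. *)
Fixpoint complex_pow (y u : R) k : R * R :=
  if k is k'.+1 then
    let p := complex_pow y u k' in (y * p.1 - u * p.2, y * p.2 + u * p.1)
  else (1, 0).

Section Fixed.
Variables (y u : R).
Let e k := (complex_pow y u k).1.
Let f k := (complex_pow y u k).2.
Let rc n t := expR (y * t) * cos (t * u) - taylor_sum e n t.
Let rs n t := expR (y * t) * sin (t * u) - taylor_sum f n t.

Let taylor_sum_lin (a b : nat -> R) (z w : R) n t :
  taylor_sum (fun k => z * a k + w * b k) n t = z * taylor_sum a n t + w * taylor_sum b n t.
Proof.
rewrite /taylor_sum !mulr_sumr -big_split /=; apply: eq_bigr => i _; ring.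
Qed.

Let rc_derive n (t : R) : is_derive t (1 : R) (rc n.+1) (y * rc n t - u * rs n t).
Proof.
have E : rc n.+1 = fun t => expR (y * t) * cos (t * u) - (1 + taylor_sum_primitive (fun k => e k.+1) n t).
  by apply/funext => s; rewrite /rc taylor_sumS.
have D := taylor_sum_primitive_derive (fun k => e k.+1) n t.
rewrite E; isderiv.
have -> : taylor_sum (fun k => e k.+1) n t = y * taylor_sum e n t + (- u) * taylor_sum f n t.
  by rewrite -taylor_sum_lin; apply: eq_bigr => i _; rewrite /e /f /=; ring.
by rewrite /rc /rs; ring.
Qed.

Let rs_derive n (t : R) : is_derive t (1 : R) (rs n.+1) (y * rs n t + u * rc n t).
Proof.
have E : rs n.+1 = fun t => expR (y * t) * sin (t * u) - (0 + taylor_sum_primitive (fun k => f k.+1) n t).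
  by apply/funext => s; rewrite /rs taylor_sumS.
have D := taylor_sum_primitive_derive (fun k => f k.+1) n t.
rewrite E; isderiv.
have -> : taylor_sum (fun k => f k.+1) n t = y * taylor_sum f n t + u * taylor_sum e n t.
  by rewrite -taylor_sum_lin; apply: eq_bigr => i _; rewrite /e /f /=.
by rewrite /rc /rs; ring.
Qed.

Let L := `|y| + `|u|.

Let remainder (B : R) n : forall t, `|t| <= B ->
  `|rc n t| <= expR (`|y| * B) * L ^+ n * (`|t| ^+ n / n`!%:R) /\
  `|rs n t| <= expR (`|y| * B) * L ^+ n * (`|t| ^+ n / n`!%:R).
Proof.
elim: n => [|n IH] t tB.
  rewrite /rc /rs /taylor_sum !big_ord0 !subr0 !expr0 fact0 divr1 !mulr1.
  have eB : expR (y * t) <= expR (`|y| * B).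
    by rewrite ler_expR (le_trans (ler_norm _))// normrM ler_wpM2l.
  by split; rewrite (le_trans (norm_expM _ _ _))// ?norm_cos ?norm_sin.
have comb (z1 z2 w1 w2 K : R) : `|z1| <= K -> `|z2| <= K ->
    `|w1 * z1| + `|w2 * z2| <= (`|w1| + `|w2|) * K.
  by move=> h1 h2; rewrite !normrM mulrDl lerD// ler_wpM2l.
split; move: t tB.
- apply: taylor_step (rc_derive n) _.
    by rewrite /rc taylor_sumS /taylor_sum_primitive big1 => [|i _];
      rewrite ?mulr0 ?mul0r ?expR0 ?cos0 ?expr0n /=
      ?mul0r ?mulr0//; rewrite /e/=; ring.
  move=> t /IH[h1 h2]; rewrite (le_trans (ler_normB _ _))//.
  by rewrite (le_trans (comb _ _ y u _ h1 h2))// exprS -/L; rewrite le_eqVlt; apply/orP; left;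
    apply/eqP; ring.
- apply: taylor_step (rs_derive n) _.
    by rewrite /rs taylor_sumS /taylor_sum_primitive big1 => [|i _];
      rewrite ?mulr0 ?mul0r ?expR0 ?sin0 ?expr0n /=
      ?mul0r ?mulr0//; rewrite /f/=; ring.
  move=> t /IH[h1 h2]; rewrite (le_trans (ler_normD _ _))//.
  by rewrite (le_trans (comb _ _ y u _ h2 h1))// exprS -/L; rewrite le_eqVlt; apply/orP; left;
    apply/eqP; ring.
Qed.

Let continuous_taylor_sum a n : continuous (taylor_sum a n).
Proof.
elim: n => [|n IH].
  have -> : taylor_sum a 0 = cst 0 by apply/funext => s; rewrite /taylor_sum big_ord0.
  by move=> t; exact: cvg_cst.
have -> : taylor_sum a n.+1 = fun t => taylor_sum a n t + a n * (t ^+ n / n`!%:R).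
  by apply/funext => s; rewrite /taylor_sum big_ord_recr.
move=> t; apply: cvgD; first exact: IH.
apply: cvgM; first exact: cvg_cst.
by apply: cvgM; [exact: exprn_continuous|exact: cvg_cst].
Qed.

Let taylor_sum_primitive_odd a n A :
  taylor_sum_primitive a n.*2 A - taylor_sum_primitive a n.*2 (- A) =
  2 * \sum_(j < n) a j.*2 * (A ^+ j.*2.+1 / (j.*2.+1)`!%:R).
Proof.
elim: n => [|n IH]; first by rewrite /taylor_sum_primitive !big_ord0 subrr mulr0.
rewrite big_ord_recr /= mulrDr -IH doubleS /taylor_sum_primitive !big_ord_recr /=.
have -> : (- A) ^+ n.*2.+1 = - A ^+ n.*2.+1 by rewrite exprNn -signr_odd /= odd_double expr1 mulN1r.
have -> : (- A) ^+ n.*2.+2 = A ^+ n.*2.+2 by rewrite exprNn -signr_odd /= odd_double expr0 mul1r.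
by ring.
Qed.

(** Integrating the Taylor polynomials over the symmetric segment kills the odd
    powers of [t]; in degree [m] the remainder is of order [(L A) ^ m / m!] with
    [L = |y| + |u|]. *)
Lemma kernel_series (A : R) : 0 <= A ->
  \sum_(j < n) e j.*2 * (A ^+ j.*2.+1 / (j.*2.+1)`!%:R) @[n --> \oo] --> cos_kernel y (- A) A u / 2 /\
  \sum_(j < n) f j.*2 * (A ^+ j.*2.+1 / (j.*2.+1)`!%:R) @[n --> \oo] --> sin_kernel y (- A) A u / 2.
Proof.
move=> A0; have AA : - A <= A by lra.
have gen (w : R -> R) (a : nat -> R) : continuous w ->
    (forall n t, `|t| <= A -> `|w t - taylor_sum a n t| <= expR (`|y| * A) * L ^+ n * (`|t|
      ^+ n / n`!%:R)) ->
    \sum_(j < n) a j.*2 * (A ^+ j.*2.+1 / (j.*2.+1)`!%:R) @[n --> \oo] -->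
      (\int[mu]_(t in `[- A, A]) w t) / 2.
  move=> cw Hw.
  have H n : `|(\int[mu]_(t in `[- A, A]) w t) / 2 -
      \sum_(j < n) a j.*2 * (A ^+ j.*2.+1 / (j.*2.+1)`!%:R)| <=
      expR (`|y| * A) * A * exp_coeff (L * A) n.*2.
    have E : \int[mu]_(t in `[- A, A]) taylor_sum a n.*2 t =
      2 * \sum_(j < n) a j.*2 * (A ^+ j.*2.+1 / (j.*2.+1)`!%:R).
      rewrite -taylor_sum_primitive_odd.
      notypeclasses refine (@rintegral_is_derive R _ (taylor_sum_primitive a n.*2) _ _ AA _ _).
        by move=> t; exact: taylor_sum_primitive_derive.
      exact: continuous_taylor_sum.
    have -> : (\int[mu]_(t in `[- A, A]) w t) / 2 -
      \sum_(j < n) a j.*2 * (A ^+ j.*2.+1 / (j.*2.+1)`!%:R) =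
      (\int[mu]_(t in `[- A, A]) (w t - taylor_sum a n.*2 t)) / 2.
      rewrite rintegralB//; [|exact: continuous_rintegrable_segment|apply:
        continuous_rintegrable_segment; exact: continuous_taylor_sum].
      by rewrite E; field.
    rewrite normrM normfV [X in _ / X]ger0_norm// ler_pdivrMr//.
    pose K := expR (`|y| * A) * exp_coeff (L * A) n.*2.
    have K0 : 0 <= K.
      by rewrite mulr_ge0 ?expR_ge0// exp_coeff_ge0// mulr_ge0// addr_ge0.
    have -> : expR (`|y| * A) * A * exp_coeff (L * A) n.*2 * 2 = K * (A - - A).
      by rewrite /K; ring.
    rewrite -rintegral_segment_cst//; apply: le_norm_rintegral => //.
    - apply: measurable_funTS; apply: continuous_measurable_fun => t.
      by apply: cvgB; [exact: cw|exact: continuous_taylor_sum].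
    - move=> t; rewrite /= in_itv/= -ler_norml => tA.
      rewrite (le_trans (Hw _ _ tA))// /K /exp_coeff -mulrA ler_wpM2l ?expR_ge0//.
      change (L ^+ n.*2 * (`|t| ^+ n.*2 / (n.*2)`!%:R) <= (L * A) ^+ n.*2 / (n.*2)`!%:R).
      rewrite mulrA exprMn ler_wpM2r ?invr_ge0// ler_wpM2l ?exprn_ge0 ?addr_ge0//.
      by rewrite lerXn2r// nnegrE.
    - exact: cst_rintegrable_segment.
  apply/subr_cvg0/cvgr0Pnorm_le => /= eps eps0.
  have lim0 : expR (`|y| * A) * A * exp_coeff (L * A) n.*2 @[n --> \oo] --> 0.
    rewrite -(mulr0 (expR (`|y| * A) * A)); apply: cvgM; first exact: cvg_cst.
    have := @cvg_exp_coeff R (L * A).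
    apply: (@cvg_comp _ _ _ double) => //.
    apply/cvgnyPge => M; exists M => // n /= Mn.
    by rewrite (leq_trans Mn)// -addnn leq_addr.
  move/cvgr0Pnorm_le : lim0 => /(_ _ eps0); apply: filterS => n.
  move/(le_trans (ler_norm _)); apply: le_trans.
  by rewrite distrC; exact: H.
split; rewrite /cos_kernel /sin_kernel; apply: gen.
- exact: continuous_expcos.
- by move=> n t /(remainder n)[].
- exact: continuous_expsin.
- by move=> n t /(remainder n)[].
Qed.

End Fixed.
End ComplexExponentialTaylor.

(** * The quaternionic sinc and exponential series *)

Section QuaternionSeries.
Variable R : realType.
Local Notation H := (quat R).
Local Notation mu := (@lebesgue_measure R).

Lemma limn_scale2 (p r : nat -> R) (a b : R) (v w : H) :
  p @ \oo --> a -> r @ \oo --> b ->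
  limn (fun n => p n *: v + r n *: w) = a *: v + b *: w.
Proof.
move=> pa rb; apply: cvg_lim; first exact: norm_hausdorff.
by apply: cvgD; apply: cvgZr_tmp.
Qed.

Lemma complex_pow_quat (I : H) (y u : R) k : I ^+ 2 = -1 ->
  (y%:A + u *: I) ^+ k = (complex_pow y u k).1 *: 1 + (complex_pow y u k).2 *: I.
Proof.
move=> I2; elim: k => [|k IH]; first by rewrite expr0 /= scale1r scale0r addr0.
rewrite exprS IH /=; set e := (complex_pow y u k).1; set f := (complex_pow y u k).2.
rewrite mulrDl !mulrDr -!scalerAl -!scalerAr !mul1r !mulr1 -expr2 I2.
rewrite !scalerA scalerN scalerBl scalerDl.
by rewrite [_ *: I - _]addrC addrACA.
Qed.

Lemma sqr_slice (I : H) (y u : R) k : I ^+ 2 = -1 ->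
  (I * (y%:A + u *: I)) ^+ (2 * k) =
  (-1) ^+ k *: ((complex_pow y u k.*2).1 *: 1 + (complex_pow y u k.*2).2 *: I).
Proof.
move=> I2; rewrite -complex_pow_quat//; set K := _ + _.
have cIK : GRing.comm I K.
  by rewrite /GRing.comm /K mulrDr mulrDl -!scalerAr -!scalerAl mulr1 mul1r.
rewrite exprMn_comm// exprM I2 mul2n.
by rewrite -[in LHS]signr_odd -[in RHS]signr_odd; case: (odd k);
  rewrite ?expr1 ?expr0 ?scaleN1r ?scale1r ?mulN1r ?mul1r.
Qed.

(** With [W = x + I y - s = I (y + I (s - x))] the even powers of [W] are, up to the sign
    [(-1) ^ k], even powers of [y + I (s - x)], which lie in the plane of 1 and [I];
    the two coordinates of the sinc series are then the series of the kernels. *)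
Lemma qsinc_kernel (I : H) (A x y s : R) : I ^+ 2 = -1 -> 0 < A ->
  qsinc ((A / pi) *: (x%:A + I * y%:A - s%:A)) =
  (2 * A)^-1 *: ((cos_kernel y (- A) A (s - x))%:A + I * (sin_kernel y (- A) A (s - x))%:A).
Proof.
move=> I2 A0; rewrite /qsinc.
have pi0 : pi != 0 :> R by rewrite gt_eqF// pi_gt0.
set W := _ - _.
have WE : W = I * (y%:A + (s - x) *: I).
  rewrite mulrDr -[I * (_ *: I)]scalerAr -expr2 I2 scalerN -scaleNr opprB scalerBl /W.
  by rewrite addrAC addrC.
pose e k := (complex_pow y (s - x) k).1; pose f k := (complex_pow y (s - x) k).2.
have [c1 c2] := @kernel_series R y (s - x) A (ltW A0).
have -> : series (fun k => ((- pi ^+ 2) ^+ k / ((2 * k).+1)`!%:R : R) *: ((A / pi) *: W) ^+ (2 * k)) =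
   (fun n => (A^-1 * \sum_(j < n) e j.*2 * (A ^+ j.*2.+1 / (j.*2.+1)`!%:R)) *: (1 : H) +
             (A^-1 * \sum_(j < n) f j.*2 * (A ^+ j.*2.+1 / (j.*2.+1)`!%:R)) *: I).
  apply/funext => n; rewrite /series /= big_mkord !mulr_sumr !scaler_suml -big_split /=.
  apply: eq_bigr => k _.
  rewrite exprZn WE sqr_slice// -/(e _) -/(f _) !scalerDr !scalerA mul2n.
  have coef (z : R) : (- pi ^+ 2) ^+ k / (k.*2.+1)`!%:R * (A / pi) ^+ k.*2 * (-1) ^+ k * z =
      A^-1 * (z * (A ^+ k.*2.+1 / (k.*2.+1)`!%:R)).
    rewrite -mul2n (exprM (A / pi)) expr_div_n (exprS A (2 * k)) (exprM A).
    rewrite -[- pi ^+ 2]mulN1r exprMn.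
    rewrite (_ : (-1) ^+ k * (pi ^+ 2) ^+ k / ((2 * k).+1)`!%:R * (A ^+ 2 / pi ^+ 2) ^+ k * (-1)
      ^+ k * z =
      ((-1) ^+ k * (-1) ^+ k) * ((pi ^+ 2) ^+ k * (A ^+ 2 / pi ^+ 2) ^+ k) * z / ((2 * k).+1)`!%:R);
      last by ring.
    rewrite -expr2 sqrr_sign mul1r -exprMn mulrCA divff ?expf_neq0// mulr1.
    set F := _^-1; set G := (A ^+ 2) ^+ k.
    by rewrite (mulrC z) !mulrA mulVf ?gt_eqF// mul1r; ring.
  by rewrite !coef.
rewrite (limn_scale2 (a := A^-1 * (cos_kernel y (- A) A (s - x) / 2))
  (b := A^-1 * (sin_kernel y (- A) A (s - x) / 2))).
- have -> : I * (sin_kernel y (- A) A (s - x))%:A = sin_kernel y (- A) A (s - x) *: I.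
    by rewrite -scalerAr mulr1.
  by rewrite scalerDr !scalerA invfM; congr (_ *: _ + _ *: _); ring.
- by apply: cvgM; [exact: cvg_cst|exact: c1].
- by apply: cvgM; [exact: cvg_cst|exact: c2].
Qed.

Definition quat_i : H := Quat 0 1 0 0.

Lemma quat_i_sqr : quat_i ^+ 2 = -1.
Proof. by rewrite expr2; congr Quat => /=; ring. Qed.

Lemma complex_pow_imag_even (u : R) m : complex_pow 0 u m.*2 = ((-1) ^+ m * u ^+ m.*2, 0).
Proof.
elim: m => [|m IH]; first by rewrite /= !expr0 mulr1.
by rewrite doubleS /= IH /= !exprS; congr pair; ring.
Qed.

Lemma complex_pow_imag (u : R) k : complex_pow 0 u k =
  ((~~ odd k)%:R * (-1) ^+ k./2 * u ^+ k, (odd k)%:R * (-1) ^+ k.-1./2 * u ^+ k).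
Proof.
have [m [->|->]] : exists m, k = m.*2 \/ k = m.*2.+1.
  by exists k./2; have := odd_double_half k; case: (odd k) => E; [right|left]; exact: esym E.
- by rewrite complex_pow_imag_even odd_double /= doubleK; congr pair; ring.
- rewrite [complex_pow _ _ _]/= complex_pow_imag_even /= odd_double /= doubleK exprS.
  by congr pair; ring.
Qed.

Lemma qexp_quat_i (th : R) : qexp (- (quat_i * th%:A)) = Quat (cos th) (- sin th) 0 0.
Proof.
rewrite /qexp.
have WE : - (quat_i * th%:A) = (0 : R)%:A + (- th) *: quat_i.
  by congr Quat => /=; ring.
have -> : series (fun k => (k`!%:R : R)^-1 *: (- (quat_i * th%:A)) ^+ k) =
   (fun n => (series (cos_coeff (- th)) n) *: (1 : H) + (series (sin_coeff (- th)) n) *: quat_i).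
  apply/funext => n; rewrite /series /= !scaler_suml -big_split /=.
  apply: eq_bigr => k _.
  rewrite WE complex_pow_quat ?quat_i_sqr// complex_pow_imag /= scalerDr !scalerA /cos_coeff
    /sin_coeff /=.
  by congr (_ *: _ + _ *: _); rewrite -?exprnP; ring.
have c1 : series (cos_coeff (- th)) @ \oo --> cos th.
  by rewrite -cosN unlock; exact: is_cvg_series_cos_coeff.
have c2 : series (sin_coeff (- th)) @ \oo --> - sin th.
  by rewrite -sinN unlock; exact: is_cvg_series_sin_coeff.
by rewrite (limn_scale2 _ _ c1 c2); congr Quat => /=; ring.
Qed.

End QuaternionSeries.

(** * Integrability of quaternionic functions *)

Section QuaternionLebesgue.
Variable R : realType.
Local Notation H := (quat R).
Local Notation mu := (@lebesgue_measure R).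
Implicit Types F G : R -> H.

Definition qsqr (q : H) : R := qre q ^+ 2 + qi q ^+ 2 + qj q ^+ 2 + qk q ^+ 2.

Lemma qsqr_ge0 q : 0 <= qsqr q.
Proof. by rewrite !addr_ge0 ?sqr_ge0. Qed.

Lemma qnormE (q : H) : `|q| = Num.sqrt (qsqr q).
Proof. by []. Qed.

Lemma qnorm_sqr (q : H) : `|q| ^+ 2 = qsqr q.
Proof. by rewrite qnormE sqr_sqrtr// qsqr_ge0. Qed.

Lemma qnorm_le (q : H) : `|q| <= `|qre q| + `|qi q| + `|qj q| + `|qk q|.
Proof.
set s := _ + _ + _ + _; have s0 : 0 <= s by rewrite !addr_ge0.
rewrite -(@ler_pXn2r _ 2)// ?nnegrE// qnorm_sqr /qsqr /s.
rewrite -(real_normK (num_real (qre q))) -(real_normK (num_real (qi q))).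
rewrite -(real_normK (num_real (qj q))) -(real_normK (num_real (qk q))).
move: (normr_ge0 (qre q)) (normr_ge0 (qi q)) (normr_ge0 (qj q)) (normr_ge0 (qk q)).
set a := `|qre q|; set b := `|qi q|; set c := `|qj q|; set d := `|qk q| => a0 b0 c0 d0.
rewrite -subr_ge0 (_ : _ - _ = 2 * (a * b + a * c + a * d + b * c + b * d + c * d)); last by ring.
by rewrite !(mulr_ge0, addr_ge0).
Qed.

Definition qsqr_integral F : \bar R := (\int[mu]_x (qsqr (F x))%:E)%E.

Lemma qLnorm2_sqr F : (qLnorm 2%:E F `^ 2 = qsqr_integral F)%E.
Proof.
rewrite /qLnorm poweR_Lnorm ?pnatr_eq0// /qsqr_integral; apply: eq_integral => x _.
by rewrite /= normr_id -[2]/(2%:R) powR_mulrn// qnorm_sqr.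
Qed.

Lemma qsqr_integral_ge0 F : (0 <= qsqr_integral F)%E.
Proof. by apply: integral_ge0 => x _; rewrite lee_fin qsqr_ge0. Qed.

Lemma qLnorm2E F : (qLnorm 2%:E F = qsqr_integral F `^ 2^-1)%E.
Proof. by rewrite -qLnorm2_sqr -poweRrM mulfV ?pnatr_eq0// poweRe1// Lnorm_ge0. Qed.

Lemma qLnorm2_cvg0 (Fn : nat -> R -> H) :
  (qLnorm 2%:E (Fn n) @[n --> \oo] --> 0 <-> qsqr_integral (Fn n) @[n --> \oo] --> 0)%E.
Proof.
split => /fine_cvgP[fin c0]; apply/fine_cvgP; split.
- move: fin; apply: filterS => n fn; rewrite -qLnorm2_sqr.
  by rewrite -(fineK fn) poweR_EFin.
- have : fine (qLnorm 2%:E (Fn n)) * fine (qLnorm 2%:E (Fn n)) @[n --> \oo] --> 0 * (0 : R).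
    exact: cvgM.
  rewrite mulr0; apply: cvg_trans; apply: near_eq_cvg; move: fin; apply: filterS => n fn.
  rewrite /= -qLnorm2_sqr -[in RHS](fineK fn) poweR_EFin /= -[2]/(2%:R) powR_mulrn ?expr2//.
  by rewrite fine_ge0// Lnorm_ge0.
- move: fin; apply: filterS => n fn; rewrite qLnorm2E.
  by rewrite -(fineK fn) poweR_EFin.
- have : Num.sqrt (fine (qsqr_integral (Fn n))) @[n --> \oo] --> Num.sqrt (0 : R).
    exact: (continuous_cvg _ (@sqrt_continuous R 0)).
  rewrite sqrtr0; apply: cvg_trans; apply: near_eq_cvg; move: fin; apply: filterS => n fn.
  rewrite /= qLnorm2E -{2}(fineK fn) poweR_EFin /= powR12_sqrt//.
  by rewrite fine_ge0// qsqr_integral_ge0.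
Qed.

Lemma integral_EFin (g : R -> R) : rintegrable setT g ->
  (\int[mu]_x (g x)%:E = (\int[mu]_x g x)%:E)%E.
Proof. by move=> ig; rewrite /Rintegral fineK//; exact: (integrable_fin_num (mu:=mu)). Qed.

Lemma rintegrable_lty (g : R -> R) : measurable_fun setT g -> (forall x, 0 <= g x) ->
  (\int[mu]_x (g x)%:E < +oo)%E -> rintegrable setT g.
Proof.
move=> mg g0 H; apply/integrableP; split; first exact/measurable_EFinP.
by under eq_integral do rewrite /= ger0_norm//.
Qed.

Lemma measurable_qsqr F : qmeasurable F -> measurable_fun setT (fun x => qsqr (F x)).
Proof.
by move=> [m0 m1 m2 m3]; rewrite /qsqr; do 3 (apply: measurable_funD; last exact: measurable_funX);
  exact: measurable_funX.
Qed.

Lemma qLp2_sqr_integrable F : qLp 2%:E F ->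
  [/\ sqr_integrable (fun x => qre (F x)), sqr_integrable (fun x => qi (F x)),
    sqr_integrable (fun x => qj (F x)) & sqr_integrable (fun x => qk (F x))].
Proof.
move=> [mF LF].
have iS : rintegrable setT (fun x => qsqr (F x)).
  apply: rintegrable_lty; [exact: measurable_qsqr|by move=> x; exact: qsqr_ge0|].
  by rewrite -/(qsqr_integral F) -qLnorm2_sqr poweR_lty.
have gen (p : H -> R) : measurable_fun setT (fun x => p (F x)) -> (forall q, p q ^+ 2 <= qsqr q) ->
    sqr_integrable (fun x => p (F x)).
  move=> mp Hp; split=> //; apply: rintegrable_dominated iS => //; first exact: measurable_funX.
  by move=> x _; rewrite ger0_norm ?sqr_ge0 //; exact: Hp.
case: mF => m0 m1 m2 m3; split; apply: gen => // q; rewrite /qsqr.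
- by rewrite -!addrA lerDl !addr_ge0 ?sqr_ge0.
- by rewrite -!addrA addrCA lerDl !addr_ge0 ?sqr_ge0.
- by rewrite addrAC lerDr !addr_ge0 ?sqr_ge0.
- by rewrite lerDr !addr_ge0 ?sqr_ge0.
Qed.

Lemma sqr_integrable_qLp2 F :
  sqr_integrable (fun x => qre (F x)) -> sqr_integrable (fun x => qi (F x)) ->
  sqr_integrable (fun x => qj (F x)) -> sqr_integrable (fun x => qk (F x)) ->
    qLp 2%:E F /\ rintegrable setT (fun x => qsqr (F x)).
Proof.
move=> [m0 i0] [m1 i1] [m2 i2] [m3 i3].
have iS : rintegrable setT (fun x => qsqr (F x)) by rewrite /qsqr; do 3 apply: rintegrableD => //.
by split => //; split => //; rewrite qLnorm2E poweR_lty// /qsqr_integral integral_EFin// ltry.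
Qed.

Definition qintegrable F :=
  [/\ rintegrable setT (fun x => qre (F x)), rintegrable setT (fun x => qi (F x)),
      rintegrable setT (fun x => qj (F x)) & rintegrable setT (fun x => qk (F x))].

Lemma qintegrable_qLp1 F : qintegrable F -> qLp 1%:E F.
Proof.
move=> [i0 i1 i2 i3].
have mF : qmeasurable F by split; exact: rintegrable_measurable.
split => //; rewrite /qLnorm Lnorm1.
under eq_integral do rewrite /= normr_id.
have mn : measurable_fun setT (fun x => `|F x|).
  apply: (measurableT_comp (f := @Num.sqrt R)); last exact: measurable_qsqr.
  by apply: continuous_measurable_fun; exact: sqrt_continuous.
rewrite integral_EFin ?ltry//.
apply: (@rintegrable_dominated R setT _ (fun x => `|qre (F x)| + `|qi (F x)| + `|qj (F x)|
  + `|qk (F x)|)) => //.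
  by move=> x _; rewrite normr_id; exact: qnorm_le.
by do 3 (apply: rintegrableD => //; last exact: rintegrable_norm); exact: rintegrable_norm.
Qed.

End QuaternionLebesgue.

(** * Coordinates of the quaternionic Fourier transform *)

Section PaleyWienerPairs.
Variable R : realType.
Local Notation H := (quat R).
Local Notation mu := (@lebesgue_measure R).
Implicit Types F G : R -> H.

(** The complement of the support is an uncountable union of open sets on which [G]
    vanishes almost everywhere; it is covered by the countably many intervals with
    rational end points that have this property. *)
Lemma ess_supp_ae G (A : R) : ess_supp G `<=` `[- A, A]%classic ->
  {ae mu, forall t, ~ `[- A, A]%classic t -> G t = 0}.
Proof.
move=> HG.
pose good (pq : rat * rat) := {ae mu, forall t, ratr pq.1 < t < ratr pq.2 -> G t = 0}.
pose P (n : nat) t := if unpickle n is Some pq then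
    (good pq -> ratr pq.1 < t < ratr pq.2 -> G t = 0) else True.
have aeP n : {ae mu, forall t, P n t}.
  rewrite /P; case: unpickle => [pq|]; last exact: aeW.
  have [g|ng] := pselect (good pq); last by apply: aeW => t.
  move: g; apply: filterS; first exact: (ae_filter_ringOfSetsType mu).
  by move=> t Ht _.
have : {ae mu, forall t, forall n, P n t} by exact: ae_foralln.
apply: filterS; first exact: (ae_filter_ringOfSetsType mu).
move=> t Pt tA.
have : ~ ess_supp G t by move=> /HG.
rewrite /ess_supp /setC /= not_notE => -[U [oU aeU] Ut].
have [e /= e0 eU] : nbhs t U by rewrite nbhsE; exists U.
have := @rat_in_itvoo R (t - e) t; rewrite ltrBlDr ltrDl => /(_ e0)[p].
rewrite in_itv/= => /andP[p1 p2].
have := @rat_in_itvoo R t (t + e); rewrite ltrDl => /(_ e0)[q].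
rewrite in_itv/= => /andP[q1 q2].
have := Pt (pickle (p, q)); rewrite /P pickleK /=; apply; last by rewrite p2 q1.
move: aeU; apply: filterS; first exact: (ae_filter_ringOfSetsType mu).
move=> s Hs /= /andP[ps sq]; apply: Hs; apply: eU.
rewrite /ball/= ltr_norml; apply/andP; split; lra.
Qed.

Definition qtrunc F (n : nat) (x : R) : H := if - n%:R <= x <= n%:R then F x else 0.

Lemma qtrunc_patch F (p : H -> R) n : p 0 = 0 ->
  (fun x => p (qtrunc F n x)) = (fun x => p (F x)) \_ `[- n%:R, n%:R]%classic.
Proof.
move=> p0; apply/funext => x; rewrite /qtrunc patchE mem_setE /= in_itv/=.
by case: ifP.
Qed.

Lemma sqr_integrable_trunc F (p : H -> R) n : p 0 = 0 -> sqr_integrable (fun x => p (F x)) ->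
  sqr_integrable (fun x => p (qtrunc F n x)) /\ rintegrable setT (fun x => p (qtrunc F n x)).
Proof.
move=> p0 [mp ip].
have mD : measurable `[- n%:R : R, n%:R]%classic by exact: measurable_itv.
have mt : measurable_fun setT (fun x => p (qtrunc F n x)).
  by rewrite qtrunc_patch//; apply/(measurable_restrictT _ _).1 => //; exact: measurable_funTS.
split.
  split => //; apply: rintegrable_dominated ip => //; first exact: measurable_funX.
  move=> x _; rewrite ger0_norm ?sqr_ge0// /qtrunc; case: ifP => // _.
  by rewrite p0 expr0n sqr_ge0.
rewrite qtrunc_patch// /rintegrable -restrict_EFin.
apply: (proj1 (integrable_mkcond (mu:=mu) _ mD)).
exact: (sqr_integrable_segment _ _ (conj mp ip)).
Qed.

Lemma integral_qtrunc F (p : R -> H -> R) n : (forall x, p x 0 = 0) ->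
  \int[mu]_x p x (qtrunc F n x) = \int[mu]_(x in `[- n%:R, n%:R]) p x (F x).
Proof.
move=> p0; rewrite [RHS]Rintegral_mkcond; apply: eq_rintegral => x _.
rewrite /qtrunc patchE mem_setE /= in_itv/=.
by case: ifP.
Qed.

Let c : R := (Num.sqrt (2 * pi))^-1.

Lemma fourier1_qtrunc F n t :
  fourier1 (quat_i R) (qtrunc F n) t = Quat
    (truncated_transform c (fun x => qre (F x)) (fun x => qi (F x)) n t)
    (truncated_transform c (fun x => qi (F x)) (fun x => - qre (F x)) n t)
    (truncated_transform c (fun x => qj (F x)) (fun x => qk (F x)) n t)
    (truncated_transform c (fun x => qk (F x)) (fun x => - qj (F x)) n t).
Proof.
rewrite /fourier1 /qintegral /truncated_transform -/c.
congr Quat; rewrite /=; congr (_ * _).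
- rewrite -(@integral_qtrunc F (fun s q => cos (s * t) * qre q + sin (s * t) * qi q)) => [|x].
    by apply: eq_rintegral => x _; rewrite qexp_quat_i /=; ring.
  by rewrite /=; ring.
- rewrite -(@integral_qtrunc F (fun s q => cos (s * t) * qi q + sin (s * t) * - qre q)) => [|x].
    by apply: eq_rintegral => x _; rewrite qexp_quat_i /=; ring.
  by rewrite /=; ring.
- rewrite -(@integral_qtrunc F (fun s q => cos (s * t) * qj q + sin (s * t) * qk q)) => [|x].
    by apply: eq_rintegral => x _; rewrite qexp_quat_i /=; ring.
  by rewrite /=; ring.
- rewrite -(@integral_qtrunc F (fun s q => cos (s * t) * qk q + sin (s * t) * - qj q)) => [|x].
    by apply: eq_rintegral => x _; rewrite qexp_quat_i /=; ring.
  by rewrite /=; ring.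
Qed.

Lemma qtrunc_cvg F : qLp 2%:E F ->
  qLnorm 2%:E (fun x => qtrunc F n x - F x) @[n --> \oo] --> 0%E.
Proof.
move=> LF; apply/qLnorm2_cvg0.
have [s0 s1 s2 s3] := qLp2_sqr_integrable LF.
have [_ iS] := sqr_integrable_qLp2 s0 s1 s2 s3.
have cS := cvg_integral_segments iS.
have E n : qsqr_integral (fun x => qtrunc F n x - F x) = ((\int[mu]_x qsqr (F x)) -
    \int[mu]_(x in `[- n%:R, n%:R]) qsqr (F x))%:E.
  have mD : measurable `[- n%:R : R, n%:R]%classic by exact: measurable_itv.
  have iD : rintegrable setT ((fun x => qsqr (F x)) \_ `[- n%:R, n%:R]%classic).
    rewrite /rintegrable -restrict_EFin; apply: (proj1 (integrable_mkcond (mu:=mu) _ mD)).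
    exact: rintegrableS iS.
  rewrite [X in _ - X]Rintegral_mkcond -rintegralB// -integral_EFin; last exact: rintegrableB.
  apply: eq_integral => x _; congr EFin; rewrite patchE /qtrunc mem_setE /= in_itv/=.
  case: ifP => _; first by rewrite !subrr /qsqr /= !expr0n /= !addr0.
  by rewrite sub0r subr0 /qsqr /= !sqrrN.
rewrite (_ : (fun n => _) = (fun n => ((\int[mu]_x qsqr (F x)) -
    \int[mu]_(x in `[- n%:R, n%:R]) qsqr (F x))%:E)); last by apply/funext.
apply: cvg_EFin; first exact: nearW.
rewrite -(subrr (\int[mu]_x qsqr (F x))).
by apply: cvgB => //; exact: cvg_cst.
Qed.

Lemma qtrunc_qLp F n : qLp 2%:E F -> qLp 1%:E (qtrunc F n) /\ qLp 2%:E (qtrunc F n).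
Proof.
move=> LF; have [s0 s1 s2 s3] := qLp2_sqr_integrable LF.
have [t0 u0] := sqr_integrable_trunc n (erefl : qre (0 : H) = 0) s0.
have [t1 u1] := sqr_integrable_trunc n (erefl : qi (0 : H) = 0) s1.
have [t2 u2] := sqr_integrable_trunc n (erefl : qj (0 : H) = 0) s2.
have [t3 u3] := sqr_integrable_trunc n (erefl : qk (0 : H) = 0) s3.
by split; [apply: qintegrable_qLp1; split|case: (sqr_integrable_qLp2 t0 t1 t2 t3)].
Qed.

Lemma measurable_truncated_transform d (p q : R -> R) n :
  sqr_integrable p -> sqr_integrable q ->
  measurable_fun setT (truncated_transform d p q n).
Proof.
move=> sp sq; apply: continuous_measurable_fun.
exact: continuous_truncated_transform.
Qed.

Lemma L2_limit_le (h : nat -> R -> R) (g : R -> R) (Fn : nat -> R -> H) :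
  (forall n t, (h n t - g t) ^+ 2 <= qsqr (Fn n t)) ->
  (forall n, measurable_fun setT (fun t => h n t - g t)) ->
  (forall n, measurable_fun setT (fun t => qsqr (Fn n t))) ->
  (qsqr_integral (Fn n) @[n --> \oo] --> 0)%E -> L2_limit h g.
Proof.
move=> Hle mh mF; apply: (@squeeze_cvge _ _ _ _ (fun=> 0%E)); last exact: cvg_cst.
apply: nearW => n; apply/andP; split.
  by apply: integral_ge0 => t _; rewrite lee_fin sqr_ge0.
apply: ge0_le_integral => //.
- by move=> t _; rewrite lee_fin sqr_ge0.
- by apply/measurable_EFinP; exact: (measurable_funX 2 (mh n)).
- by apply/measurable_EFinP; exact: (mF n).
- by move=> t _; rewrite lee_fin.
Qed.

(** The truncations of [F] to [[- n, n]] are both integrable and square integrable and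
    tend to [F] in mean square, so their transforms tend to [G], coordinate by
    coordinate. *)
Lemma fourier_pairs F G : qLp 2%:E F -> is_fourier2 (quat_i R) F G ->
  fourier_pair c (fun x => qre (F x)) (fun x => qi (F x))
    (fun x => qre (G x)) (fun x => qi (G x)) /\
  fourier_pair c (fun x => qj (F x)) (fun x => qk (F x))
    (fun x => qj (G x)) (fun x => qk (G x)).
Proof.
move=> LF [LG HG].
have [s0 s1 s2 s3] := qLp2_sqr_integrable LF.
have [t0 t1 t2 t3] := qLp2_sqr_integrable LG.
pose h1 n := truncated_transform c (fun x => qre (F x)) (fun x => qi (F x)) n.
pose h2 n := truncated_transform c (fun x => qi (F x)) (fun x => - qre (F x)) n.
pose h3 n := truncated_transform c (fun x => qj (F x)) (fun x => qk (F x)) n.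
pose h4 n := truncated_transform c (fun x => qk (F x)) (fun x => - qj (F x)) n.
have m1 n : measurable_fun setT (fun t => h1 n t - qre (G t)).
  by apply: measurable_funB; [exact: measurable_truncated_transform|case: t0].
have m2 n : measurable_fun setT (fun t => h2 n t - qi (G t)).
  by apply: measurable_funB; [apply: measurable_truncated_transform => //;
    exact: sqr_integrableN|case: t1].
have m3 n : measurable_fun setT (fun t => h3 n t - qj (G t)).
  by apply: measurable_funB; [exact: measurable_truncated_transform|case: t2].
have m4 n : measurable_fun setT (fun t => h4 n t - qk (G t)).
  by apply: measurable_funB; [apply: measurable_truncated_transform => //;
    exact: sqr_integrableN|case: t3].
pose Fn n t := fourier1 (quat_i R) (qtrunc F n) t - G t.
have S0 : (qsqr_integral (Fn n) @[n --> \oo] --> 0)%E.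
  apply: (qLnorm2_cvg0 Fn).1.
  exact: (HG _ (fun n => qtrunc_qLp n LF) (qtrunc_cvg LF)).
have FnE n : Fn n = fun t => Quat (h1 n t - qre (G t)) (h2 n t - qi (G t))
    (h3 n t - qj (G t)) (h4 n t - qk (G t)).
  by apply/funext => t; rewrite /Fn fourier1_qtrunc.
have mF n : measurable_fun setT (fun t => qsqr (Fn n t)).
  by apply: measurable_qsqr; rewrite FnE; split; [exact: m1|exact: m2|exact: m3|exact: m4].
split; (split; [by split|by split| |]).
- apply: (L2_limit_le (h := h1) _ m1 mF S0) => n t; rewrite FnE /qsqr /=.
  by rewrite -!addrA lerDl !addr_ge0 ?sqr_ge0.
- apply: (L2_limit_le (h := h2) _ m2 mF S0) => n t; rewrite FnE /qsqr /=.
  by rewrite -!addrA addrCA lerDl !addr_ge0 ?sqr_ge0.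
- apply: (L2_limit_le (h := h3) _ m3 mF S0) => n t; rewrite FnE /qsqr /=.
  by rewrite addrAC lerDr !addr_ge0 ?sqr_ge0.
- apply: (L2_limit_le (h := h4) _ m4 mF S0) => n t; rewrite FnE /qsqr /=.
  by rewrite lerDr !addr_ge0 ?sqr_ge0.
Qed.

End PaleyWienerPairs.

(** * The identity theorem on slices *)

Section QuaternionFrechet.
Variable R : realType.
Local Notation H := (quat R).
Implicit Types (P : R -> R -> H).

Lemma qnormM (p q : H) : `|p * q| = `|p| * `|q|.
Proof.
by rewrite !qnormE -sqrtrM ?qsqr_ge0//; congr Num.sqrt; rewrite /qsqr /=; ring.
Qed.

Lemma norm_coord_le_qnorm (q : H) :
  [/\ `|qre q| <= `|q|, `|qi q| <= `|q|, `|qj q| <= `|q| & `|qk q| <= `|q|].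
Proof.
have gen (z : R) : z ^+ 2 <= qsqr q -> `|z| <= `|q|.
  by move=> h; rewrite qnormE -sqrtr_sqr ler_wsqrtr.
split; apply: gen; rewrite /qsqr.
- by rewrite -!addrA lerDl !addr_ge0 ?sqr_ge0.
- by rewrite -!addrA addrCA lerDl !addr_ge0 ?sqr_ge0.
- by rewrite addrAC lerDr !addr_ge0 ?sqr_ge0.
- by rewrite lerDr !addr_ge0 ?sqr_ge0.
Qed.

Definition qfrechet2 P (x y : R) (a b : H) := forall e, 0 < e ->
  exists2 d, 0 < d & forall h k, `|h| <= d -> `|k| <= d ->
    `|P (x + h) (y + k) - P x y - (h *: a + k *: b)| <= e * (`|h| + `|k|).

Lemma qfrechet2B P Q x y a b a' b' : qfrechet2 P x y a b -> qfrechet2 Q x y a' b' ->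
  qfrechet2 (fun x y => P x y - Q x y) x y (a - a') (b - b').
Proof.
move=> HP HQ e e0; have e20 : 0 < e / 2 by rewrite divr_gt0.
have [d1 d10 H1] := HP _ e20; have [d2 d20 H2] := HQ _ e20.
exists (Num.min d1 d2); first by rewrite lt_min d10.
move=> h k; rewrite !le_min => /andP[h1 h2] /andP[k1 k2].
rewrite (_ : _ - _ = (P (x + h) (y + k) - P x y - (h *: a + k *: b)) -
  (Q (x + h) (y + k) - Q x y - (h *: a' + k *: b'))); last first.
  by rewrite !scalerBr; congr Quat => /=; ring.
rewrite (le_trans (ler_normB _ _))// (le_trans (lerD (H1 _ _ h1 k1) (H2 _ _ h2 k2)))//.
by rewrite -mulrDl -splitr.
Qed.

Lemma qfrechet2M (J : H) P x y a b : qfrechet2 P x y a b ->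
  qfrechet2 (fun x y => J * P x y) x y (J * a) (J * b).
Proof.
move=> HP e e0.
have c0 : 0 < `|J| + 1 by rewrite ltr_wpDl.
have [d d0 Hd] := HP _ (divr_gt0 e0 c0).
exists d => // h k h1 k1.
rewrite !scalerAr -!mulrDr -!mulrBr qnormM.
apply: (@le_trans _ _ ((`|J| + 1) * `|P (x + h) (y + k) - P x y - (h *: a + k *: b)|)).
  by rewrite ler_wpM2r// lerDl.
by rewrite mulrC -ler_pdivlMr// mulrAC Hd.
Qed.

Lemma qfrechet2_coord P x y a b : qfrechet2 P x y a b ->
  [/\ frechet2 (fun x y => qre (P x y)) x y (qre a) (qre b),
      frechet2 (fun x y => qi (P x y)) x y (qi a) (qi b),
      frechet2 (fun x y => qj (P x y)) x y (qj a) (qj b) &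
      frechet2 (fun x y => qk (P x y)) x y (qk a) (qk b)].
Proof.
move=> HP; split=> e e0; have [d d0 Hd] := HP _ e0; exists d => // h k h1 k1;
  apply: le_trans (Hd h k h1 k1); rewrite (mulrC _ h) (mulrC _ k);
  by case: (norm_coord_le_qnorm (P (x + h) (y + k) - P x y - (h *: a + k *: b))).
Qed.

Lemma coord_qfrechet2 (P0 P1 P2 P3 : R -> R -> R) x y a0 a1 a2 a3 b0 b1 b2 b3 :
  frechet2 P0 x y a0 b0 -> frechet2 P1 x y a1 b1 ->
  frechet2 P2 x y a2 b2 -> frechet2 P3 x y a3 b3 ->
  qfrechet2 (fun x y => Quat (P0 x y) (P1 x y) (P2 x y) (P3 x y)) x y
    (Quat a0 a1 a2 a3) (Quat b0 b1 b2 b3).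
Proof.
move=> H0 H1 H2 H3 e e0; have e40 : 0 < e / 4 by rewrite divr_gt0.
have [d0 d00 {}H0] := H0 _ e40; have [d1 d10 {}H1] := H1 _ e40.
have [d2 d20 {}H2] := H2 _ e40; have [d3 d30 {}H3] := H3 _ e40.
exists (Num.min (Num.min d0 d1) (Num.min d2 d3)); first by rewrite !lt_min d00 d10 d20.
move=> h k; rewrite !le_min => /andP[/andP[h0 h1] /andP[h2 h3]].
move=> /andP[/andP[k0 k1] /andP[k2 k3]].
have := H0 _ _ h0 k0; have := H1 _ _ h1 k1; have := H2 _ _ h2 k2; have := H3 _ _ h3 k3.
rewrite !(mulrC _ h) !(mulrC _ k) => E3 E2 E1 E0.
rewrite (le_trans (qnorm_le _))// /=.
apply: le_trans (lerD (lerD (lerD E0 E1) E2) E3) _.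
by rewrite le_eqVlt; apply/orP; left; apply/eqP; field.
Qed.

(** Left multiplication by [I] makes [P] holomorphic on the slice: each real
    coordinate [p] of [P] has [- p (I * P)] as harmonic conjugate. *)
Lemma slice_identity (I : H) P (a : R -> R -> H) : I ^+ 2 = -1 ->
  (forall x y, qfrechet2 P x y (a x y) (I * a x y)) ->
  (forall x, P x 0 = 0) -> forall x y, 0 < y -> P x y = 0.
Proof.
move=> I2 HP P0 x y y0.
have HI x' y' := qfrechet2M I (HP x' y').
have I2a x' y' : I * (I * a x' y') = - a x' y' by rewrite mulrA -expr2 I2 mulN1r.
have gen (p : H -> R) : (forall q, p (- q) = - p q) -> p 0 = 0 ->
    (forall Q x y a b, qfrechet2 Q x y a b -> frechet2 (fun x y => p (Q x y)) x y (p a) (p b)) ->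
    p (P x y) = 0.
  move=> pN p0 Hp.
  apply: (@cauchy_riemann_identity R (fun x y => p (P x y)) (fun x y => (-1) * p (I * P x y))
     (fun x y => p (a x y)) (fun x y => - p (I * a x y))) => //.
  - by move=> x' y'; apply: frechet2_eq (Hp _ _ _ _ _ (HP x' y')) _ _; rewrite ?opprK.
  - move=> x' y'; apply: frechet2_eq (frechet2Z (-1) (Hp _ _ _ _ _ (HI x' y'))) _ _.
      by rewrite mulN1r.
    by rewrite I2a pN mulN1r opprK.
  - by move=> x'; rewrite P0.
  - by move=> x'; rewrite P0 mulr0 p0 mulr0.
have Hre := gen (@qre R) (fun=> erefl) erefl (fun Q x y a b h => let: And4 h0 _ _ _ :=
  qfrechet2_coord h in h0).
have Hi := gen (@qi R) (fun=> erefl) erefl (fun Q x y a b h => let: And4 _ h0 _ _ :=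
  qfrechet2_coord h in h0).
have Hj := gen (@qj R) (fun=> erefl) erefl (fun Q x y a b h => let: And4 _ _ h0 _ :=
  qfrechet2_coord h in h0).
have Hk := gen (@qk R) (fun=> erefl) erefl (fun Q x y a b h => let: And4 _ _ _ h0 :=
  qfrechet2_coord h in h0).
by move: Hre Hi Hj Hk; case: (P x y) => /= ? ? ? ? -> -> -> ->.
Qed.

Lemma differentiable_bound (f : H -> H) (q : H) : differentiable f q ->
  forall e, 0 < e -> exists2 d, 0 < d &
    forall v, `|v| <= d -> `|f (q + v) - f q - 'd f q v| <= e * `|v|.
Proof.
move=> /diff_locally /eqaddoP Hf e e0.
have /nbhs_ballP[d /= d0 Hd] := Hf e e0.
exists (d / 2); first by rewrite divr_gt0.
move=> v vd; have := Hd v; rewrite -ball_normE /= sub0r normrN.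
move=> /(_ _)/wrap[].
  by rewrite (le_lt_trans vd)// ltr_pdivrMr// mulr_natr mulr2n ltrDl.
by rewrite /= !fctE /= (addrC v) opprD addrA.
Qed.

Lemma derive1_of_bound (g : R -> H) (x : R) (a : H) :
  (forall e, 0 < e -> exists2 d, 0 < d &
     forall h, `|h| <= d -> `|g (x + h) - g x - h *: a| <= e * `|h|) ->
  derive1 g x = a.
Proof.
move=> Hg; rewrite /derive1; apply: cvg_lim; first exact: norm_hausdorff.
apply/cvgrPdist_le => /= e e0.
have [d d0 Hd] := Hg _ e0.
near=> h.
have h0 : h != 0 by near: h; exact: nbhs_dnbhs_neq.
rewrite distrC (_ : _ - a = h^-1 *: (g (x + h) - g x - h *: a)); last first.
  by rewrite [RHS]scalerBr scalerA mulVf// scale1r (addrC h).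
rewrite normrZ normfV mulrC ler_pdivrMr ?normr_gt0//.
by apply: Hd; near: h; exact: dnbhs0_le.
Unshelve. all: by end_near. Qed.

End QuaternionFrechet.

(** * Slice regular functions *)

Section SliceRegular.
Variable R : realType.
Local Notation H := (quat R).

Lemma qnorm1 : `|1 : H| = 1.
Proof. by rewrite qnormE /qsqr /= expr1n !expr0n /= !addr0 sqrtr1. Qed.

Lemma imag_unit_norm (I : H) : I ^+ 2 = -1 -> `|I| = 1.
Proof.
move=> I2; have : `|I| * `|I| = 1 by rewrite -qnormM -expr2 I2 normrN qnorm1.
by move/eqP; rewrite -expr2 sqrf_eq1 => /orP[/eqP//|/eqP n1];
  have := normr_ge0 I; rewrite n1 oppr_ge0 ler10.
Qed.

(** The total differential of [f] provides both partial derivatives on the slice, and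
    the equation of slice regularity says that the second is [I] times the first. *)
Lemma slice_regular_qfrechet2 (f : H -> H) (I : H) : slice_regular f -> I ^+ 2 = -1 ->
  exists a : R -> R -> H, forall x y,
    qfrechet2 (fun x y => f (x%:A + I * y%:A)) x y (a x y) (I * a x y).
Proof.
move=> [df CR] I2.
pose pt (x y : R) : H := x%:A + I * y%:A.
have ptD x y h k : pt (x + h) (y + k) = pt x y + (h *: 1 + k *: I).
  by rewrite /pt !scalerDl mulrDr -(scalerAr k) mulr1 addrACA.
have I1 := imag_unit_norm I2.
have one1 := qnorm1.
have Q x y : qfrechet2 (fun x y => f (pt x y)) x y ('d f (pt x y) 1) ('d f (pt x y) I).
  move=> e e0; have [d d0 Hd] := differentiable_bound (df (pt x y)) e0.
  exists (d / 2); first by rewrite divr_gt0.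
  move=> h k h1 k1; rewrite ptD.
  have vle : `|h *: (1 : H) + k *: I| <= `|h| + `|k|.
    by rewrite (le_trans (ler_normD _ _))// !normrZ one1 I1 !mulr1.
  have := Hd (h *: 1 + k *: I).
  rewrite linearD !linearZ /= => Hv.
  apply: le_trans (Hv _) _; last by rewrite ler_wpM2l// ltW.
  by rewrite (le_trans vle)// (splitr d) lerD.
exists (fun x y => 'd f (pt x y) 1) => x y.
have d1 : derive1 (fun s : R => f (s%:A + I * y%:A)) x = 'd f (pt x y) 1.
  apply: derive1_of_bound => e e0; have [d d0 Hd] := Q x y _ e0; exists d => // h hd.
  by have := Hd h 0 hd; rewrite normr0 !addr0 scale0r addr0; apply; rewrite ltW.
have d2 : derive1 (fun s : R => f (x%:A + I * s%:A)) y = 'd f (pt x y) I.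
  apply: derive1_of_bound => e e0; have [d d0 Hd] := Q x y _ e0; exists d => // h hd.
  by have := Hd 0 h; rewrite normr0 !addr0 scale0r !add0r; apply => //; rewrite ltW.
have := CR I I2 x y; rewrite d1 d2 => /eqP; rewrite scaler_eq0 invr_eq0 pnatr_eq0 /=.
rewrite addr_eq0 => /eqP E.
have -> : I * 'd f (pt x y) 1 = 'd f (pt x y) I.
  by rewrite E mulrN mulrA -expr2 I2 mulN1r opprK.
exact: Q.
Qed.

Lemma slice_decomposition (q : H) : exists (I : H) (x y : R),
  [/\ I ^+ 2 = -1, 0 <= y & q = x%:A + I * y%:A].
Proof.
case: q => a b c d.
pose r := Num.sqrt (b ^+ 2 + c ^+ 2 + d ^+ 2).
have s0 : 0 <= b ^+ 2 + c ^+ 2 + d ^+ 2 by rewrite !addr_ge0 ?sqr_ge0.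
have r2 : r ^+ 2 = b ^+ 2 + c ^+ 2 + d ^+ 2 by rewrite sqr_sqrtr.
have [r0|r0] := eqVneq r 0.
  (* A real quaternion lies in every slice. *)
  exists (quat_i R), a, 0; split => //; first exact: quat_i_sqr.
  move: r2; rewrite r0 expr0n /= => /esym/eqP.
  rewrite !paddr_eq0 ?addr_ge0 ?sqr_ge0// !sqrf_eq0 => /andP[/andP[/eqP -> /eqP ->] /eqP ->].
  by congr Quat => /=; ring.
exists (Quat 0 (b / r) (c / r) (d / r)), a, r; split; last 2 first.
- exact: sqrtr_ge0.
- by congr Quat => /=; field.
rewrite expr2; congr Quat => /=; try ring.
rewrite (_ : _ - _ = - ((b ^+ 2 + c ^+ 2 + d ^+ 2) / r ^+ 2)); last by field.
by rewrite -r2 divff ?expf_neq0//; ring.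
Qed.

End SliceRegular.

(** * Linearity of the quaternionic integral *)

Section QuaternionIntegral.
Variable R : realType.
Local Notation H := (quat R).
Local Notation mu := (@lebesgue_measure R).
Implicit Types F G : R -> H.

Lemma qintegrable_sqr (k : R -> R) F : sqr_integrable k -> qLp 2%:E F ->
  qintegrable (fun t => k t *: F t).
Proof.
move=> sk /qLp2_sqr_integrable[s0 s1 s2 s3]; split.
- exact: (sqr_integrableM sk s0).
- exact: (sqr_integrableM sk s1).
- exact: (sqr_integrableM sk s2).
- exact: (sqr_integrableM sk s3).
Qed.

Lemma qintegrableD F G : qintegrable F -> qintegrable G -> qintegrable (fun x => F x + G x).
Proof. by move=> [? ? ? ?] [? ? ? ?]; split; apply: rintegrableD. Qed.

Lemma qintegralD F G : qintegrable F -> qintegrable G ->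
  qintegral (fun x => F x + G x) = qintegral F + qintegral G.
Proof.
by move=> [? ? ? ?] [? ? ? ?]; congr Quat; rewrite /= rintegralD.
Qed.

Lemma qintegrableZ k F : qintegrable F -> qintegrable (fun x => k *: F x).
Proof. by move=> [? ? ? ?]; split; apply: rintegrableZ. Qed.

Lemma qintegralZ k F : qintegrable F -> qintegral (fun x => k *: F x) = k *: qintegral F.
Proof. by move=> [? ? ? ?]; congr Quat; rewrite /= rintegralZ. Qed.

Let lin4 (a b c d : R) (f0 f1 f2 f3 : R -> R) :
  rintegrable setT f0 -> rintegrable setT f1 -> rintegrable setT f2 -> rintegrable setT f3 ->
  rintegrable setT (fun x => a * f0 x + b * f1 x + c * f2 x + d * f3 x) /\
  \int[mu]_x (a * f0 x + b * f1 x + c * f2 x + d * f3 x) =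
  a * \int[mu]_x f0 x + b * \int[mu]_x f1 x + c * \int[mu]_x f2 x + d * \int[mu]_x f3 x.
Proof.
move=> i0 i1 i2 i3.
have j0 := rintegrableZ a measurableT i0; have j1 := rintegrableZ b measurableT i1.
have j2 := rintegrableZ c measurableT i2; have j3 := rintegrableZ d measurableT i3.
have j01 := rintegrableD measurableT j0 j1; have j012 := rintegrableD measurableT j01 j2.
split; first exact: rintegrableD.
rewrite (rintegralD measurableT j012 j3) (rintegralD measurableT j01 j2) (rintegralD measurableT j0 j1).
by rewrite !rintegralZ.
Qed.

Lemma qintegralM (J : H) F : qintegrable F ->
  qintegrable (fun x => J * F x) /\ qintegral (fun x => J * F x) = J * qintegral F.
Proof.
case: J => a b c d [i0 i1 i2 i3].
have [k0 e0] := lin4 a (- b) (- c) (- d) i0 i1 i2 i3.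
have [k1 e1] := lin4 b a (- d) c i0 i1 i2 i3.
have [k2 e2] := lin4 c d a (- b) i0 i1 i2 i3.
have [k3 e3] := lin4 d (- c) b a i0 i1 i2 i3.
have E0 x : qre (Quat a b c d * F x) = a * qre (F x) + (- b) * qi (F x) + (- c) * qj (F x) + (- d)
  * qk (F x).
  by rewrite /=; ring.
have E1 x : qi (Quat a b c d * F x) = b * qre (F x) + a * qi (F x) + (- d) * qj (F x) + c * qk (F x).
  by rewrite /=; ring.
have E2 x : qj (Quat a b c d * F x) = c * qre (F x) + d * qi (F x) + a * qj (F x) + (- b) * qk (F x).
  by rewrite /=; ring.
have E3 x : qk (Quat a b c d * F x) = d * qre (F x) + (- c) * qi (F x) + b * qj (F x) + a * qk (F x).
  by rewrite /=; ring.
split.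
  by split; under eq_fun do rewrite ?E0 ?E1 ?E2 ?E3.
rewrite /qintegral; congr Quat.
- by rewrite (eq_rintegral (g := fun x => a * qre (F x) + (- b) * qi (F x) + (- c) * qj (F x)
    + (- d) * qk (F x)))// e0 /=; ring.
- by rewrite (eq_rintegral (g := fun x => b * qre (F x) + a * qi (F x) + (- d) * qj (F x)
    + c * qk (F x)))// e1 /=; ring.
- by rewrite (eq_rintegral (g := fun x => c * qre (F x) + d * qi (F x) + a * qj (F x) + (- b)
    * qk (F x)))// e2 /=; ring.
- by rewrite (eq_rintegral (g := fun x => d * qre (F x) + (- c) * qi (F x) + b * qj (F x)
    + a * qk (F x)))// e3 /=; ring.
Qed.

End QuaternionIntegral.

(** * The sinc integral *)

Theorem theorem4p3 (R : realType) (A : R) (hA : 0 < A)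
    (f : quat R -> quat R) (hf : paley_wiener A f) (q : quat R) :
  qLp 1%:E (fun t : R => qsinc ((A / pi) *: (q - t%:A)) * f t%:A) /\
  f q = (A / pi) *:
    qintegral (fun t : R => qsinc ((A / pi) *: (q - t%:A)) * f t%:A).
Proof.
have [sf LF HI] := hf.
have [G [fG sG]] := HI (quat_i R) (quat_i_sqr R).
pose F (t : R) := f t%:A.
pose c : R := (Num.sqrt (2 * pi))^-1.
have pi0 := @pi_gt0 R.
have hc : 2 * c ^+ 2 * pi = 1.
  by rewrite /c exprVn sqr_sqrtr ?mulr_ge0 ?ltW// mulrAC divff// gt_eqF// mulr_gt0.
have [P1 P2] := fourier_pairs LF fG.
have aeG := ess_supp_ae sG.
have vanish (p1 p2 : quat R -> R) : p1 0 = 0 -> p2 0 = 0 ->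
    {ae @lebesgue_measure R, forall t, ~ `[- A, A]%classic t -> p1 (G t) = 0 /\ p2 (G t) = 0}.
  move=> h1 h2; move: aeG; apply: filterS; first exact: (ae_filter_ringOfSetsType (@lebesgue_measure R)).
  by move=> t Ht /Ht ->.
have cF : [/\ continuous (fun t => qre (F t)), continuous (fun t => qi (F t)),
      continuous (fun t => qj (F t)) & continuous (fun t => qk (F t))].
  have [a Ha] := slice_regular_qfrechet2 sf (quat_i_sqr R).
  have FE t : F t = f (t%:A + quat_i R * (0 : R)%:A) by rewrite /F scale0r mulr0 addr0.
  split=> t; under eq_fun do rewrite FE; have [h0 h1 h2 h3] := qfrechet2_coord (Ha t 0);
    [have := frechet2_derive1 h0|have := frechet2_derive1 h1|
     have := frechet2_derive1 h2|have := frechet2_derive1 h3];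
    exact: is_derive_continuous.
have [c0 c1 c2 c3] := cF.
have [U0 [V0 [dU0 dV0 b0]]] := ext_cauchy_riemann hA P1 c0 (vanish _ _ erefl erefl) hc.
have [U2 [V2 [dU2 dV2 b2]]] := ext_cauchy_riemann hA P2 c2 (vanish _ _ erefl erefl) hc.
have [U1 [V1 [dU1 dV1 b1]]] := ext_cauchy_riemann hA (fourier_pair_rot P1) c1
  (vanish (@qi R) (fun q => - qre q) erefl (oppr0 _)) hc.
have [U3 [V3 [dU3 dV3 b3]]] := ext_cauchy_riemann hA (fourier_pair_rot P2) c3
  (vanish (@qk R) (fun q => - qj q) erefl (oppr0 _)) hc.
(* The sinc integral at [x + I y] will be [U x y + I * V x y], with the same [U] and
   [V] for all [I]. *)
pose U x y := Quat (ext_re c A (fun t => qre (F t)) x y) (ext_re c A (fun t => qi (F t)) x y)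
  (ext_re c A (fun t => qj (F t)) x y) (ext_re c A (fun t => qk (F t)) x y).
pose V x y := Quat (ext_im c A (fun t => qre (F t)) x y) (ext_im c A (fun t => qi (F t)) x y)
  (ext_im c A (fun t => qj (F t)) x y) (ext_im c A (fun t => qk (F t)) x y).
pose X x y := Quat (U0 x y) (U1 x y) (U2 x y) (U3 x y).
pose Y x y := Quat (V0 x y) (V1 x y) (V2 x y) (V3 x y).
have dU x y : qfrechet2 U x y (X x y) (- Y x y).
  exact: (coord_qfrechet2 (dU0 x y) (dU1 x y) (dU2 x y) (dU3 x y)).
have dV x y : qfrechet2 V x y (Y x y) (X x y).
  exact: (coord_qfrechet2 (dV0 x y) (dV1 x y) (dV2 x y) (dV3 x y)).
have U00 x : U x 0 = F x.
  transitivity (Quat (qre (F x)) (qi (F x)) (qj (F x)) (qk (F x))); last by case: (F x).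
  by congr Quat; [exact: (b0 x).1|exact: (b1 x).1|exact: (b2 x).1|exact: (b3 x).1].
have V00 x : V x 0 = 0.
  by congr Quat; [exact: (b0 x).2|exact: (b1 x).2|exact: (b2 x).2|exact: (b3 x).2].
have [I [x [y [I2 y0 ->]]]] := slice_decomposition q.
have main : f (x%:A + I * y%:A) = U x y + I * V x y.
  move: y0; rewrite le_eqVlt => /predU1P[<-|y0].
    by rewrite scale0r mulr0 addr0 U00 V00 mulr0 addr0.
  have [a Ha] := slice_regular_qfrechet2 sf I2.
  apply/eqP; rewrite -subr_eq0 opprD addrA; apply/eqP.
  apply: (@slice_identity R I (fun x y => f (x%:A + I * y%:A) - U x y - I * V x y)
    (fun x y => a x y - X x y - I * Y x y) I2) => //.
    move=> x' y'.
    have D := qfrechet2B (qfrechet2B (Ha x' y') (dU x' y')) (qfrechet2M I (dV x' y')).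
    have -> : I * (a x' y' - X x' y' - I * Y x' y') = I * a x' y' - - Y x' y' - I * X x' y'.
      by rewrite !mulrBr mulrA -expr2 I2 mulN1r opprK addrAC.
    exact: D.
  by move=> x'; rewrite scale0r mulr0 addr0 U00 V00 mulr0 subr0 subrr.
have KE t : qsinc ((A / pi) *: (x%:A + I * y%:A - t%:A)) * f t%:A =
   (2 * A)^-1 *: (cos_kernel y (- A) A (t - x) *: F t + I * (sin_kernel y (- A) A (t - x) *: F t)).
  rewrite qsinc_kernel// -[LHS]scalerAl; congr (_ *: _).
  by rewrite mulrDl -[I * _ * _]mulrA !mulr_algl.
have AA : - A <= A by lra.
have jC : qintegrable (fun t => cos_kernel y (- A) A (t - x) *: F t).
  exact: qintegrable_sqr (sqr_integrable_cos_kernel y AA x) LF.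
have jS : qintegrable (fun t => sin_kernel y (- A) A (t - x) *: F t).
  exact: qintegrable_sqr (sqr_integrable_sin_kernel y AA x) LF.
have [jIS eIS] := qintegralM I jS.
have jK := qintegrableD jC jIS.
have FE : (fun t : R => qsinc ((A / pi) *: (x%:A + I * y%:A - t%:A)) * f t%:A) =
   (fun t => (2 * A)^-1 *: (cos_kernel y (- A) A (t - x) *: F t + I * (sin_kernel y (- A) A (t - x)
     *: F t))).
  exact/funext.
rewrite FE; split.
  by apply: qintegrable_qLp1; exact: qintegrableZ.
rewrite main qintegralZ// qintegralD// eIS.
have c2E : c ^+ 2 = A / pi * (2 * A)^-1.
  have -> : c ^+ 2 = (2 * pi)^-1.
    by rewrite /c exprVn sqr_sqrtr// mulr_ge0// ltW.
  by clear -hA; move: (@pi R) (@pi_gt0 R) => p p0; field; rewrite !gt_eqF.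
rewrite scalerA -c2E scalerDr scalerAr; congr (_ + _ * _).
- by congr Quat => /=; congr (_ * _); apply: eq_rintegral => t _; rewrite mulrC.
- by congr Quat => /=; congr (_ * _); apply: eq_rintegral => t _; rewrite mulrC.
Qed.
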